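(* Let $(M^3,J,\theta,f,\mu)$ be a closed three-dimensional CR Yamabe soliton. Then $\theta$ has constant Tanaka-Webster scalar curvature $W\equiv\mu$; that is, $f_0=0$ on $M$.
   Context: A pseudohermitian $3$-manifold $(M^3,J,\theta)$ is a smooth $3$-manifold with a global contact form $\theta$, oriented contact structure $\xi=\ker\theta$, and a smooth endomorphism $J:\xi\to\xi$ with $J^2=-\mathrm{Id}$. The Reeb field $\mathbf{T}$ is defined by $\theta(\mathbf{T})=1$, $d\theta(\mathbf{T},\cdot)=0$. Let $T_{1,0},T_{0,1}$ be the $\pm i$-eigenbundles of $J$ on $\mathbb{C}\otimes\xi$. Take a local frame $\{\mathbf{T},Z_1,Z_{\bar1}\}$ with $Z_1\in T_{1,0}$, $Z_{\bar1}=\overline{Z_1}$, dual coframe $\{\theta,\theta^1,\theta^{\bar1}\}$, normalized so that $d\theta=i\theta^1\wedge\theta^{\bar1}$. There is a unique purely imaginary $1$-form $\theta_1{}^1$ with $d\theta^1=\theta^1\wedge\theta_1{}^1+\theta\wedge A^1{}_{\bar1}\theta^{\bar1}$; the pseudohermitian torsion components are $A_{\bar1\bar1}=A^1{}_{\bar1}$ and $A_{11}=\overline{A_{\bar1\bar1}}$. The pseudohermitian connection is given by $\nabla Z_1=\theta_1{}^1\otimes Z_1$, $\nabla Z_{\bar1}=\overline{\theta_1{}^1}\otimes Z_{\bar1}$, $\nabla\mathbf{T}=0$. The Tanaka-Webster scalar curvature $W$ is the real function defined by $d\theta_1{}^1=W\theta^1\wedge\theta^{\bar1}+2i\,\mathrm{Im}(A_{11,\bar1}\theta^1\wedge\theta)$.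 Indices $0,1,\bar1$ on functions and tensor components denote covariant derivatives along $\mathbf{T},Z_1,Z_{\bar1}$ (e.g. $f_0=\mathbf{T}f$, $f_1=Z_1f$, $f_{11}=Z_1Z_1f-\theta_1{}^1(Z_1)Z_1f$). A CR Yamabe soliton $(M^3,J,\theta,f,\mu)$ is a pseudohermitian $3$-manifold with a smooth real function $f$ and a constant $\mu\in\mathbb{R}$ such that $W+\frac12 f_0=\mu$ and $f_{11}+iA_{11}f=0$. It is closed if $M$ is compact without boundary. *)

(* Defs.v *)
From HB Require Import structures.
From mathcomp Require Import all_boot all_order all_algebra.
From mathcomp Require Import complex.
From mathcomp Require Import all_classical all_reals all_analysis.
Set Implicit Arguments.
Unset Strict Implicit.
Unset Printing Implicit Defensive.
Import Order.TTheory GRing.Theory Num.Theory.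
Import numFieldNormedType.Exports.
Local Open Scope classical_set_scope.
Local Open Scope ring_scope.
Local Open Scope complex_scope.

(* For open V: all partial derivatives of order at most k exist and are
   continuous on V. *)
Fixpoint Ck (R : realType) (n k : nat) (V : set 'rV[R]_n)
    (g : 'rV[R]_n -> R) : Prop :=
  (forall x, V x -> {for x, continuous g}) /\
  match k with
  | 0 => True
  | k'.+1 => forall i : 'I_n,
      (forall x, V x -> derivable g x (delta_mx 0 i)) /\
      Ck k' V (fun x => 'D_(delta_mx 0 i) g x)
  end.

Definition Cinf (R : realType) (n : nat) (V : set 'rV[R]_n)
  (g : 'rV[R]_n -> R) : Prop := forall k, Ck k V g.

(* A homeomorphism [cmap] from the open set [cdom] of M onto an open set of
   R^n, with inverse [cinv]; both maps are junk outside these sets. *)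
Record chart (R : realType) (n : nat) (M : topologicalType) := Chart {
  cdom : set M;
  cmap : M -> 'rV[R]_n;
  cinv : 'rV[R]_n -> M;
  cdom_open : open cdom;
  cimg_open : open (cmap @` cdom);
  cmapK : forall p, cdom p -> cinv (cmap p) = p;
  cmap_cont : forall p, cdom p -> {for p, continuous cmap};
  cinv_cont : forall x, (cmap @` cdom) x -> {for x, continuous cinv} }.

Definition transition_smooth (R : realType) (n : nat) (M : topologicalType)
    (c d : chart R n M) : Prop :=
  forall j : 'I_n,
    Cinf (cmap c @` (cdom c `&` cdom d)) (fun x => cmap d (cinv c x) 0 j).

Record manifold (R : realType) (n : nat) := Manifold {
  carrier :> topologicalType;
  atlas : set (chart R n carrier);
  atlas_cover : forall p, exists2 c, atlas c & cdom c p;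
  atlas_compat : forall c d, atlas c -> atlas d -> transition_smooth c d;
  manifold_hausdorff : hausdorff_space carrier;
  manifold_countable : @second_countable carrier }.

(* All objects on M are complexified: functions are complex valued, tangent
   vectors are complex derivations (elements of C (x) T_pM), and real objects
   are those commuting with conjugation. *)
Section Calculus.
Variables (R : realType) (n : nat) (M : manifold R n).
Local Notation C := R[i].

Definition func := M -> C.
Definition vec := func -> C.
Definition vfield := M -> vec.
Definition form1 := M -> vec -> C.
Definition form2 := vfield -> vfield -> func.

Definition smooth_on (U : set M) (f : func) : Prop :=
  forall c, @atlas R n M c ->
    Cinf (cmap c @` (U `&` cdom c)) (fun x => complex.Re (f (cinv c x))) /\
    Cinf (cmap c @` (U `&` cdom c)) (fun x => complex.Im (f (cinv c x))).

Definition smooth_at (p : M) (f : func) : Prop :=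
  exists U, [/\ open U, U p & smooth_on U f].

(* A derivation at p on the functions smooth near p. The value 0 is imposed on
   all other functions so that equality of tangent vectors is equality of
   functions; locality follows from the Leibniz rule since cut-off functions
   need only be smooth near p. *)
Record tangent (p : M) (v : vec) : Prop := Tangent {
  tangent_linear : forall (a : C) (f g : func),
    smooth_at p f -> smooth_at p g ->
    v (fun q => a * f q + g q) = a * v f + v g;
  tangent_leibniz : forall f g : func,
    smooth_at p f -> smooth_at p g ->
    v (fun q => f q * g q) = v f * g p + f p * v g;
  tangent_junk : forall f : func, ~ smooth_at p f -> v f = 0 }.

Definition conjv (v : vec) : vec := fun f => conjc (v (fun q => conjc (f q))).
Definition conj_field (X : vfield) : vfield := fun p => conjv (X p).

Record smooth_vfield (U : set M) (X : vfield) : Prop := SmoothVfield {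
  vfield_tangent : forall p, U p -> tangent p (X p);
  vfield_smooth : forall (V : set M) (f : func), open V -> V `<=` U ->
    smooth_on V f -> smooth_on V (fun q => X q f) }.

Definition real_vfield (U : set M) (X : vfield) : Prop :=
  smooth_vfield U X /\ forall p, U p -> conjv (X p) = X p.

(* The case distinction is the normalization of [tangent_junk]. *)
Definition lie_bracket (X Y : vfield) : vfield := fun p f =>
  if `[< smooth_at p f >]
  then X p (fun q => Y q f) - Y p (fun q => X q f) else 0.

Record smooth_form1 (U : set M) (w : form1) : Prop := SmoothForm1 {
  form1_linear : forall p, U p -> forall (a : C) (v v' : vec),
    tangent p v -> tangent p v' ->
    w p (fun f => a * v f + v' f) = a * w p v + w p v';
  form1_smooth : forall (V : set M) (X : vfield), open V -> V `<=` U ->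
    smooth_vfield V X -> smooth_on V (fun q => w q (X q)) }.

Definition conj_form1 (w : form1) : form1 := fun p v => conjc (w p (conjv v)).

Definition scale_form1 (A : func) (w : form1) : form1 := fun p v => A p * w p v.

Definition real_form1 (U : set M) (w : form1) : Prop :=
  forall p v, U p -> tangent p v -> conj_form1 w p v = w p v.

Definition imaginary_form1 (U : set M) (w : form1) : Prop :=
  forall p v, U p -> tangent p v -> conj_form1 w p v = - w p v.

(* 2-forms are given by their values on pairs of local vector fields, with
   the conventions  (a /\ b)(X, Y) = a(X) b(Y) - a(Y) b(X)  and
   dw(X, Y) = X(w(Y)) - Y(w(X)) - w([X, Y]). *)
Definition wedge (a b : form1) : form2 := fun X Y p =>
  a p (X p) * b p (Y p) - a p (Y p) * b p (X p).

Definition dform (w : form1) : form2 := fun X Y p =>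
  X p (fun q => w q (Y q)) - Y p (fun q => w q (X q))
  - w p (lie_bracket X Y p).

Definition scale_form2 (A : func) (a : form2) : form2 :=
  fun X Y p => A p * a X Y p.

Definition add_form2 (a b : form2) : form2 := fun X Y p => a X Y p + b X Y p.

Definition im_form2 (a : form2) : form2 := fun X Y p =>
  (a X Y p - conjc (a (conj_field X) (conj_field Y) p)) / (2%:R * 'i%C).

Definition eq_form2 (U : set M) (a b : form2) : Prop :=
  forall (V : set M) (X Y : vfield), open V -> V `<=` U ->
    smooth_vfield V X -> smooth_vfield V Y ->
    forall p, V p -> a X Y p = b X Y p.

Definition wedge12 (a : form1) (b : form2) (X Y Z : vfield) : func := fun p =>
  a p (X p) * b Y Z p - a p (Y p) * b X Z p + a p (Z p) * b X Y p.

End Calculus.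

Section Pseudohermitian.
Variables (R : realType) (M : manifold R 3).
Local Notation C := R[i].

Definition contact_form (theta : form1 M) : Prop :=
  [/\ smooth_form1 setT theta, real_form1 setT theta &
      forall p : M, exists (U : set M) (X Y Z : vfield M),
        [/\ open U, U p, smooth_vfield U X, smooth_vfield U Y &
            smooth_vfield U Z /\ wedge12 theta (dform theta) X Y Z p != 0]].

(* C (x) ker theta *)
Definition in_xi (theta : form1 M) (p : M) (v : vec M) : Prop :=
  tangent p v /\ theta p v = 0.

(* [J p] is the complex linear extension to C (x) xi_p of an endomorphism of
   xi_p. The contact planes are oriented by d theta, and J is compatible with
   this orientation ([J_positive]); for a J of the opposite orientation no
   frame satisfies d theta = i theta^1 /\ theta^{1bar}. *)
Record pseudohermitian (theta : form1 M) (J : M -> vec M -> vec M) : Prop :=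
  Pseudohermitian {
  theta_contact : contact_form theta;
  J_xi : forall p v, in_xi theta p v -> in_xi theta p (J p v);
  J_linear : forall p (a : C) v w, in_xi theta p v -> in_xi theta p w ->
    J p (fun f => a * v f + w f) = (fun f => a * J p v f + J p w f);
  J_real : forall p v, in_xi theta p v -> J p (conjv v) = conjv (J p v);
  J_square : forall p v, in_xi theta p v -> J p (J p v) = (fun f => - v f);
  J_smooth : forall (U : set M) (X : vfield M), open U -> smooth_vfield U X ->
    (forall p, U p -> theta p (X p) = 0) ->
    smooth_vfield U (fun p => J p (X p));
  J_positive : forall (U : set M) (X : vfield M), open U -> real_vfield U X ->
    (forall p, U p -> theta p (X p) = 0) ->
    forall p, U p -> X p <> (fun=> 0) ->
    0 < dform theta X (fun q => J q (X q)) p }.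

Definition reeb_field (theta : form1 M) (T : vfield M) : Prop :=
  [/\ real_vfield setT T, forall p, theta p (T p) = 1 &
      forall (U : set M) (Y : vfield M), open U -> smooth_vfield U Y ->
        forall p, U p -> dform theta T Y p = 0].

(* [T], [Z1], [conj_field Z1] is a frame on U with Z1 of type (1,0), with dual
   coframe [theta], [theta1], [conj_form1 theta1], normalized by
   d theta = i theta^1 /\ theta^{1bar}. *)
Record admissible_frame (theta : form1 M) (J : M -> vec M -> vec M)
    (T : vfield M) (U : set M) (Z1 : vfield M) (theta1 : form1 M) : Prop :=
  AdmissibleFrame {
  frame_open : open U;
  frame_Z1 : smooth_vfield U Z1;
  frame_theta1 : smooth_form1 U theta1;
  frame_xi : forall p, U p -> theta p (Z1 p) = 0;
  frame_type : forall p, U p -> J p (Z1 p) = (fun f => 'i%C * Z1 p f);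
  frame_dual : forall p, U p ->
    [/\ theta1 p (T p) = 0, theta1 p (Z1 p) = 1 &
        theta1 p (conj_field Z1 p) = 0];
  frame_span : forall p v, U p -> tangent p v ->
    v = (fun f => theta p v * T p f + theta1 p v * Z1 p f
                  + conj_form1 theta1 p v * conj_field Z1 p f);
  frame_normalized :
    eq_form2 U (dform theta)
      (scale_form2 (fun=> 'i%C) (wedge theta1 (conj_form1 theta1))) }.

(* omega is the connection form theta_1^1, and A is the component
   A^1_{1bar} = A_{1bar 1bar} of the torsion; A_{11} is its conjugate. *)
Record connection_torsion (theta : form1 M) (U : set M) (theta1 : form1 M)
    (omega : form1 M) (A : func M) : Prop := ConnectionTorsion {
  connection_smooth : smooth_form1 U omega;
  connection_imaginary : imaginary_form1 U omega;
  torsion_smooth : smooth_on U A;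
  structure_equation :
    eq_form2 U (dform theta1)
      (add_form2 (wedge theta1 omega)
         (wedge theta (scale_form1 A (conj_form1 theta1)))) }.

Definition A11 (A : func M) : func M := fun p => conjc (A p).

(* Since nabla theta^1 = - omega (x) theta^1, the covariant derivative of the
   tensor A_{11} theta^1 (x) theta^1 along Z_{1bar} is
   Z_{1bar} A_{11} - 2 omega(Z_{1bar}) A_{11}. *)
Definition A11_1bar (Z1 : vfield M) (omega : form1 M) (A : func M) : func M :=
  fun p => conj_field Z1 p (A11 A)
           - 2%:R * omega p (conj_field Z1 p) * A11 A p.

Definition webster_curvature (theta : form1 M) (J : M -> vec M -> vec M)
    (T : vfield M) (W : M -> R) : Prop :=
  forall U Z1 theta1 omega A,
    admissible_frame theta J T U Z1 theta1 ->
    connection_torsion theta U theta1 omega A ->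
    eq_form2 U (dform omega)
      (add_form2
         (scale_form2 (fun p => (W p)%:C) (wedge theta1 (conj_form1 theta1)))
         (scale_form2 (fun=> 2%:R * 'i%C)
            (im_form2 (scale_form2 (A11_1bar Z1 omega A)
                         (wedge theta1 theta))))).

Definition cfun (f : M -> R) : func M := fun p => (f p)%:C.

Definition d0 (T : vfield M) (f : M -> R) : func M := fun p => T p (cfun f).

Definition d11 (Z1 : vfield M) (omega : form1 M) (f : M -> R) : func M :=
  fun p => Z1 p (fun q => Z1 q (cfun f)) - omega p (Z1 p) * Z1 p (cfun f).

Record cr_yamabe_soliton (theta : form1 M) (J : M -> vec M -> vec M)
    (T : vfield M) (W f : M -> R) (mu : R) : Prop := CRYamabeSoliton {
  soliton_pseudohermitian : pseudohermitian theta J;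
  soliton_reeb : reeb_field theta T;
  soliton_webster : webster_curvature theta J T W;
  soliton_smooth : smooth_on setT (cfun f);
  soliton_curvature : forall p, (W p)%:C + 2%:R^-1 * d0 T f p = mu%:C;
  soliton_hessian : forall U Z1 theta1 omega A,
    admissible_frame theta J T U Z1 theta1 ->
    connection_torsion theta U theta1 omega A ->
    forall p, U p -> d11 Z1 omega f p + 'i%C * A11 A p * (f p)%:C = 0 }.

End Pseudohermitian.

(* Main.v *)
Require Import Defs.
From HB Require Import structures.
From mathcomp Require Import all_boot all_order all_algebra.
From mathcomp Require Import complex.
From mathcomp Require Import all_classical all_reals all_analysis.
From mathcomp Require Import perm ring lra zify.
Set Implicit Arguments.
Unset Strict Implicit.
Unset Printing Implicit Defensive.
Import Order.TTheory GRing.Theory Num.Theory.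
Import numFieldNormedType.Exports.
Local Open Scope classical_set_scope.
Local Open Scope ring_scope.
Local Open Scope complex_scope.

(** Let [T], [Z], [Y] be the Reeb field and an admissible frame, [Y] being the
    conjugate of [Z].  The idea is an integral identity found pointwise: the real
    field
      [X = (mu f - f W) T + B Y + conj(B) Z], [B = f A_{11,1bar} - A_11 f_1bar],
    has divergence [f_0^2 / 2] with respect to the volume form
    [theta /\ d theta].  On a closed manifold the integral of a divergence is zero,
    hence [f_0 = 0], and then [W = mu] by the soliton equation.

    The divergence is computed with the structure functions
      [[Z, Y] = - i T + alpha Z - conj(alpha) Y], [[T, Z] = beta Z + gamma Y].
    The structure equation forces the connection form to be
    [conj(alpha) theta1 - alpha theta1bar + beta theta] and the torsion [A_11] to be
    [- gamma] ([frame_connection]); that [beta] is imaginary is a component of the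
    Jacobi identity ([jacobi_frame]).  The other components give the Bianchi
    identity [W_0 = A_{11,1bar 1bar} + conj] ([bianchi]), and with the Hessian
    equation [f_11 = - i A_11 f] everything in the divergence of [X] cancels except
    [(mu - W) f_0 = f_0^2 / 2] ([divergence_identity]).  A change of frame
    multiplies [Z] and [B] by the same function of modulus one, so that [X] is
    globally defined ([fr_field_change]); admissible frames exist near every point
    by normalizing [H - i J H] for a real field [H] in the contact planes
    ([admissible_frame_exists]).

    The divergence theorem is obtained without any integral over the manifold.
    For a function [g] on R^n, [null g] says that the Riemann sums of [g] over
    finer and finer lattices tend to zero; this is the statement that the integral
    of [g] vanishes.  Two facts about such sums are enough: partial
    derivatives of compactly supported functions are null, because a lattice is
    invariant under translation by a mesh ([null_partial]), and a nonnegative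
    continuous function that is positive somewhere is not null ([not_null]).  The
    change of variables formula follows from the first fact: along a homotopy
    [psi_s] the derivative in [s] of [f (psi_s) * jac psi_s] is a divergence
    ([piola]), so that a diffeomorphism can be deformed near a point to its affine
    part ([local_change_of_variables]) and an invertible matrix, factor by factor,
    to a symmetry of the lattice ([linv_all]).  Partitions of unity then globalize
    the formula to [nonneg_divergence_eq0].

    Tangent vectors being derivations, Hadamard's lemma ([hadamard]) is needed to
    expand them in coordinate fields ([tangent_expand]). *)

(** * Calculus on open subsets of R^n *)

Notation "''e_' i" := (delta_mx (0 : 'I_1) i) (at level 8, i at level 2, format "''e_' i") : ring_scope.
Notation "'re z" := (complex.Re z) (at level 10, z at level 8) : ring_scope.
Notation "'im z" := (complex.Im z) (at level 10, z at level 8) : ring_scope.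

Lemma near_all (T : topologicalType) (I : finType) (x : T) (P : I -> T -> Prop) :
  (forall i, \forall y \near x, P i y) -> \forall y \near x, forall i, P i y.
Proof. by move=> H; exact: (@filter_forall _ I P (nbhs x) (nbhs_filter x) H). Qed.

Lemma cont_distP (R : realType) (T : topologicalType) (g : T -> R) (x : T) :
  (forall e, 0 < e -> \forall y \near x, `|g x - g y| <= e) -> {for x, continuous g}.
Proof. by move=> H; apply/cvgrPdist_le. Qed.

Lemma cont_dist_lt (R : realType) (T : topologicalType) (g : T -> R) (x : T) (e : R) :
  {for x, continuous g} -> 0 < e -> \forall y \near x, `|g x - g y| < e.
Proof. by move=> /cvgrPdist_lt H; exact: H. Qed.

Section LineDerivative.
Variables (R : realType) (V : normedModType R).
Implicit Types (g : V -> R) (y e : V).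

Lemma is_derive_lineE g y e (s d : R) :
  is_derive s 1 (fun r : R => g (y + r *: e)) d <-> is_derive (y + s *: e) e g d.
Proof.
have E : (fun h : R => h^-1 *: (((fun r : R => g (y + r *: e)) \o shift s) (h *: 1)
            - g (y + s *: e)))
       = (fun h : R => h^-1 *: ((g \o shift (y + s *: e)) (h *: e) - g (y + s *: e))).
  apply/funext => h /=; congr (_ *: (g _ - _)).
  by rewrite scalerDl addrCA -scalerA scale1r.
split=> -[]; rewrite /derivable /derive => d1 d2; apply: DeriveDef.
- by rewrite /derivable -E.
- by rewrite /derive -E.
- by rewrite /derivable E.
- by rewrite /derive E.
Qed.

Lemma is_derive_line g y e (s : R) : derivable g (y + s *: e) e ->
  is_derive s 1 (fun r : R => g (y + r *: e)) ('D_e g (y + s *: e)).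
Proof. by move=> dg; apply/is_derive_lineE/derivableP. Qed.

Lemma is_derive_comp1 g (phi : R -> R) y e (a : R) :
  is_derive (g y) 1 phi a -> derivable g y e ->
  is_derive y e (fun x => phi (g x)) (a * 'D_e g y).
Proof.
move=> dphi dg; have E : y = y + (0 : R) *: e by rewrite scale0r addr0.
rewrite [X in is_derive X]E; apply/is_derive_lineE.
apply: (@is_derive1_comp _ phi (fun r => g (y + r *: e))); first by rewrite -E.
by rewrite {2}E; apply: is_derive_line; rewrite -E.
Qed.

Lemma MVT_line g y e (t : R) :
  (forall s, `|s| <= `|t| -> derivable g (y + s *: e) e) ->
  exists2 s, `|s| <= `|t| & g (y + t *: e) - g y = t * 'D_e g (y + s *: e).
Proof.
move=> dg; pose p r := g (y + r *: e); pose dp r := 'D_e g (y + r *: e).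
have dpP (s : R) : `|s| <= `|t| -> is_derive s 1 p (dp s).
  by move=> st; apply/is_derive_line/dg.
have cp (a b : R) : (forall s : R, s \in `[a, b] -> `|s| <= `|t|) -> {within `[a, b], continuous p}.
  move=> ab; apply: derivable_within_continuous => s sab.
  by have [] := dpP _ (ab _ sab).
have p0 : p 0 = g y by rewrite /p scale0r addr0.
have [t0|t0|t0] := ltgtP t 0.
- have b (s : R) : s \in `[t, 0] -> `|s| <= `|t|.
    by rewrite in_itv/= => /andP[ts s0]; rewrite !ler0_norm ?(ltW t0)// lerN2.
  have [s sI E] := MVT t0 (fun s sI => dpP s (b s (subset_itv_oo_cc sI))) (cp _ _ b).
  exists s; first exact/b/subset_itv_oo_cc.
  by rewrite -p0 -opprB -/(p t) E sub0r mulrN opprK mulrC.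
- have b (s : R) : s \in `[0, t] -> `|s| <= `|t|.
    by rewrite in_itv/= => /andP[s0 st]; rewrite !ger0_norm ?(ltW t0).
  have [s sI E] := MVT t0 (fun s sI => dpP s (b s (subset_itv_oo_cc sI))) (cp _ _ b).
  exists s; first exact/b/subset_itv_oo_cc.
  by rewrite -p0 -/(p t) E subr0 mulrC.
- by exists 0; rewrite ?normr0 ?normr_ge0// t0 scale0r addr0 subrr mul0r.
Qed.

End LineDerivative.

Section DeriveLambda.
Variables (R : realType) (V : normedModType R).
Implicit Types (g h : V -> R) (x v : V).

Lemma is_deriveDx g h x v dg dh : is_derive x v g dg -> is_derive x v h dh ->
  is_derive x v (fun y => g y + h y) (dg + dh).
Proof. exact: is_deriveD. Qed.

Lemma is_deriveBx g h x v dg dh : is_derive x v g dg -> is_derive x v h dh ->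
  is_derive x v (fun y => g y - h y) (dg - dh).
Proof. exact: is_deriveB. Qed.

Lemma is_deriveMx g h x v dg dh : is_derive x v g dg -> is_derive x v h dh ->
  is_derive x v (fun y => g y * h y) (dg * h x + g x * dh).
Proof.
move=> dgx dhx; have := is_deriveM dgx dhx.
by rewrite addrC [h x *: _]mulrC.
Qed.

Lemma is_deriveZx (a : R) h x v dh : is_derive x v h dh ->
  is_derive x v (fun y => a * h y) (a * dh).
Proof.
move=> dhx; have := is_deriveMx (is_derive_cst a x v) dhx.
by rewrite mul0r add0r.
Qed.

End DeriveLambda.

Section Ck.
Variables (R : realType) (n : nat).
Implicit Types (V : set 'rV[R]_n) (g h : 'rV[R]_n -> R) (x : 'rV[R]_n).

Lemma Ck_sub k V V' g : V' `<=` V -> Ck k V g -> Ck k V' g.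
Proof.
move=> VV'; elim: k g => [|k IH] g /= [cg H]; (split=> [x /VV'/cg//|//]).
move=> i.
by have [dg Dg] := H i; split=> [x /VV'/dg//|]; exact: IH.
Qed.

Lemma Ck_cont k V g x : Ck k V g -> V x -> {for x, continuous g}.
Proof. by case: k => [|k] [cg _] /cg. Qed.

Lemma Ck_pred k V g : Ck k.+1 V g -> Ck k V g.
Proof.
elim: k g => [|k IH] g [cg H]; split=> // i.
by have [dg Dg] := H i; split=> //; apply: IH.
Qed.

Lemma Ck_derivable k V g x i : Ck k.+1 V g -> V x -> derivable g x 'e_i.
Proof. by move=> [_ /(_ i)[dg _]] /dg. Qed.

Lemma Ck_D k V g i : Ck k.+1 V g -> Ck k V (fun x => 'D_'e_i g x).
Proof. by move=> [_ /(_ i)[]]. Qed.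

Lemma Ck_near k V g h : (forall x, V x -> \forall y \near x, g y = h y) ->
  Ck k V g -> Ck k V h.
Proof.
have cgh g' h' : (forall x, V x -> \forall y \near x, g' y = h' y) ->
    (forall x, V x -> {for x, continuous g'}) -> forall x, V x -> {for x, continuous h'}.
  move=> gh cg x Vx; rewrite /prop_for/= /continuous_at -(nbhs_singleton (gh x Vx)).
  have c : g' @ x --> g' x by exact: cg.
  exact: cvg_trans (near_eq_cvg (gh x Vx)) c.
elim: k g h => [|k IH] g h gh /= [cg H]; (split; first exact: cgh gh cg); first by [].
move=> i; have [dg Dg] := H i; split=> [x Vx|].
  exact: near_eq_derivable (gh x Vx) (dg x Vx).
apply: IH Dg => x Vx; have := near_join (gh x Vx); apply: filterS => y gy.
exact: near_eq_derive.
Qed.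

Lemma Ck_open_eq k V g h : open V -> (forall x, V x -> g x = h x) ->
  Ck k V g -> Ck k V h.
Proof.
move=> oV gh; apply: Ck_near => x Vx.
by apply: filterS (open_nbhs_nbhs (conj oV Vx)) => y /gh.
Qed.

(** Each condition in [Ck k V g] is imposed at single points of [V], so that case
    distinctions can be made at each point separately. *)
Lemma Ck_pointwise k V g : (forall x, V x -> Ck k [set x] g) -> Ck k V g.
Proof.
elim: k g => [|k IH] g H; (split=> [x Vx|//]); try exact: Ck_cont (H x Vx) _.
move=> i.
split=> [x Vx|]; first exact: Ck_derivable (H x Vx) _.
by apply: IH => x Vx; apply: Ck_D; exact: H.
Qed.

Lemma Ck_cst k V (a : R) : Ck k V (fun=> a).
Proof.
elim: k a => [|k IH] a; (split=> [x _|//]); first exact: cst_continuous.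
  exact: cst_continuous.
move=> i; split=> [x _|]; first exact: derivable_cst.
have -> : (fun x => 'D_'e_i (fun=> a) x) = (fun=> 0) :> ('rV[R]_n -> R).
  by apply/funext => x; exact: derive_cst.
exact: IH.
Qed.

Lemma CkD k V g h : open V -> Ck k V g -> Ck k V h -> Ck k V (fun x => g x + h x).
Proof.
move=> oV; elim: k g h => [|k IH] g h [cg Hg] [ch Hh]; (split=> [x Vx|//]).
- by apply: continuousD; [exact: cg|exact: ch].
- by apply: continuousD; [exact: cg|exact: ch].
move=> i; have [dg Dg] := Hg i; have [dh Dh] := Hh i; split=> [x Vx|].
  by apply: derivableD; [exact: dg|exact: dh].
apply: (Ck_open_eq oV _ (IH _ _ Dg Dh)) => x Vx.
by rewrite -deriveD; [|exact: dg|exact: dh].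
Qed.

Lemma CkM k V g h : open V -> Ck k V g -> Ck k V h -> Ck k V (fun x => g x * h x).
Proof.
move=> oV; elim: k g h => [|k IH] g h [cg Hg] [ch Hh]; (split=> [x Vx|//]).
- by apply: continuousM; [exact: cg|exact: ch].
- by apply: continuousM; [exact: cg|exact: ch].
move=> i; have [dg Dg] := Hg i; have [dh Dh] := Hh i; split=> [x Vx|].
  by apply: derivableM; [exact: dg|exact: dh].
have gk : Ck k V g by exact: Ck_pred (conj cg Hg).
have hk : Ck k V h by exact: Ck_pred (conj ch Hh).
apply: (Ck_open_eq oV _ (CkD oV (IH _ _ gk Dh) (IH _ _ hk Dg))) => x Vx.
by rewrite deriveM; [|exact: dg|exact: dh].
Qed.

Lemma CkV k V g : open V -> (forall x, V x -> g x != 0) ->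
  Ck k V g -> Ck k V (fun x => (g x)^-1).
Proof.
move=> oV g0; elim: k => [|k IH] [cg Hg]; (split=> [x Vx|//]).
- by apply: continuousV; [exact: g0|exact: cg].
- by apply: continuousV; [exact: g0|exact: cg].
move=> i; have [dg Dg] := Hg i; split=> [x Vx|].
  by apply: derivableV; [exact: g0|exact: dg].
have gk := IH (Ck_pred (conj cg Hg)).
apply: (Ck_open_eq oV _ (CkM oV (Ck_cst k V (-1)) (CkM oV (CkM oV gk gk) Dg))) => x Vx.
rewrite deriveV; [|exact: g0|exact: dg].
by rewrite mulN1r scaleNr -exprVn expr2.
Qed.

(** A composition with a function of one variable all of whose derivatives are
    known.  The family [phi] is indexed by an arbitrary type so that one
    application covers a class of functions closed under derivation. *)
Lemma Ck_comp1 (D : set R) (I : Type) (phi : I -> R -> R)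
  (dphi : I -> seq (R * I)) k V g :
  open V ->
  (forall j t, D t -> is_derive t 1 (phi j) (\sum_(c <- dphi j) c.1 * phi c.2 t)) ->
  (forall x, V x -> D (g x)) -> Ck k V g ->
  forall j, Ck k V (fun x => phi j (g x)).
Proof.
move=> oV dphiP DV; elim: k => [|k IH] [cg Hg] j.
  split=> // x Vx; apply: continuous_comp; first exact: cg.
  apply: differentiable_continuous; apply/derivable1_diffP.
  by have [] := dphiP j _ (DV x Vx).
have Dp t : D t -> derivable (phi j) t 1 by move=> /(dphiP j)[].
split=> [x Vx|i].
  apply: continuous_comp; first exact: cg.
  by apply: differentiable_continuous; apply/derivable1_diffP/Dp/DV.
have [dg Dg] := Hg i.
have key x : V x -> is_derive x 'e_i (fun x => phi j (g x))
    ((\sum_(c <- dphi j) c.1 * phi c.2 (g x)) * 'D_'e_i g x).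
  by move=> Vx; apply: is_derive_comp1; [apply: dphiP; exact: DV|exact: dg].
split=> [x Vx|]; first by have [] := key x Vx.
have gk := IH (Ck_pred (conj cg Hg)).
have sk : Ck k V (fun x => \sum_(c <- dphi j) c.1 * phi c.2 (g x)).
  elim: (dphi j) => [|c s IHs].
    by apply: Ck_open_eq (Ck_cst k V 0) => // x _; rewrite big_nil.
  apply: Ck_open_eq (CkD oV (CkM oV (Ck_cst k V c.1) (gk c.2)) IHs) => // x _.
  by rewrite big_cons.
apply: (Ck_open_eq oV _ (CkM oV sk Dg)) => x Vx.
by have [_ ->] := key x Vx.
Qed.

Lemma is_derive_coord i j x :
  is_derive x 'e_j (fun y : 'rV[R]_n => y 0 i) ((j == i)%:R).
Proof.
have E : x = x + (0 : R) *: 'e_j by rewrite scale0r addr0.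
rewrite [X in is_derive X]E; apply/is_derive_lineE.
have -> : (fun r : R => (x + r *: 'e_j) 0 i)
    = cst (x 0 i) + id * cst ((j == i)%:R : R).
  by apply/funext => r; rewrite !mxE eqxx /= eq_sym.
apply: (is_derive_eq (is_deriveD (is_derive_cst _ _ _)
  (is_deriveM (is_derive_id _ _) (is_derive_cst _ _ _)))).
by rewrite add0r scaler0 add0r; exact: mulr1.
Qed.

Lemma derive_coord i j x : 'D_'e_j (fun y : 'rV[R]_n => y 0 i) x = (j == i)%:R.
Proof. by have [_ ->] := is_derive_coord i j x. Qed.

Lemma Ck_coord k V i : Ck k V (fun x => x 0 i).
Proof.
case: k => [|k]; (split=> [x _|//]); try exact: coord_continuous.
move=> j; split=> [x _|]; first by have [] := is_derive_coord i j x.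
have -> : (fun x => 'D_'e_j (fun y : 'rV[R]_n => y 0 i) x) = (fun=> (j == i)%:R).
  by apply/funext => x; exact: derive_coord.
exact: Ck_cst.
Qed.

Lemma CkN k V g : open V -> Ck k V g -> Ck k V (fun x => - g x).
Proof.
move=> oV gk; apply: Ck_open_eq (CkM oV (Ck_cst k V (-1)) gk) => // x _.
by rewrite mulN1r.
Qed.

Lemma CkB k V g h : open V -> Ck k V g -> Ck k V h -> Ck k V (fun x => g x - h x).
Proof. by move=> oV gk hk; apply: CkD => //; exact: CkN. Qed.

Lemma Ck_sum k V (I : Type) (s : seq I) (P : pred I) (F : I -> 'rV[R]_n -> R) :
  open V -> (forall i, P i -> Ck k V (F i)) -> Ck k V (fun x => \sum_(i <- s | P i) F i x).
Proof.
move=> oV FP; elim: s => [|i s IHs].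
  by apply: Ck_open_eq (Ck_cst k V 0) => // x _; rewrite big_nil.
case Pi : (P i).
  by apply: Ck_open_eq (CkD oV (FP i Pi) IHs) => // x _; rewrite big_cons Pi.
by apply: Ck_open_eq IHs => // x _; rewrite big_cons Pi.
Qed.

Lemma Ck_prod k V (I : Type) (s : seq I) (P : pred I) (F : I -> 'rV[R]_n -> R) :
  open V -> (forall i, P i -> Ck k V (F i)) -> Ck k V (fun x => \prod_(i <- s | P i) F i x).
Proof.
move=> oV FP; elim: s => [|i s IHs].
  by apply: Ck_open_eq (Ck_cst k V 1) => // x _; rewrite big_nil.
case Pi : (P i).
  by apply: Ck_open_eq (CkM oV (FP i Pi) IHs) => // x _; rewrite big_cons Pi.
by apply: Ck_open_eq IHs => // x _; rewrite big_cons Pi.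
Qed.

Lemma norm_coord_le (x : 'rV[R]_n) i : `|x 0 i| <= `|x|.
Proof. by have := mx_normrE x; rewrite /Num.norm/= => ->; apply: (le_bigmax _ (fun ij => `|x ij.1 ij.2|) (0, i)). Qed.

Lemma mx_norm_le (x : 'rV[R]_n) (c : R) : 0 <= c ->
  (forall i, `|x 0 i| <= c) -> `|x| <= c.
Proof.
move=> c0 xc; rewrite [X in X <= _]mx_normrE; apply/bigmax_leP; split=> // -[i j] _.
by rewrite (ord1 i); exact: xc.
Qed.

Definition lincomb (a : 'I_n -> R) (h : 'rV[R]_n) : R := \sum_i h 0 i * a i.

Lemma lincomb_is_linear a : linear (lincomb a).
Proof.
move=> c u v; rewrite /lincomb scaler_sumr -big_split/=; apply: eq_bigr => i _.
by rewrite !mxE mulrDl -mulrA.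
Qed.

HB.instance Definition _ a :=
  GRing.isLinear.Build R 'rV[R]_n R _ (lincomb a) (lincomb_is_linear a).

Lemma lincomb_continuous a : continuous (lincomb a).
Proof.
move=> x; apply: (@Ck_cont 0 setT) => //; apply: Ck_sum => [|i _]; first exact: openT.
by apply: CkM; [exact: openT|exact: Ck_coord|exact: Ck_cst].
Qed.

Lemma near0_norm_lt (d : R) : 0 < d -> \forall h \near (0 : 'rV[R]_n), `|h| < d.
Proof.
by move=> d0; apply/nbhs_ballP; exists d => //= y; rewrite -ball_normE/= sub0r normrN.
Qed.

(** Coordinatewise, [g (x + h) - g x] telescopes into increments along the
    axes, each of which the mean value theorem turns into a partial derivative
    at a point close to [x]. *)
Lemma C1_increment V g x (eps : R) : open V -> V x -> Ck 1 V g -> 0 < eps ->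
  \forall h \near (0 : 'rV[R]_n),
    `|g (x + h) - g x - lincomb (fun i => 'D_'e_i g x) h| <= eps * `|h|.
Proof.
move=> oV Vx gk eps0; pose e := eps / n.+1%:R.
have e0 : 0 < e by rewrite divr_gt0.
have close : \forall y \near x, V y /\ forall i, `|'D_'e_i g y - 'D_'e_i g x| < e.
  apply: filterI; first exact: open_nbhs_nbhs.
  apply: (@near_all _ 'I_n x (fun i y => `|'D_'e_i g y - 'D_'e_i g x| < e)) => i.
  have c : {for x, continuous (fun y => 'D_'e_i g y)} by apply: Ck_cont (Ck_D i gk) Vx.
  by have /cvgrPdist_lt/(_ e e0) := c; apply: filterS => y; rewrite distrC.
have /nbhs_ballP[d /= d0 dP] := close.
near=> h.
have hd : `|h| < d by near: h; exact: near0_norm_lt.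
pose tel (k : nat) : 'rV[R]_n := \row_i (if (i < k)%N then h 0 i else 0).
have telS (i : 'I_n) : tel i.+1 = tel i + h 0 i *: 'e_i.
  apply/rowP => j; rewrite !mxE eqxx/= ltnS.
  have [->|ne] := eqVneq j i; first by rewrite leqnn ltnn add0r mulr1.
  by rewrite leq_eqVlt (inj_eq val_inj) (negPf ne) mulr0 addr0.
have tel0 : tel 0 = 0 by apply/rowP => j; rewrite !mxE.
have teln : tel n = h by apply/rowP => j; rewrite !mxE ltn_ord.
have near_tel (i : 'I_n) (s : R) : `|s| <= `|h 0 i| ->
    ball x d (x + tel i + s *: 'e_i).
  move=> sh; rewrite -ball_normE /ball_/= -addrA opprD addNKr normrN.
  apply: le_lt_trans hd; apply: mx_norm_le => // j.
  rewrite !mxE eqxx/=; have [->|ne] := eqVneq j i.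
    by rewrite ltnn mulr1 add0r (le_trans sh)// norm_coord_le.
  by rewrite mulr0 addr0; case: ifP; rewrite ?normr0// norm_coord_le.
have step (i : 'I_n) : `|g (x + tel i.+1) - g (x + tel i) - h 0 i * 'D_'e_i g x| <= e * `|h|.
  have [s sh E] : exists2 s, `|s| <= `|h 0 i| & g (x + tel i + h 0 i *: 'e_i) - g (x + tel i)
      = h 0 i * 'D_'e_i g (x + tel i + s *: 'e_i).
    apply: MVT_line => s sh; apply: Ck_derivable gk _.
    by have [] := dP _ (near_tel i s sh).
  rewrite telS addrA E -mulrBr normrM mulrC.
  have [_ /(_ i) c] := dP _ (near_tel i s sh).
  by apply: ler_pM => //; [exact: ltW|exact: norm_coord_le].
have -> : g (x + h) - g x - lincomb (fun i => 'D_'e_i g x) h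
    = \sum_(i < n) (g (x + tel i.+1) - g (x + tel i) - h 0 i * 'D_'e_i g x).
  rewrite sumrB; congr (_ - _).
  by rewrite -(big_mkord xpredT (fun i => g (x + tel i.+1) - g (x + tel i))) telescope_sumr// tel0 teln addr0.
apply: le_trans (ler_norm_sum _ _ _) _.
apply: le_trans (ler_sum _ (fun i _ => step i)) _.
rewrite sumr_const card_ord -mulr_natr mulrAC; apply: ler_wpM2r => //.
by rewrite /e mulrAC ler_pdivrMr// ler_pM2l// ler_nat.
Unshelve. all: by end_near. Qed.

Lemma C1_differentiable V g x : open V -> V x -> Ck 1 V g ->
  differentiable g x /\ 'd g x = lincomb (fun i => 'D_'e_i g x) :> (_ -> _).
Proof.
move=> oV Vx gk; pose L := lincomb (fun i => 'D_'e_i g x).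
have cL : continuous L by exact: lincomb_continuous.
have eL : g \o shift x = cst (g x) + L +o_ (0 : 'rV[R]_n) id.
  apply/eqaddoP => eps eps0; have := C1_increment oV Vx gk eps0.
  by apply: filterS => h; rewrite /= !fctE/= opprD addrA [h + x]addrC.
have dE := diff_unique cL eL.
split=> //; apply/diff_locallyP; rewrite dE; split=> //.
Qed.

End Ck.

Section Cinf.
Variables (R : realType) (n : nat).
Implicit Types (V : set 'rV[R]_n) (g h : 'rV[R]_n -> R) (x : 'rV[R]_n).

Lemma Cinf_sub V V' g : V' `<=` V -> Cinf V g -> Cinf V' g.
Proof. by move=> VV' gk k; exact: Ck_sub VV' (gk k). Qed.

Lemma Cinf_near V g h : (forall x, V x -> \forall y \near x, g y = h y) ->
  Cinf V g -> Cinf V h.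
Proof. by move=> gh gk k; exact: Ck_near gh (gk k). Qed.

Lemma Cinf_open_eq V g h : open V -> (forall x, V x -> g x = h x) ->
  Cinf V g -> Cinf V h.
Proof. by move=> oV gh gk k; exact: Ck_open_eq gh (gk k). Qed.

Lemma Cinf_pointwise V g : (forall x, V x -> Cinf [set x] g) -> Cinf V g.
Proof. by move=> gk k; apply: Ck_pointwise => x /gk. Qed.

Lemma Cinf_D V g i : Cinf V g -> Cinf V (fun x => 'D_'e_i g x).
Proof. by move=> gk k; exact: Ck_D (gk k.+1). Qed.

Lemma Cinf_cont V g x : Cinf V g -> V x -> {for x, continuous g}.
Proof. by move=> gk; exact: Ck_cont (gk 0). Qed.

Lemma Cinf_derivable V g x i : Cinf V g -> V x -> derivable g x 'e_i.
Proof. by move=> gk; exact: Ck_derivable (gk 1). Qed.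

Lemma Cinf_cst V (a : R) : Cinf V (fun=> a).
Proof. by move=> k; exact: Ck_cst. Qed.

Lemma Cinf_coord V i : Cinf V (fun x => x 0 i).
Proof. by move=> k; exact: Ck_coord. Qed.

Section open.
Variables (V : set 'rV[R]_n) (oV : open V).

Lemma CinfDr g h : Cinf V g -> Cinf V h -> Cinf V (fun x => g x + h x).
Proof. by move=> gk hk k; exact: CkD. Qed.

Lemma CinfNr g : Cinf V g -> Cinf V (fun x => - g x).
Proof. by move=> gk k; exact: CkN. Qed.

Lemma CinfBr g h : Cinf V g -> Cinf V h -> Cinf V (fun x => g x - h x).
Proof. by move=> gk hk k; exact: CkB. Qed.

Lemma CinfMr g h : Cinf V g -> Cinf V h -> Cinf V (fun x => g x * h x).
Proof. by move=> gk hk k; exact: CkM. Qed.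

Lemma CinfVr g : (forall x, V x -> g x != 0) -> Cinf V g -> Cinf V (fun x => (g x)^-1).
Proof. by move=> g0 gk k; exact: CkV. Qed.

Lemma Cinf_sum (I : Type) (s : seq I) (P : pred I) (F : I -> 'rV[R]_n -> R) :
  (forall i, P i -> Cinf V (F i)) -> Cinf V (fun x => \sum_(i <- s | P i) F i x).
Proof. by move=> FP k; apply: Ck_sum => // i Pi; exact: FP. Qed.

Lemma Cinf_prod (I : Type) (s : seq I) (P : pred I) (F : I -> 'rV[R]_n -> R) :
  (forall i, P i -> Cinf V (F i)) -> Cinf V (fun x => \prod_(i <- s | P i) F i x).
Proof. by move=> FP k; apply: Ck_prod => // i Pi; exact: FP. Qed.

Lemma derive_lincomb g x (v : 'rV[R]_n) : Cinf V g -> V x ->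
  derivable g x v /\ 'D_v g x = \sum_i v 0 i * 'D_'e_i g x.
Proof.
move=> gk Vx; have [dg dE] := C1_differentiable oV Vx (gk 1).
by split; [exact: diff_derivable|rewrite deriveE// dE].
Qed.

End open.
End Cinf.

Section ChainRule.
Variables (R : realType) (m n : nat).
Implicit Types (psi : 'rV[R]_m -> 'rV[R]_n) (g : 'rV[R]_n -> R).

Lemma row_of_coord_cont (T : topologicalType) (psi : T -> 'rV[R]_n) (x : T) :
  (forall j, {for x, continuous (fun y => psi y 0 j)}) -> {for x, continuous psi}.
Proof.
move=> c; apply/cvgrPdist_lt => e e0; near=> y.
have : forall j : 'I_n, `|psi x 0 j - psi y 0 j| < e / 2.
  near: y; apply: (@near_all _ 'I_n) => j.
  by have /cvgrPdist_lt/(_ (e / 2)) := c j; apply; rewrite divr_gt0.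
move=> H; apply: (@le_lt_trans _ _ (e / 2)); last by rewrite ltr_pdivrMr// ltr_pMr// ltr1n.
apply: mx_norm_le => [|j]; first by rewrite divr_ge0// ltW.
by rewrite !mxE; apply/ltW/H.
Unshelve. all: by end_near. Qed.

(** On the line through [x] in the direction [e_i] this is the composition of a curve
    with [g], which is differentiable because it is C^1. *)
Lemma chain_rule (U : set 'rV[R]_m) (V : set 'rV[R]_n) psi g x i :
  open U -> open V -> (forall j, Cinf U (fun y => psi y 0 j)) ->
  (forall y, U y -> V (psi y)) -> Cinf V g -> U x ->
  is_derive x 'e_i (fun y => g (psi y))
    (\sum_j 'D_'e_j g (psi x) * 'D_'e_i (fun y => psi y 0 j) x).
Proof.
move=> oU oV psik UV gk Ux.
have [dg dgE] := C1_differentiable oV (UV _ Ux) (gk 1).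
pose l (r : R) := psi (x + r *: 'e_i).
have l0 : l 0 = psi x by rewrite /l scale0r addr0.
have E : x = x + (0 : R) *: 'e_i by rewrite scale0r addr0.
have dl j : is_derive (0 : R) 1 (fun r => l r 0 j) ('D_'e_i (fun y => psi y 0 j) x).
  rewrite [X in 'D_ _ _ X]E.
  apply: (@is_derive_line R _ (fun y => psi y 0 j)); rewrite -E.
  exact: Cinf_derivable (psik j) Ux.
have ld : derivable l 0 1.
  by apply/derivable_mxP => a b; rewrite (ord1 a); have [] := dl b.
have ldiff : differentiable l 0 by apply/derivable1_diffP.
rewrite -l0 in dg dgE *; rewrite [X in is_derive X]E; apply/is_derive_lineE.
have gld : differentiable (g \o l) 0 by exact: differentiable_comp.
apply: DeriveDef; first exact: diff_derivable.
rewrite deriveE// diff_comp//= dgE -deriveE// derive_mx// /lincomb.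
apply: eq_bigr => j _; rewrite mxE mulrC; congr (_ * _).
by have [_] := dl j.
Qed.

Lemma Ck_compose (U : set 'rV[R]_m) (V : set 'rV[R]_n) psi g k :
  open U -> open V -> (forall j, Cinf U (fun y => psi y 0 j)) ->
  (forall y, U y -> V (psi y)) -> Cinf V g -> Ck k U (fun y => g (psi y)).
Proof.
move=> oU oV psik UV; elim: k g => [|k IH] g gk; (split=> [x Ux|//]).
- apply: (@continuous_comp _ _ _ psi g); last exact: Cinf_cont gk (UV _ Ux).
  by apply: row_of_coord_cont => j; exact: Cinf_cont (psik j) Ux.
- apply: (@continuous_comp _ _ _ psi g); last exact: Cinf_cont gk (UV _ Ux).
  by apply: row_of_coord_cont => j; exact: Cinf_cont (psik j) Ux.
move=> i; split=> [x Ux|]; first by have [] := chain_rule i oU oV psik UV gk Ux.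
apply: (@Ck_open_eq _ _ _ _ (fun x => \sum_j 'D_'e_j g (psi x) * 'D_'e_i (fun y => psi y 0 j) x)) => //.
  by move=> x Ux; have [_ ->] := chain_rule i oU oV psik UV gk Ux.
apply: Ck_sum => // j _; apply: CkM => //; last exact: (Cinf_D i (psik j)).
by apply: (IH (fun z => 'D_'e_j g z)); exact: Cinf_D.
Qed.

Lemma Cinf_compose (U : set 'rV[R]_m) (V : set 'rV[R]_n) psi g :
  open U -> open V -> (forall j, Cinf U (fun y => psi y 0 j)) ->
  (forall y, U y -> V (psi y)) -> Cinf V g -> Cinf U (fun y => g (psi y)).
Proof. by move=> oU oV psik UV gk k; exact: Ck_compose gk. Qed.

End ChainRule.

(** * Integrals depending on parameters, and Hadamard's lemma *)

Section IntegralOverUnitInterval.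
Variable R : realType.
Implicit Types (f g : R -> R).

Definition int01 f : R := \int[lebesgue_measure]_(s in `[0, 1]) f s.

Definition cont01 f := forall s, s \in `[0, 1] -> {for s, continuous f}.

Lemma cont01_integrable f : cont01 f ->
  (lebesgue_measure : measure (measurableTypeR R) R).-integrable `[0, 1] (EFin \o f).
Proof.
move=> cf; apply: continuous_compact_integrable; first exact: segment_compact.
apply: continuous_in_subspaceT => s; rewrite inE => sI; exact: cf.
Qed.

Lemma int01D f g : cont01 f -> cont01 g ->
  int01 (fun s => f s + g s) = int01 f + int01 g.
Proof. by move=> cf cg; rewrite /int01 RintegralD//; exact: cont01_integrable. Qed.

Lemma int01Z (c : R) f : cont01 f -> int01 (fun s => c * f s) = c * int01 f.
Proof. by move=> cf; rewrite /int01 RintegralZl//; exact: cont01_integrable. Qed.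

Lemma eq_int01 f g : (forall s, s \in `[0, 1] -> f s = g s) -> int01 f = int01 g.
Proof. by move=> fg; apply: eq_Rintegral => s; rewrite inE; exact: fg. Qed.

Lemma int01_cst (c : R) : int01 (fun=> c) = c.
Proof.
rewrite /int01 /Rintegral integral_cst//= lebesgue_measure_itv/= lte01 oppr0 adde0.
by rewrite mule1.
Qed.

Lemma int01_le f g : cont01 f -> cont01 g ->
  (forall s, s \in `[0, 1] -> f s <= g s) -> int01 f <= int01 g.
Proof.
move=> cf cg fg; apply: le_Rintegral => //; try exact: cont01_integrable.
Qed.

Lemma cont01D f g : cont01 f -> cont01 g -> cont01 (fun s => f s + g s).
Proof. by move=> cf cg s sI; apply: continuousD; [exact: cf|exact: cg]. Qed.

Lemma cont01Z (c : R) f : cont01 f -> cont01 (fun s => c * f s).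
Proof. by move=> cf s sI; apply: continuousM; [exact: cst_continuous|exact: cf]. Qed.

Lemma int01_dist f g (e : R) : cont01 f -> cont01 g ->
  (forall s, s \in `[0, 1] -> `|f s - g s| <= e) -> `|int01 f - int01 g| <= e.
Proof.
move=> cf cg fg.
have E : int01 (fun s => f s + (-1) * g s) = int01 f - int01 g.
  by rewrite int01D ?int01Z ?mulN1r//; exact: cont01Z.
have cE : cont01 (fun s => f s + (-1) * g s) by apply: cont01D => //; exact: cont01Z.
rewrite -E ler_norml; apply/andP; split.
  rewrite -(int01_cst (- e)); apply: int01_le => // [s _|s /fg]; first exact: cst_continuous.
  by rewrite mulN1r ler_norml => /andP[].
rewrite -[leRHS](int01_cst e); apply: int01_le => // [s _|s /fg]; first exact: cst_continuous.
by rewrite mulN1r ler_norml => /andP[].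
Qed.

Lemma cont01_sum (I : Type) (s : seq I) (F : I -> R -> R) :
  (forall i, cont01 (F i)) -> cont01 (fun t => \sum_(i <- s) F i t).
Proof.
move=> cF t tI; elim: s => [|j s IHs].
  rewrite (_ : (fun _ => _) = (fun=> 0)); first exact: cst_continuous.
  by apply/funext => u; rewrite big_nil.
rewrite (_ : (fun _ => _) = (fun u => F j u + \sum_(i <- s) F i u)).
  by apply: continuousD => //; exact: cF.
by apply/funext => u; rewrite big_cons.
Qed.

Lemma int01_sum (I : Type) (s : seq I) (F : I -> R -> R) :
  (forall i, cont01 (F i)) ->
  int01 (fun t => \sum_(i <- s) F i t) = \sum_(i <- s) int01 (F i).
Proof.
move=> cF; elim: s => [|i s IHs].
  rewrite big_nil -[RHS](int01_cst 0); apply: eq_int01 => t _; exact: big_nil.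
rewrite big_cons -IHs -int01D//.
  by apply: eq_int01 => t _; rewrite big_cons.
exact: cont01_sum.
Qed.

Lemma int01_FTC F f : (forall s : R, s \in `[0, 1] -> is_derive s 1 F (f s)) ->
  cont01 f -> int01 f = F 1 - F 0.
Proof.
move=> dF cf; rewrite /int01 /Rintegral.
rewrite (continuous_FTC2 (F := F)) //.
- apply: continuous_in_subspaceT => s; rewrite inE => sI; exact: cf.
- have cF (s : R) : s \in `[0, 1] -> {for s, continuous F}.
    by move=> /dF[dFs _]; apply: differentiable_continuous; exact/derivable1_diffP.
  split=> [s sI||].
  + by have [] := dF s (subset_itv_oo_cc sI).
  + by apply: cvg_at_right_filter; apply: cF; rewrite bound_itvE.
  + by apply: cvg_at_left_filter; apply: cF; rewrite bound_itvE.
- by move=> s sI; rewrite derive1E; have [_ ->] := dF s (subset_itv_oo_cc sI).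
Qed.

End IntegralOverUnitInterval.

Section ParametricIntegral.
Variables (R : realType) (n : nat).
Implicit Types (h : 'rV[R]_(1 + n) -> R) (x : 'rV[R]_n) (s : R).

Definition scons s x : 'rV[R]_(1 + n) := row_mx s%:M x.

Lemma scons_l s x i : scons s x 0 (lshift n i) = s.
Proof. by rewrite row_mxEl mxE (ord1 i) eqxx. Qed.

Lemma scons_r s x i : scons s x 0 (rshift 1 i) = x 0 i.
Proof. by rewrite row_mxEr. Qed.

Lemma scons_ind (P : 'I_(1 + n) -> Prop) :
  P (lshift n 0) -> (forall i, P (rshift 1 i)) -> forall j, P j.
Proof. by move=> P0 PS j; case: (split_ordP j) => k ->; rewrite ?(ord1 k). Qed.

Lemma scons_move s x (r : R) i : scons s (x + r *: 'e_i) = scons s x + r *: 'e_(rshift 1 i).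
Proof.
apply/rowP => j; elim/scons_ind: j => [|j].
  by rewrite [RHS]mxE !scons_l !mxE eqxx eq_lrshift mulr0 addr0.
by rewrite [RHS]mxE !scons_r !mxE eqxx eq_rshift.
Qed.

Lemma scons_moves s x (r : R) : scons (s + r) x = scons s x + r *: 'e_(lshift n 0).
Proof.
apply/rowP => j; elim/scons_ind: j => [|j].
  by rewrite [RHS]mxE !scons_l !mxE !eqxx mulr1.
by rewrite [RHS]mxE !scons_r !mxE eqxx eq_rlshift mulr0 addr0.
Qed.

Lemma scons_cont : continuous (fun p : R * 'rV[R]_n => scons p.1 p.2).
Proof.
move=> p; apply: (@row_of_coord_cont _ _ _ (fun p : R * 'rV[R]_n => scons p.1 p.2)).
elim/scons_ind => [|j].
  rewrite (_ : (fun _ => _) = fst); first exact: cvg_fst.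
  by apply/funext => q; rewrite scons_l.
rewrite (_ : (fun _ => _) = (fun q : R * 'rV[R]_n => q.2 0 j)).
  apply: (@continuous_comp _ _ _ snd (fun x : 'rV[R]_n => x 0 j) p); first exact: cvg_snd.
  exact: coord_continuous.
by apply/funext => q; rewrite scons_r.
Qed.

Lemma scons_contl x : continuous (fun s : R => scons s x).
Proof.
move=> s; apply: (@row_of_coord_cont _ _ _ (fun s : R => scons s x)).
elim/scons_ind => [|j].
  rewrite (_ : (fun _ => _) = id); first exact: cvg_id.
  by apply/funext => q; rewrite scons_l.
rewrite (_ : (fun _ => _) = (fun=> x 0 j)); first exact: cst_continuous.
by apply/funext => q; rewrite scons_r.
Qed.

Section fixed.
Variables (U : set 'rV[R]_n) (H : set 'rV[R]_(1 + n)).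
Hypotheses (oU : open U)
  (UH : forall s x, s \in `[0, 1] -> U x -> H (scons s x)).

Definition pint h x : R := int01 (fun s => h (scons s x)).

Lemma slice_cont h x s : Cinf H h -> s \in `[0, 1] -> U x ->
  {for (s, x), continuous (fun p : R * 'rV[R]_n => h (scons p.1 p.2))}.
Proof.
move=> hk sI Ux.
apply: (@continuous_comp _ _ _ (fun p : R * 'rV[R]_n => scons p.1 p.2) h).
  exact: scons_cont.
by apply: Cinf_cont hk _; exact: UH.
Qed.

Lemma slice_cont01 h x : Cinf H h -> U x -> cont01 (fun s => h (scons s x)).
Proof.
move=> hk Ux s sI.
apply: (@continuous_comp _ _ _ (fun s : R => scons s x) h); first exact: scons_contl.
by apply: Cinf_cont hk _; exact: UH.
Qed.

(** Compactness of the segment makes the modulus of continuity uniform in the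
    parameter. *)
Lemma slice_unif h x (e : R) : Cinf H h -> U x -> 0 < e ->
  \forall y \near x, U y /\ forall s, s \in `[0, 1] -> `|h (scons s y) - h (scons s x)| < e.
Proof.
move=> hk Ux e0; apply: filterI; first exact: open_nbhs_nbhs.
have /compact_near_coveringP nc : compact `[(0 : R), 1] by exact: segment_compact.
apply: (nc _ (nbhs x) (fun y s => `|h (scons s y) - h (scons s x)| < e)) => s sI.
have e20 : 0 < e / 2 by rewrite divr_gt0.
have c := cont_dist_lt (slice_cont hk sI Ux) e20.
have c' := cont_dist_lt (slice_cont01 hk Ux sI) e20.
have c2 : \forall p \near (s, x), `|h (scons s x) - h (scons p.1 x)| < e / 2.
  by exists ([set t | `|h (scons s x) - h (scons t x)| < e / 2], setT);
    [split=> //; exact: filterT|move=> p []].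
apply: filterS2 c c2 => -[t y]/= A B.
rewrite -(subrKA (h (scons s x))) [ltRHS]splitr (le_lt_trans (ler_normD _ _))// ltrD//.
by rewrite distrC.
Qed.

(** Differentiation under the integral sign: by the mean value theorem the
    difference quotients are values of the partial derivative at nearby points. *)
Lemma pint_derive h x i : Cinf H h -> U x ->
  is_derive x 'e_i (pint h) (pint (fun z => 'D_'e_(rshift 1 i) h z) x).
Proof.
move=> hk Ux; have dk := Cinf_D (rshift 1 i) hk.
suff c : r^-1 *: ((pint h \o shift x) (r *: 'e_i) - pint h x) @[r --> (0 : R)^']
    --> pint (fun z => 'D_'e_(rshift 1 i) h z) x.
  by apply: DeriveDef; [apply/cvg_ex; eexists; exact: c|exact/cvg_lim].
apply/cvgrPdist_le => e e0.
have [d /= d0 dP] := (nbhs_ballP _ _).1 (slice_unif dk Ux e0).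
have xd (r : R) : `|r| < d -> ball x d (x + r *: 'e_i).
  move=> rd; rewrite -ball_normE /ball_/= opprD addNKr normrN normrZ.
  apply: le_lt_trans rd; apply: ler_piMr => //.
  apply: mx_norm_le => // j; rewrite !mxE eqxx/=.
  by case: eqP => _; rewrite ?normr1 ?normr0.
near=> r.
have r0 : r != 0 by near: r; exact: nbhs_dnbhs_neq.
have rd : `|r| < d by near: r; exact: dnbhs0_lt.
have [Ur _] := dP _ (xd r rd).
rewrite distrC -(ler_pM2l (_ : 0 < `|r|)) ?normr_gt0// -normrM mulrBr /=.
rewrite /GRing.scale/= mulVKf// [r *: _ + x]addrC.
have -> : pint h (x + r *: 'e_i) - pint h x - r * pint (fun z => 'D_'e_(rshift 1 i) h z) x
   = pint h (x + r *: 'e_i) - int01 (fun s => h (scons s x) + r * 'D_'e_(rshift 1 i) h (scons s x)).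
  have c1 := slice_cont01 hk Ux; have c2 := slice_cont01 dk Ux.
  by rewrite int01D ?int01Z ?opprD ?addrA//; exact: cont01Z.
apply: int01_dist => [||s sI]; first exact: slice_cont01.
  by apply: cont01D; [exact: slice_cont01|apply: cont01Z; exact: slice_cont01 dk Ux].
have [t tr E] : exists2 t, `|t| <= `|r| & h (scons s x + r *: 'e_(rshift 1 i)) - h (scons s x)
    = r * 'D_'e_(rshift 1 i) h (scons s x + t *: 'e_(rshift 1 i)).
  apply: MVT_line => t tr; rewrite -scons_move; apply: Cinf_derivable hk _.
  by apply: UH => //; have [] := dP _ (xd t (le_lt_trans tr rd)).
rewrite scons_move opprD addrA E -mulrBr normrM ler_pM2l ?normr_gt0// -scons_move.
by have [_ /(_ s sI)/ltW] := dP _ (xd t (le_lt_trans tr rd)).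
Unshelve. all: by end_near. Qed.

Lemma pint_Ck k h : Cinf H h -> Ck k U (pint h).
Proof.
elim: k h => [|k IH] h hk.
  split=> // x Ux; apply: cont_distP => e e0.
  apply: filterS (slice_unif hk Ux e0) => y [Uy yP].
  apply: int01_dist => [||s /yP]; try exact: slice_cont01.
  by rewrite distrC => /ltW.
split=> [x Ux|i]; first exact: Ck_cont (IH h hk) Ux.
split=> [x Ux|]; first by have [] := pint_derive i hk Ux.
apply: (@Ck_open_eq _ _ _ _ (pint (fun z => 'D_'e_(rshift 1 i) h z))) => //.
  by move=> x Ux; have [_ ->] := pint_derive i hk Ux.
by apply: IH; exact: Cinf_D.
Qed.

Lemma pint_Cinf h : Cinf H h -> Cinf U (pint h).
Proof. by move=> hk k; exact: pint_Ck. Qed.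

End fixed.
End ParametricIntegral.

Section Hadamard.
Variables (R : realType) (n : nat).
Implicit Types (g : 'rV[R]_n -> R) (x a : 'rV[R]_n).

Lemma ball_segment a x (r s : R) : s \in `[0, 1] -> ball a r x ->
  ball a r (a + s *: (x - a)).
Proof.
rewrite in_itv/= -!ball_normE /ball_/= => /andP[s0 s1] xr.
rewrite opprD addNKr normrN normrZ ger0_norm// distrC in xr *.
by apply: le_lt_trans xr; rewrite distrC ler_piMl.
Qed.

Let seg a (z : 'rV[R]_(1 + n)) : 'rV[R]_n :=
  \row_j (a 0 j + z 0 (lshift n 0) * (z 0 (rshift 1 j) - a 0 j)).

Let seg_scons a s x : seg a (scons s x) = a + s *: (x - a).
Proof. by apply/rowP => j; rewrite mxE scons_l scons_r !mxE. Qed.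

Let seg_Cinf a j : Cinf setT (fun z => seg a z 0 j).
Proof.
apply: (@Cinf_open_eq _ _ _ (fun z : 'rV[R]_(1 + n) =>
  a 0 j + z 0 (lshift n 0) * (z 0 (rshift 1 j) - a 0 j))); first exact: openT.
  by move=> z _; rewrite mxE.
apply: CinfDr; [exact: openT|exact: Cinf_cst|apply: CinfMr; first exact: openT].
  exact: Cinf_coord.
by apply: CinfBr; [exact: openT|exact: Cinf_coord|exact: Cinf_cst].
Qed.

(** The integral of the derivative along the segment from [a] to [x]. *)
Lemma hadamard a (r : R) g : Cinf (ball a r) g ->
  exists q : 'I_n -> 'rV[R]_n -> R, (forall j, Cinf (ball a r) (q j)) /\
    forall x, ball a r x -> g x = g a + \sum_j (x 0 j - a 0 j) * q j x.
Proof.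
move=> gk; have oB : open (ball a r) by exact: ball_open.
pose H := seg a @^-1` ball a r.
have cseg : continuous (seg a).
  by move=> z; apply: row_of_coord_cont => j; exact: Cinf_cont (seg_Cinf a j) _.
have oH : open H by apply: open_comp => // z _; exact: cseg.
have UH s x : s \in `[0, 1] -> ball a r x -> H (scons s x).
  by move=> sI xr; rewrite /H/= seg_scons; exact: ball_segment.
pose h (j : 'I_n) (z : 'rV[R]_(1 + n)) : R := 'D_'e_j g (seg a z).
have hk j : Cinf H (h j).
  apply: (@Cinf_compose _ _ _ H (ball a r) (seg a) (fun y => 'D_'e_j g y)) => //.
    by move=> i; apply: Cinf_sub (seg_Cinf a i).
  exact: Cinf_D.
exists (fun j => pint (h j)); split=> [j|x xr].
  exact: (pint_Cinf oB UH (hk j)).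
have dF (s : R) : s \in `[0, 1] -> is_derive s 1 (fun s : R => g (a + s *: (x - a)))
    (\sum_j (x 0 j - a 0 j) * h j (scons s x)).
  move=> sI; apply/is_derive_lineE.
  have [d dE] := derive_lincomb oB (x - a) gk (ball_segment sI xr).
  apply: DeriveDef => //; rewrite dE; apply: eq_bigr => j _.
  by rewrite /h seg_scons !mxE.
have ch j : cont01 (fun s => (x 0 j - a 0 j) * h j (scons s x)).
  by apply: cont01Z; exact: slice_cont01 (hk j) xr.
have cf : cont01 (fun s => \sum_j (x 0 j - a 0 j) * h j (scons s x)).
  by apply: cont01_sum => j; exact: ch.
have := int01_FTC dF cf; rewrite scale1r scale0r addr0 [a + _]addrC subrK => E.
rewrite -(subrK (g a) (g x)) addrC; congr (_ + _); rewrite -E int01_sum//.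
by apply: eq_bigr => j _; rewrite int01Z//; exact: slice_cont01 (hk j) xr.
Qed.

End Hadamard.

(** * Smooth functions on a manifold *)

Section SmoothFunctions.
Variables (R : realType) (n : nat) (M : manifold R n).
Local Notation C := R[i].
Implicit Types (U V : set M) (f g : func M) (p q : M) (c d : chart R n M).

Lemma cimg_nbhs c p : cdom c p -> nbhs (cmap c p) (cmap c @` cdom c).
Proof. by move=> cp; apply: open_nbhs_nbhs; split; [exact: cimg_open|exists p]. Qed.

Lemma img_open c U : open U -> open (cmap c @` (U `&` cdom c)).
Proof.
move=> oU; rewrite openE => _ [p [Up cp] <-]; rewrite /interior.
have cc : nbhs (cmap c p) (cinv c @^-1` U).
  apply: cinv_cont; first by exists p.
  by apply: open_nbhs_nbhs; split=> //; rewrite cmapK.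
apply: filterS (filterI (cimg_nbhs cp) cc) => _ [[q cq <-]].
by rewrite /= cmapK// => Uq; exists q.
Qed.

Lemma near_cmap c p (P : set M) : cdom c p -> (\forall q \near p, P q) ->
  \forall x \near cmap c p, P (cinv c x).
Proof. by move=> cp Pp; apply: cinv_cont; [exists p|rewrite cmapK]. Qed.

Lemma near_cinv c p (P : set 'rV[R]_n) : cdom c p -> (\forall x \near cmap c p, P x) ->
  \forall q \near p, P (cmap c q).
Proof. by move=> cp; exact: cmap_cont. Qed.

Lemma smooth_sub U V f : V `<=` U -> smooth_on U f -> smooth_on V f.
Proof.
move=> VU fU c ac; have [fr fi] := fU c ac.
by split; [apply: Cinf_sub fr|apply: Cinf_sub fi];
  apply: image_subset => p [/VU ? ?].
Qed.

Lemma smooth_pointwise U f : (forall p, U p -> exists V, V p /\ smooth_on V f) -> smooth_on U f.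
Proof.
move=> H c ac; split; apply: Cinf_pointwise => _ [p [Up cp] <-];
  have [V [Vp fV]] := H p Up; have [fr fi] := fV c ac.
  by apply: Cinf_sub fr => _ ->; exists p.
by apply: Cinf_sub fi => _ ->; exists p.
Qed.

Lemma smooth_near U f g : (forall p, U p -> \forall q \near p, f q = g q) ->
  smooth_on U f -> smooth_on U g.
Proof.
move=> fg fU c ac; have [fr fi] := fU c ac.
by split; [apply: Cinf_near fr|apply: Cinf_near fi] => _ [p [Up cp] <-];
  apply: filterS (near_cmap cp (fg p Up)) => x ->.
Qed.

Lemma smooth_eq U f g : open U -> (forall p, U p -> f p = g p) ->
  smooth_on U f -> smooth_on U g.
Proof.
move=> oU fg; apply: smooth_near => p Up.
by apply: filterS (open_nbhs_nbhs (conj oU Up)) => q /fg.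
Qed.

Section open.
Variables (U : set M) (oU : open U).

Lemma smooth_cst (a : C) : smooth_on U (fun=> a).
Proof. by move=> c ac; split; exact: Cinf_cst. Qed.

Lemma smoothD f g : smooth_on U f -> smooth_on U g -> smooth_on U (fun q => f q + g q).
Proof.
move=> fU gU c ac; have oUc := @img_open c U oU.
have [fr fi] := fU c ac; have [gr gi] := gU c ac; split.
  by apply: (Cinf_open_eq oUc _ (CinfDr oUc fr gr)) => x _; case: (f _) (g _) => ? ? [].
by apply: (Cinf_open_eq oUc _ (CinfDr oUc fi gi)) => x _; case: (f _) (g _) => ? ? [].
Qed.

Lemma smoothM f g : smooth_on U f -> smooth_on U g -> smooth_on U (fun q => f q * g q).
Proof.
move=> fU gU c ac; have oUc := @img_open c U oU.
have [fr fi] := fU c ac; have [gr gi] := gU c ac; split.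
  apply: (Cinf_open_eq oUc _ (CinfBr oUc (CinfMr oUc fr gr) (CinfMr oUc fi gi))) => x _.
  by case: (f _) (g _) => ? ? [].
apply: (Cinf_open_eq oUc _ (CinfDr oUc (CinfMr oUc fr gi) (CinfMr oUc fi gr))) => x _.
by case: (f _) (g _) => ? ? [].
Qed.

Lemma smoothN f : smooth_on U f -> smooth_on U (fun q => - f q).
Proof.
move=> fU; apply: smooth_eq (smoothM (smooth_cst (-1)) fU) => // p _.
by rewrite mulN1r.
Qed.

Lemma smoothB f g : smooth_on U f -> smooth_on U g -> smooth_on U (fun q => f q - g q).
Proof. by move=> fU gU; apply: smoothD => //; exact: smoothN. Qed.

Lemma smooth_conj f : smooth_on U f -> smooth_on U (fun q => (f q)^*).
Proof.
move=> fU c ac; have oUc := @img_open c U oU; have [fr fi] := fU c ac; split.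
  by apply: (Cinf_open_eq oUc _ fr) => x _; case: (f _).
by apply: (Cinf_open_eq oUc _ (CinfNr oUc fi)) => x _; case: (f _).
Qed.

Lemma smooth_Re f : smooth_on U f -> smooth_on U (fun q => ('re (f q))%:C).
Proof.
move=> fU c ac; have oUc := @img_open c U oU; have [fr fi] := fU c ac; split.
  exact: fr.
exact: Cinf_cst.
Qed.

Lemma smooth_Im f : smooth_on U f -> smooth_on U (fun q => ('im (f q))%:C).
Proof.
move=> fU c ac; have oUc := @img_open c U oU; have [fr fi] := fU c ac; split.
  exact: fi.
exact: Cinf_cst.
Qed.

Lemma smoothV f : (forall p, U p -> f p != 0) -> smooth_on U f ->
  smooth_on U (fun q => (f q)^-1).
Proof.
move=> f0 fU c ac; have oUc := @img_open c U oU; have [fr fi] := fU c ac.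
pose N x := 're (f (cinv c x)) * 're (f (cinv c x)) + 'im (f (cinv c x)) * 'im (f (cinv c x)).
have Nk : Cinf (cmap c @` (U `&` cdom c)) N by apply: CinfDr => //; apply: CinfMr.
have N0 x : (cmap c @` (U `&` cdom c)) x -> N x != 0.
  move=> [p [Up cp] <-]; rewrite /N cmapK//; have := f0 p Up; case: (f p) => a b.
  rewrite /= -!expr2; apply: contraNneq => /eqP; rewrite paddr_eq0 ?sqr_ge0//.
  by rewrite !sqrf_eq0 => /andP[/eqP-> /eqP->].
have Vk := CinfVr oUc N0 Nk; split.
  apply: (Cinf_open_eq oUc _ (CinfMr oUc fr Vk)) => x _; rewrite /N.
  by case: (f _) => a b /=; rewrite -!expr2.
apply: (Cinf_open_eq oUc _ (CinfNr oUc (CinfMr oUc fi Vk))) => x _; rewrite /N.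
by case: (f _) => a b /=; rewrite -!expr2 ?mulNr.
Qed.

Lemma smooth_sum (I : Type) (s : seq I) (P : pred I) (F : I -> func M) :
  (forall i, P i -> smooth_on U (F i)) -> smooth_on U (fun x => \sum_(i <- s | P i) F i x).
Proof.
move=> FP; elim: s => [|i s IHs].
  by apply: smooth_eq (smooth_cst 0) => // x _; rewrite big_nil.
case Pi : (P i).
  by apply: smooth_eq (smoothD (FP i Pi) IHs) => // x _; rewrite big_cons Pi.
by apply: smooth_eq IHs => // x _; rewrite big_cons Pi.
Qed.

Lemma smooth_cont f p : smooth_on U f -> U p ->
  {for p, continuous (fun q => 're (f q))} /\ {for p, continuous (fun q => 'im (f q))}.
Proof.
move=> fU Up; have [c ac cp] := atlas_cover p; have [fr fi] := fU c ac.
have E q : cdom c q -> cinv c (cmap c q) = q by exact: cmapK.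
have near_c : \forall q \near p, cinv c (cmap c q) = q.
  by apply: filterS (open_nbhs_nbhs (conj (cdom_open c) cp)) => q /E.
have img : (cmap c @` (U `&` cdom c)) (cmap c p) by exists p.
split; apply: cont_distP => e e0.
  have := cont_dist_lt (Cinf_cont fr img) e0; rewrite E// => H.
  apply: filterS2 near_c (near_cinv cp H) => q {2}<- /ltW; exact.
have := cont_dist_lt (Cinf_cont fi img) e0; rewrite E// => H.
apply: filterS2 near_c (near_cinv cp H) => q {2}<- /ltW; exact.
Qed.

Lemma smooth_neq0 f p : smooth_on U f -> U p -> f p != 0 -> \forall q \near p, f q != 0.
Proof.
move=> fU Up f0; have [cr ci] := smooth_cont fU Up.
have [r0|r0] := eqVneq ('re (f p)) 0.
  have i0 : 'im (f p) != 0.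
    by apply: contraNneq f0 => i0; move: r0 i0; case: (f p) => a b /= -> ->.
  have := cont_dist_lt ci (_ : 0 < `|'im (f p)|); rewrite normr_gt0 => /(_ i0).
  by apply: filterS => q; apply: contraTneq => ->; rewrite subr0 ltxx.
have := cont_dist_lt cr (_ : 0 < `|'re (f p)|); rewrite normr_gt0 => /(_ r0).
by apply: filterS => q; apply: contraTneq => ->; rewrite subr0 ltxx.
Qed.

End open.

Lemma smooth_at_on U f p : open U -> U p -> smooth_on U f -> smooth_at p f.
Proof. by exists U. Qed.

Lemma smooth_at_common2 p f g : smooth_at p f -> smooth_at p g ->
  exists U, [/\ open U, U p, smooth_on U f & smooth_on U g].
Proof.
move=> [U [oU Up fU]] [V [oV Vp gV]]; exists (U `&` V); split=> //.
- exact: openI.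
- by apply: smooth_sub fU => q [].
- by apply: smooth_sub gV => q [].
Qed.

Lemma smooth_atD p f g : smooth_at p f -> smooth_at p g -> smooth_at p (fun q => f q + g q).
Proof.
move=> /smooth_at_common2/[apply] -[U [oU Up fU gU]].
exact: (smooth_at_on oU Up (smoothD oU fU gU)).
Qed.

Lemma smooth_atM p f g : smooth_at p f -> smooth_at p g -> smooth_at p (fun q => f q * g q).
Proof.
move=> /smooth_at_common2/[apply] -[U [oU Up fU gU]].
exact: (smooth_at_on oU Up (smoothM oU fU gU)).
Qed.

Lemma smooth_at_cst p (a : C) : smooth_at p (fun=> a).
Proof. by exists setT; split=> //; [exact: openT|exact: smooth_cst]. Qed.

Lemma smooth_at_conj p f : smooth_at p f -> smooth_at p (fun q => (f q)^*).
Proof. by move=> [U [oU Up fU]]; exists U; split=> //; exact: smooth_conj. Qed.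

Lemma smooth_at_conjE p f : smooth_at p (fun q => (f q)^*) <-> smooth_at p f.
Proof.
split=> [/smooth_at_conj|]; last exact: smooth_at_conj.
by rewrite (_ : (fun q => _) = f)//; apply/funext => q; rewrite conjcK.
Qed.

Lemma smooth_at_near p f g : (\forall q \near p, f q = g q) ->
  smooth_at p f -> smooth_at p g.
Proof.
move=> fg [U [oU Up fU]]; exists (U `&` [set q | f q = g q]^°); split.
- by apply: openI => //; exact: open_interior.
- by split.
- apply: (@smooth_near _ f) => [q [_]//|]; by apply: smooth_sub fU => q [].
Qed.

Lemma smooth_all_at U f : open U -> (forall p, U p -> smooth_at p f) -> smooth_on U f.
Proof. by move=> oU H; apply: smooth_pointwise => p /H[V [oV Vp fV]]; exists V. Qed.

Lemma smooth_chart c (O : set 'rV[R]_n) (g : 'rV[R]_n -> R) : atlas c ->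
  open O -> Cinf O g -> smooth_on (cdom c `&` cmap c @^-1` O) (fun q => (g (cmap c q))%:C).
Proof.
move=> ac oO gO d ad; split; last exact: Cinf_cst.
have oD : open (cdom c `&` cmap c @^-1` O).
  rewrite openE => p [cp Op]; apply: filterI.
    by apply: open_nbhs_nbhs; split=> //; exact: cdom_open.
  by apply: (near_cinv cp); apply: open_nbhs_nbhs.
apply: (@Cinf_compose _ _ _ _ O (fun x => cmap c (cinv d x)) g) => //.
- exact: img_open.
- move=> j; apply: Cinf_sub (atlas_compat ad ac j).
  by move=> _ [p [[cp Op] dp] <-]; exists p.
- by move=> _ [p [[cp Op] dp] <-] /=; rewrite cmapK.
Qed.

Definition coordf c (j : 'I_n) : func M := fun q => (cmap c q 0 j)%:C.

Lemma smooth_coord c j : atlas c -> smooth_on (cdom c) (coordf c j).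
Proof.
move=> ac; have := smooth_chart ac openT (Cinf_coord setT j).
by apply: smooth_sub => q cq; split.
Qed.

Lemma smooth_at_coord c j p : atlas c -> cdom c p -> smooth_at p (coordf c j).
Proof. by move=> ac cp; exists (cdom c); split=> //; [exact: cdom_open|exact: smooth_coord]. Qed.

End SmoothFunctions.

(** * Tangent vectors and vector fields *)

Section TangentVectors.
Variables (R : realType) (n : nat) (M : manifold R n).
Local Notation C := R[i].
Implicit Types (U V : set M) (f g : func M) (p q : M) (c d : chart R n M).
Implicit Types (v w : vec M) (X Y : vfield M).

Lemma tangentD p v f g : tangent p v -> smooth_at p f -> smooth_at p g ->
  v (fun q => f q + g q) = v f + v g.
Proof.
move=> tv fp gp; have := tangent_linear tv 1 fp gp.
by rewrite mul1r => <-; congr v; apply/funext => q; rewrite mul1r.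
Qed.

Lemma tangent0 p v : tangent p v -> v (fun=> 0) = 0.
Proof.
move=> tv; have s0 := smooth_at_cst p (0 : C).
have := tangentD tv s0 s0; rewrite (_ : (fun q => 0 + 0) = fun=> 0); last first.
  by apply/funext => q; rewrite addr0.
by move/eqP; rewrite -{1}[v _]addr0 (inj_eq (addrI _)) eq_sym => /eqP.
Qed.

Lemma tangent_cst p v (a : C) : tangent p v -> v (fun=> a) = 0.
Proof.
move=> tv; have s1 := smooth_at_cst p (1 : C).
have v1 : v (fun=> 1) = 0.
  have := tangent_leibniz tv s1 s1.
  rewrite (_ : (fun q => 1 * 1) = fun=> 1); last by apply/funext => q; rewrite mulr1.
  rewrite mulr1 mul1r => /eqP.
  by rewrite -{1}[v _]addr0 (inj_eq (addrI _)) eq_sym => /eqP.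
have := tangent_linear tv a s1 (smooth_at_cst p (0 : C)).
by rewrite v1 (tangent0 tv) mulr0 !addr0 mulr1.
Qed.

Lemma tangentZ p v (a : C) f : tangent p v -> smooth_at p f -> v (fun q => a * f q) = a * v f.
Proof.
move=> tv fp; have := tangent_linear tv a fp (smooth_at_cst p (0 : C)).
rewrite (tangent0 tv) addr0 => <-; congr v; apply/funext => q; by rewrite addr0.
Qed.

Lemma tangentN p v f : tangent p v -> smooth_at p f -> v (fun q => - f q) = - v f.
Proof.
move=> tv fp; have := tangentZ (-1) tv fp; rewrite mulN1r => <-.
by congr v; apply/funext => q; rewrite mulN1r.
Qed.

Lemma smooth_atN p f : smooth_at p f -> smooth_at p (fun q => - f q).
Proof. by move=> [U [oU Up fU]]; exists U; split=> //; exact: smoothN. Qed.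

Lemma tangentB p v f g : tangent p v -> smooth_at p f -> smooth_at p g ->
  v (fun q => f q - g q) = v f - v g.
Proof.
by move=> tv fp gp; rewrite -(tangentN tv gp) -(tangentD tv fp)//; exact: smooth_atN.
Qed.

Lemma smooth_at_sum p (I : Type) (s : seq I) (F : I -> func M) :
  (forall i, smooth_at p (F i)) -> smooth_at p (fun q => \sum_(i <- s) F i q).
Proof.
move=> Fp; elim: s => [|i s IHs].
  rewrite (_ : (fun q => _) = fun=> 0); first exact: smooth_at_cst.
  by apply/funext => q; rewrite big_nil.
rewrite (_ : (fun q => _) = fun q => F i q + \sum_(j <- s) F j q).
  exact: smooth_atD.
by apply/funext => q; rewrite big_cons.
Qed.

Lemma tangent_sum p v (I : Type) (s : seq I) (F : I -> func M) :
  tangent p v -> (forall i, smooth_at p (F i)) ->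
  v (fun q => \sum_(i <- s) F i q) = \sum_(i <- s) v (F i).
Proof.
move=> tv Fp; elim: s => [|i s IHs].
  rewrite big_nil -[RHS](tangent0 tv); congr v.
  by apply/funext => q; rewrite big_nil.
rewrite big_cons -IHs -(tangentD tv)//; last exact: smooth_at_sum.
by congr v; apply/funext => q; rewrite big_cons.
Qed.

(** The indicator function of a neighbourhood of [p] is smooth near [p], is
    idempotent and hence killed by [v]. *)
Lemma tangent_near p v f g : tangent p v -> (\forall q \near p, f q = g q) -> v f = v g.
Proof.
move=> tv fg; have [fp|fp] := pselect (smooth_at p f); last first.
  rewrite !(tangent_junk tv)// => gp; apply: fp; apply: smooth_at_near gp.
  by apply: filterS fg => q ->.
have gp := smooth_at_near fg fp.
pose chi q : C := if `[< f q = g q >] then 1 else 0.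
have chi1 : \forall q \near p, chi q = 1.
  by apply: filterS fg => q e; rewrite /chi asboolT.
have chip : smooth_at p chi.
  by apply: smooth_at_near (smooth_at_cst p (1 : C)); apply: filterS chi1 => q ->.
have vchi : v chi = 0.
  have := tangent_leibniz tv chip chip.
  rewrite (_ : (fun q => chi q * chi q) = chi); last first.
    by apply/funext => q; rewrite /chi; case: ifP => _; rewrite ?mulr1 ?mulr0.
  rewrite (nbhs_singleton chi1) mulr1 mul1r => /eqP.
  by rewrite -{1}[v chi]addr0 (inj_eq (addrI _)) eq_sym => /eqP.
have := tangent_leibniz tv fp chip; have := tangent_leibniz tv gp chip.
rewrite vchi !mulr0 !addr0 (nbhs_singleton chi1) !mulr1 => <- <-; congr v.
by apply/funext => q; rewrite /chi; case: ifPn => [/asboolP->|_]; rewrite ?mulr0.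
Qed.

Lemma tangent_comb p v w (a b : C) : tangent p v -> tangent p w ->
  tangent p (fun f => a * v f + b * w f).
Proof.
move=> tv tw; split.
- move=> k f g fp gp; rewrite !(tangent_linear tv)// !(tangent_linear tw)//; ring.
- move=> f g fp gp; rewrite !(tangent_leibniz tv)// !(tangent_leibniz tw)//; ring.
- by move=> f fp; rewrite !(tangent_junk tv)// !(tangent_junk tw)// !mulr0 addr0.
Qed.

Lemma tangent_vec0 p : tangent p (fun=> 0 : C).
Proof.
by split=> // [k f g _ _|f g _ _]; rewrite ?mulr0 ?mul0r addr0.
Qed.

Lemma tangent_vecZ p v (a : C) : tangent p v -> tangent p (fun f => a * v f).
Proof.
move=> tv; have := tangent_comb a 0 tv (tangent_vec0 p).
by rewrite (_ : (fun f => _ + _) = fun f => a * v f)//; apply/funext => f; rewrite mulr0 addr0.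
Qed.

Lemma tangent_vec_sum p (I : Type) (s : seq I) (F : I -> vec M) :
  (forall i, tangent p (F i)) -> tangent p (fun f => \sum_(i <- s) F i f).
Proof.
move=> Fp; elim: s => [|i s IHs].
  rewrite (_ : (fun f => _) = fun=> 0); first exact: tangent_vec0.
  by apply/funext => f; rewrite big_nil.
rewrite (_ : (fun f => _) = fun f => 1 * F i f + 1 * \sum_(i <- s) F i f).
  exact: tangent_comb.
by apply/funext => f; rewrite big_cons !mul1r.
Qed.

Lemma tangent_conjv p v : tangent p v -> tangent p (conjv v).
Proof.
move=> tv; split.
- move=> k f g fp gp; rewrite /conjv.
  rewrite (_ : (fun q => (k * f q + g q)^*) = fun q => k^* * (f q)^* + (g q)^*); last first.
    by apply/funext => q; rewrite rmorphD rmorphM.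
  rewrite (tangent_linear tv); [|exact: smooth_at_conj..].
  by rewrite rmorphD rmorphM /= conjcK.
- move=> f g fp gp; rewrite /conjv.
  rewrite (_ : (fun q => (f q * g q)^*) = fun q => (f q)^* * (g q)^*); last first.
    by apply/funext => q; rewrite rmorphM.
  rewrite (tangent_leibniz tv); [|exact: smooth_at_conj..].
  by rewrite rmorphD !rmorphM /= !conjcK.
- by move=> f fp; rewrite /conjv (tangent_junk tv) ?conjc0// smooth_at_conjE.
Qed.

Lemma conjvK v : conjv (conjv v) = v.
Proof.
by apply/funext => f; rewrite /conjv conjcK; congr v; apply/funext => q; rewrite conjcK.
Qed.

Definition partial c (j : 'I_n) : vfield M := fun p f =>
  if `[< smooth_at p f >] then
    Complex ('D_'e_j (fun x => 're (f (cinv c x))) (cmap c p))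
            ('D_'e_j (fun x => 'im (f (cinv c x))) (cmap c p))
  else 0.

Section chart.
Variables (c : chart R n M) (ac : atlas c).

Lemma smooth_at_chart p f : cdom c p -> smooth_at p f -> exists r : R, [/\ 0 < r,
  ball (cmap c p) r `<=` cmap c @` cdom c,
  Cinf (ball (cmap c p) r) (fun x => 're (f (cinv c x))) &
  Cinf (ball (cmap c p) r) (fun x => 'im (f (cinv c x)))].
Proof.
move=> cp [U [oU Up fU]]; have [fr fi] := fU c ac.
have : nbhs (cmap c p) (cmap c @` (U `&` cdom c)).
  by apply: open_nbhs_nbhs; split; [exact: img_open|exists p].
move=> /nbhs_ballP[r /= r0 rP]; exists r; split=> //.
- by apply: subset_trans rP _; apply: image_subset => q [].
- exact: Cinf_sub fr.
- exact: Cinf_sub fi.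
Qed.

Lemma partial_tangent j p : cdom c p -> tangent p (partial c j p).
Proof.
move=> cp.
pose re_ f x := 're (f (cinv c x)) : R; pose im_ f x := 'im (f (cinv c x)) : R.
pose a := cmap c p.
have der f : smooth_at p f -> is_derive a 'e_j (re_ f) ('D_'e_j (re_ f) a) /\
    is_derive a 'e_j (im_ f) ('D_'e_j (im_ f) a).
  move=> fp; have [r [r0 _ fr fi]] := smooth_at_chart cp fp.
  have ar : ball a r a by exact: ballxx.
  by split; apply: DeriveDef; [exact: Cinf_derivable fr ar| |exact: Cinf_derivable fi ar|].
split.
- move=> k f g fp gp; have [f1 f2] := der f fp; have [g1 g2] := der g gp.
  rewrite /partial !asboolT//; last first.
    by apply: smooth_atD => //; apply: smooth_atM => //; exact: smooth_at_cst.
  have -> : (fun x => 're (k * f (cinv c x) + g (cinv c x))) =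
     (fun x => 're k * re_ f x - 'im k * im_ f x + re_ g x).
    by apply/funext => x; rewrite /re_ /im_; case: k (f _) (g _) => ? ? [? ?] [].
  have -> : (fun x => 'im (k * f (cinv c x) + g (cinv c x))) =
     (fun x => 're k * im_ f x + 'im k * re_ f x + im_ g x).
    by apply/funext => x; rewrite /re_ /im_; case: k (f _) (g _) => ? ? [? ?] [].
  have [_ ->] := is_deriveDx (is_deriveBx (is_deriveZx ('re k) f1) (is_deriveZx ('im k) f2)) g1.
  have [_ ->] := is_deriveDx (is_deriveDx (is_deriveZx ('re k) f2) (is_deriveZx ('im k) f1)) g2.
  by case: k.
- move=> f g fp gp; have [f1 f2] := der f fp; have [g1 g2] := der g gp.
  rewrite /partial !asboolT//; last exact: smooth_atM.
  have -> : (fun x => 're (f (cinv c x) * g (cinv c x))) =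
     (fun x => re_ f x * re_ g x - im_ f x * im_ g x).
    by apply/funext => x; rewrite /re_ /im_; case: (f _) (g _) => ? ? [].
  have -> : (fun x => 'im (f (cinv c x) * g (cinv c x))) =
     (fun x => re_ f x * im_ g x + im_ f x * re_ g x).
    by apply/funext => x; rewrite /re_ /im_; case: (f _) (g _) => ? ? [].
  have [_ ->] := is_deriveBx (is_deriveMx f1 g1) (is_deriveMx f2 g2).
  have [_ ->] := is_deriveDx (is_deriveMx f1 g2) (is_deriveMx f2 g1).
  rewrite /re_ /im_ /a cmapK//; case: (f p) (g p) => fa fb [ga gb] /=.
  by apply/eqP; rewrite eq_complex /=; apply/andP; split; apply/eqP; ring.
- by move=> f fp; rewrite /partial asboolF.
Qed.

Lemma near_cinv_fun p (g : 'rV[R]_n -> R) f : cdom c p ->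
  (\forall q \near p, f q = (g (cmap c q))%:C) ->
  smooth_at p f -> forall j, partial c j p f = ('D_'e_j g (cmap c p))%:C.
Proof.
move=> cp fg fp j; rewrite /partial asboolT//.
have E : \forall x \near cmap c p, f (cinv c x) = (g x)%:C.
  by apply: filterS2 (near_cmap cp fg) (cimg_nbhs cp) => x -> [q cq <-]; rewrite cmapK.
congr Complex.
  by apply: near_eq_derive; apply: filterS E => x ->.
rewrite -[RHS](derive_cst (0 : R) (cmap c p) 'e_j).
by apply: near_eq_derive; apply: filterS E => x ->.
Qed.

Lemma partial_coord p i j : cdom c p -> partial c j p (coordf c i) = (j == i)%:R.
Proof.
move=> cp; rewrite (near_cinv_fun (g := fun x => x 0 i) cp _ (smooth_at_coord i ac cp)).
  by rewrite derive_coord; case: eqP.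
exact: nearW.
Qed.

(** Hadamard's lemma writes a smooth function near [p] as
    [f p + \sum_j (x_j - x_j p) * q_j], and a derivation sees only the values
    [q_j p] and its own values on the coordinates. *)
Lemma tangent_eq_real p v w (h : 'rV[R]_n -> R) r : cdom c p -> tangent p v -> tangent p w ->
  (forall j, v (coordf c j) = w (coordf c j)) ->
  0 < r -> ball (cmap c p) r `<=` cmap c @` cdom c -> Cinf (ball (cmap c p) r) h ->
  v (fun q => (h (cmap c q))%:C) = w (fun q => (h (cmap c q))%:C).
Proof.
move=> cp tv tw vw r0 rc hk; pose a := cmap c p.
have [qq [qk hE]] := hadamard hk.
have sm (g : 'rV[R]_n -> R) : Cinf (ball a r) g -> smooth_at p (fun q => (g (cmap c q))%:C).
  move=> gk; exists (cdom c `&` cmap c @^-1` ball a r); split.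
  - rewrite openE => q [cq qr]; apply: filterI.
      by apply: open_nbhs_nbhs; split=> //; exact: cdom_open.
    by apply: (near_cinv cq); apply: open_nbhs_nbhs; split=> //; exact: ball_open.
  - by split=> //; exact: ballxx.
  - by apply: smooth_chart => //; exact: ball_open.
pose u j q : C := coordf c j q + (- a 0 j)%:C.
have uj j : smooth_at p (u j) by apply: smooth_atD; [exact: smooth_at_coord|exact: smooth_at_cst].
pose G q : C := (h a)%:C + \sum_j u j q * (qq j (cmap c q))%:C.
have sj j : smooth_at p (fun q => u j q * (qq j (cmap c q))%:C).
  by apply: smooth_atM => //; exact: sm.
have hG : \forall q \near p, (h (cmap c q))%:C = G q.
  have : \forall q \near p, ball a r (cmap c q).
    by apply: (near_cinv cp); exact: nbhsx_ballx.
  apply: filterS => q /hE ->; rewrite /G rmorphD rmorph_sum /=; congr (_ + _).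
  by apply: eq_bigr => j _; rewrite /u /coordf -rmorphD -rmorphM.
have key x : tangent p x -> x G = \sum_j x (coordf c j) * (qq j a)%:C.
  move=> tx; rewrite /G (tangentD tx); [|exact: smooth_at_cst|exact: smooth_at_sum].
  rewrite (tangent_cst _ tx) add0r (tangent_sum _ tx sj); apply: eq_bigr => j _.
  rewrite (tangent_leibniz tx (uj j) (sm _ (qk j))).
  have -> : u j p = 0 by rewrite /u /coordf -rmorphD /= subrr.
  rewrite mul0r addr0 /u (tangentD tx); [|exact: smooth_at_coord|exact: smooth_at_cst].
  by rewrite (tangent_cst _ tx) addr0.
rewrite (tangent_near tv hG) (tangent_near tw hG) !key//.
by apply: eq_bigr => j _; rewrite vw.
Qed.

Lemma tangent_eq p v w : cdom c p -> tangent p v -> tangent p w ->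
  (forall j, v (coordf c j) = w (coordf c j)) -> v = w.
Proof.
move=> cp tv tw vw; apply/funext => f.
have [fp|fp] := pselect (smooth_at p f); last by rewrite (tangent_junk tv) ?(tangent_junk tw).
have [r [r0 rc fr fi]] := smooth_at_chart cp fp.
have sr : smooth_at p (fun q => ('re (f q))%:C).
  by have [U [oU Up fU]] := fp; exists U; split=> //; exact: smooth_Re.
have si : smooth_at p (fun q => ('im (f q))%:C).
  by have [U [oU Up fU]] := fp; exists U; split=> //; exact: smooth_Im.
have E x : tangent p x -> x f = 'i * x (fun q => ('im (f q))%:C) + x (fun q => ('re (f q))%:C).
  move=> tx; rewrite -(tangent_linear tx 'i si sr); congr x; apply/funext => q.
  by rewrite addrC -complexE.
have nc h : \forall q \near p, ((h (f q) : R)%:C : C) = (h (f (cinv c (cmap c q))))%:C.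
  by apply: filterS (open_nbhs_nbhs (conj (cdom_open c) cp)) => q cq; rewrite cmapK.
rewrite (E v tv) (E w tw); congr (_ * _ + _).
  rewrite (tangent_near tv (nc (@complex.Im R))) (tangent_near tw (nc (@complex.Im R))).
  exact: (tangent_eq_real (h := fun x => 'im (f (cinv c x))) cp tv tw vw r0 rc fi).
rewrite (tangent_near tv (nc (@complex.Re R))) (tangent_near tw (nc (@complex.Re R))).
exact: (tangent_eq_real (h := fun x => 're (f (cinv c x))) cp tv tw vw r0 rc fr).
Qed.

Lemma tangent_expand p v : cdom c p -> tangent p v ->
  v = fun f => \sum_j v (coordf c j) * partial c j p f.
Proof.
move=> cp tv; apply: (tangent_eq cp tv).
  by apply: tangent_vec_sum => j; apply: tangent_vecZ; exact: partial_tangent.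
move=> i; rewrite (bigD1 i)//= partial_coord// eqxx mulr1 big1 ?addr0// => j ji.
by rewrite partial_coord// (negPf ji) mulr0.
Qed.

Lemma partial_conj j p : cdom c p -> conjv (partial c j p) = partial c j p.
Proof.
move=> cp; apply: (tangent_eq cp); [exact/tangent_conjv/partial_tangent|exact: partial_tangent|].
move=> i; rewrite /conjv (_ : (fun q => (coordf c i q)^*) = coordf c i).
  by rewrite partial_coord// conjc_nat.
by apply/funext => q; rewrite conjc_real.
Qed.

Lemma partial_smooth j : smooth_vfield (cdom c) (partial c j).
Proof.
split=> [p cp|V f oV Vc fV]; first exact: partial_tangent.
have [fr fi] := fV c ac; have oVc := @img_open _ _ _ c V oV.
pose g x := Complex ('D_'e_j (fun x => 're (f (cinv c x))) x) ('D_'e_j (fun x => 'im (f (cinv c x))) x) : C.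
have E p : V p -> partial c j p f = g (cmap c p).
  by move=> Vp; rewrite /partial asboolT//; exists V.
pose O := cmap c @` (V `&` cdom c).
have VO : V `<=` cdom c `&` cmap c @^-1` O.
  by move=> p Vp; split; [exact: Vc|exists p; split=> //; exact: Vc].
have s1 := smooth_sub VO (smooth_chart ac oVc (Cinf_D j fr)).
have s2 := smooth_sub VO (smooth_chart ac oVc (Cinf_D j fi)).
apply: (smooth_eq oV _ (smoothD oV s1 (smoothM oV (smooth_cst V 'i) s2))) => p Vp.
by rewrite [RHS]E// [RHS]complexE.
Qed.

End chart.

Lemma tangent_conj_eq p v f : tangent p v -> conjv v = v -> v (fun q => (f q)^*) = (v f)^*.
Proof. by move=> tv {1}<-; rewrite /conjv; congr (_^*); congr v; apply/funext => q; rewrite conjcK. Qed.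

Lemma vfield_sub U V X : V `<=` U -> smooth_vfield U X -> smooth_vfield V X.
Proof.
move=> VU [tX sX]; split=> [p /VU/tX//|W f oW WV]; apply: sX => //.
exact: subset_trans VU.
Qed.

Lemma vfield_smooth_at U X f p : open U -> smooth_vfield U X -> U p -> smooth_at p f ->
  smooth_at p (fun q => X q f).
Proof.
move=> oU [_ sX] Up [V [oV Vp fV]]; exists (V `&` U); split=> //; first exact: openI.
by apply: sX; [exact: openI|exact: subIsetr|apply: smooth_sub fV; exact: subIsetl].
Qed.

Lemma vfield_comb U X Y a b : open U -> smooth_on U a -> smooth_on U b ->
  smooth_vfield U X -> smooth_vfield U Y ->
  smooth_vfield U (fun q f => a q * X q f + b q * Y q f).
Proof.
move=> oU aU bU [tX sX] [tY sY]; split=> [p Up|V f oV VU fV].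
  by apply: tangent_comb; [exact: tX|exact: tY].
by apply: smoothD => //; apply: smoothM => //; [exact: smooth_sub aU|exact: sX|
  exact: smooth_sub bU|exact: sY].
Qed.

Lemma vfieldZ U X a : open U -> smooth_on U a -> smooth_vfield U X ->
  smooth_vfield U (fun q f => a q * X q f).
Proof.
move=> oU aU [tX sX]; split=> [p Up|V f oV VU fV]; first exact/tangent_vecZ/tX.
by apply: smoothM => //; [exact: smooth_sub aU|exact: sX].
Qed.

Lemma vfield_conj U X : open U -> smooth_vfield U X -> smooth_vfield U (conj_field X).
Proof.
move=> oU [tX sX]; split=> [p Up|V f oV VU fV]; first exact/tangent_conjv/tX.
by apply: smooth_conj => //; apply: sX => //; exact: smooth_conj.
Qed.

Section bracket.
Variables (U : set M) (oU : open U) (X Y : vfield M).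
Hypotheses (sX : smooth_vfield U X) (sY : smooth_vfield U Y).

Lemma bracket_tangent p : U p -> tangent p (lie_bracket X Y p).
Proof.
move=> Up; have tX := vfield_tangent sX Up; have tY := vfield_tangent sY Up.
have aX f : smooth_at p f -> smooth_at p (fun q => X q f) by exact: vfield_smooth_at sX Up.
have aY f : smooth_at p f -> smooth_at p (fun q => Y q f) by exact: vfield_smooth_at sY Up.
have near2 f g : smooth_at p f -> smooth_at p g ->
    \forall q \near p, [/\ U q, smooth_at q f & smooth_at q g].
  move=> /smooth_at_common2/[apply] -[V [oV Vp fV gV]].
  apply: filterS2 (open_nbhs_nbhs (conj oU Up)) (open_nbhs_nbhs (conj oV Vp)) => q Uq Vq.
  by split=> //; exists V.
split=> [a f g fp gp|f g fp gp|f fp].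
- rewrite /lie_bracket !asboolT//; last first.
    by apply: smooth_atD => //; apply: smooth_atM => //; exact: smooth_at_cst.
  rewrite (tangent_near tX (g := fun q => a * Y q f + Y q g)); last first.
    apply: filterS (near2 f g fp gp) => q [Uq fq gq].
    exact: (tangent_linear (vfield_tangent sY Uq) a fq gq).
  rewrite (tangent_near tY (g := fun q => a * X q f + X q g)); last first.
    apply: filterS (near2 f g fp gp) => q [Uq fq gq].
    exact: (tangent_linear (vfield_tangent sX Uq) a fq gq).
  rewrite (tangent_linear tX a (aY f fp) (aY g gp)) (tangent_linear tY a (aX f fp) (aX g gp)).
  ring.
- rewrite /lie_bracket !asboolT//; last exact: smooth_atM.
  rewrite (tangent_near tX (g := fun q => Y q f * g q + f q * Y q g)); last first.
    apply: filterS (near2 f g fp gp) => q [Uq fq gq].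
    exact: (tangent_leibniz (vfield_tangent sY Uq) fq gq).
  rewrite (tangent_near tY (g := fun q => X q f * g q + f q * X q g)); last first.
    apply: filterS (near2 f g fp gp) => q [Uq fq gq].
    exact: (tangent_leibniz (vfield_tangent sX Uq) fq gq).
  have [Xf Xg Yf Yg] := And4 (aX f fp) (aX g gp) (aY f fp) (aY g gp).
  rewrite (tangentD tX); [|exact: smooth_atM..].
  rewrite (tangentD tY); [|exact: smooth_atM..].
  rewrite !(tangent_leibniz tX)// !(tangent_leibniz tY)//; ring.
- by rewrite /lie_bracket asboolF.
Qed.

Lemma bracket_smooth : smooth_vfield U (lie_bracket X Y).
Proof.
split=> [p|V f oV VU fV]; first exact: bracket_tangent.
apply: (@smooth_eq _ _ _ _ (fun q => X q (fun r => Y r f) - Y q (fun r => X r f))) => //.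
  by move=> p Vp; rewrite /lie_bracket asboolT//; exists V.
apply: smoothB => //.
  by apply: (vfield_smooth sX) => //; exact: (vfield_smooth sY).
by apply: (vfield_smooth sY) => //; exact: (vfield_smooth sX).
Qed.

Lemma bracketE p f : smooth_at p f ->
  lie_bracket X Y p f = X p (fun q => Y q f) - Y p (fun q => X q f).
Proof. by move=> fp; rewrite /lie_bracket asboolT. Qed.

End bracket.
End TangentVectors.

(** * Lattice sums *)

Section LatticeSums.
Variables (R : realType) (n : nat).
Implicit Types (f g : 'rV[R]_n -> R) (x : 'rV[R]_n) (N L : nat).

(** The nodes are the multiples of the mesh in [[-(N+1), N+1]]: there are
   [2 (N+1)^2 + 1] of them on each axis. *)
Definition nodes N := (2 * (N.+1 * N.+1)).+1.

Definition node N (i : nat) : R := i%:R / N.+1%:R - N.+1%:R.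

Definition latpt N (t : {ffun 'I_n -> 'I_(nodes N)}) : 'rV[R]_n := \row_j node N (t j).

(** The Riemann sum of [g] over the cube of half-width [N + 1], with mesh
    [1 / (N + 1)]: a fixed compact set is eventually inside the cube, so that
    the sums of compactly supported functions need no reference to a box. *)
Definition lsum N g : R := (N.+1%:R^-1) ^+ n * \sum_t g (@latpt N t).

(** For a compactly supported continuous function this says that its integral is
    zero. *)
Definition null g := (fun N => lsum N g) @ \oo --> (0 : R).

Definition supp_in (L : nat) g := forall x, L%:R < `|x| -> g x = 0.

Lemma lsumD N f g : lsum N (fun x => f x + g x) = lsum N f + lsum N g.
Proof. by rewrite /lsum big_split/= mulrDr. Qed.

Lemma lsumZ N (a : R) g : lsum N (fun x => a * g x) = a * lsum N g.
Proof. by rewrite /lsum -mulr_sumr mulrCA. Qed.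

Lemma nullD f g : null f -> null g -> null (fun x => f x + g x).
Proof.
move=> nf ng; rewrite /null (_ : (fun N => _) = (fun N => lsum N f + lsum N g)).
  by rewrite -[X in _ --> X](addr0 0); apply: cvgD.
by apply/funext => N; exact: lsumD.
Qed.

Lemma nullZ (a : R) g : null g -> null (fun x => a * g x).
Proof.
move=> ng; rewrite /null (_ : (fun N => _) = (fun N => a * lsum N g)).
  by rewrite -[X in _ --> X](mulr0 a); apply: cvgM => //; exact: cvg_cst.
by apply/funext => N; exact: lsumZ.
Qed.

Lemma null_eq f g : (forall x, f x = g x) -> null f -> null g.
Proof. by move=> fg; rewrite (_ : f = g)//; apply/funext. Qed.

Lemma null0 : null (fun=> 0).
Proof.
rewrite /null (_ : (fun N => _) = fun=> 0); first exact: cvg_cst.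
by apply/funext => N; rewrite /lsum big1 ?mulr0.
Qed.

Lemma null_sum (I : Type) (s : seq I) (F : I -> 'rV[R]_n -> R) :
  (forall i, null (F i)) -> null (fun x => \sum_(i <- s) F i x).
Proof.
move=> FP; elim: s => [|i s IHs].
  by apply: null_eq null0 => x; rewrite big_nil.
by apply: null_eq (nullD (FP i) IHs) => x; rewrite big_cons.
Qed.

Lemma card_nodes N L :
  (#|[pred i : 'I_(nodes N) | (`|node N i| <= L%:R)%R]| <= (2 * L * N.+1).+1)%N.
Proof.
set A := [pred i | _]; pose a := (N.+1 * N.+1 - L * N.+1)%N.
have -> : #|A| = size [seq val i | i <- enum A] by rewrite size_map cardE.
have -> : (2 * L * N.+1).+1 = size (iota a (2 * L * N.+1).+1) by rewrite size_iota.
apply: uniq_leq_size; first by rewrite map_inj_uniq ?enum_uniq//; exact: val_inj.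
move=> k kin; have [i + ->] := mapP kin; rewrite mem_enum inE /node ler_norml lerBrDr lerBlDr => /andP[l r] {kin}.
have N0 : 0 < N.+1%:R :> R by rewrite ltr0n.
move: l r; rewrite ler_pdivlMr// ler_pdivrMr// [- _ + _]addrC mulrBl lerBlDr -!natrM -!natrD -natrM.
rewrite !ler_nat mem_iota /a mulnDl -mulnA.
move: (L * N.+1)%N (N.+1 * N.+1)%N => p q /=; lia.
Qed.

Lemma leq_expn2 (a b k : nat) : (a <= b)%N -> (a ^ k <= b ^ k)%N.
Proof. by case: k => // k ab; rewrite leq_exp2r. Qed.

Lemma card_latpt N L :
  (#|[pred t | (`|@latpt N t| <= L%:R)%R]| <= (2 * L * N.+1).+1 ^ n)%N.
Proof.
pose A := [pred i : 'I_(nodes N) | `|node N i| <= L%:R :> R].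
apply: (@leq_trans (#|A| ^ n)); last exact/leq_expn2/card_nodes.
rewrite -[X in (_ ^ X)%N]card_ord -(card_ffun_on 'I_n); apply: subset_leq_card.
apply/fintype.subsetP => t; rewrite inE => tL; apply/ffun_onP => j; rewrite inE.
apply: le_trans tL; have := norm_coord_le (latpt t) j.
by rewrite mxE.
Qed.

Lemma lsum_bound N L g (C : R) : 0 <= C -> supp_in L g -> (forall x, `|g x| <= C) ->
  `|lsum N g| <= C * (2 * L + 1)%:R ^+ n.
Proof.
move=> C0 gL gC; have N0 : 0 < N.+1%:R :> R by rewrite ltr0n.
rewrite /lsum normrM ger0_norm ?exprn_ge0 ?invr_ge0// exprVn ler_pdivrMl ?exprn_gt0//.
apply: le_trans (ler_norm_sum _ _ _) _.
rewrite (bigID [pred t | `|@latpt N t| <= L%:R])/= [X in _ + X]big1 ?addr0; last first.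
  by move=> t; rewrite -ltNge => /gL ->; rewrite normr0.
apply: le_trans (ler_sum _ (fun t _ => gC _)) _.
rewrite sumr_const -[leLHS]mulr_natr [leRHS]mulrCA.
apply: ler_wpM2l => //.
rewrite -exprMn -natrM -natrX ler_nat.
apply: leq_trans (card_latpt N L) _; apply: leq_expn2; nia.
Qed.

(** ** The lattice sums of a derivative tend to zero *)

Lemma supp_D L g i : supp_in L g -> supp_in L (fun x => 'D_'e_i g x).
Proof.
move=> gL x Lx; rewrite -[RHS](derive_cst (0 : R) x 'e_i); apply: near_eq_derive.
have oL : open [set y : 'rV[R]_n | L%:R < `|y|].
  apply: (@open_comp _ _ (fun y : 'rV[R]_n => `|y|) [set r | L%:R < r]) => //.
    by move=> y _; exact: norm_continuous.
by apply: filterS (open_nbhs_nbhs (conj oL Lx)) => y /gL.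
Qed.

Lemma supp_bounded L g : supp_in L g -> continuous g -> exists2 C, 0 < C & forall x, `|g x| <= C.
Proof.
move=> gL cg; pose B := [set x : 'rV[R]_n | `|x| <= L%:R].
have cB : compact B.
  apply: bounded_closed_compact.
    by exists L%:R; split; [exact: num_real|move=> r Lr x xL; exact: le_trans xL (ltW Lr)].
  apply: (@preimage_closed _ _ (fun y : 'rV[R]_n => `|y|) [set r | r <= L%:R]).
    by move=> y _; exact: norm_continuous.
  exact: closed_le.
have /compact_bounded[C [_ HC]] : compact (g @` B).
  by apply: continuous_compact => //; exact: continuous_subspaceT.
exists (Num.max 1 (C + 1)); first by rewrite lt_max ltr01.
move=> x; have [xL|/gL->] := leP `|x| L%:R; last by rewrite normr0 le_max ler01.
by rewrite le_max (HC (C + 1)) ?orbT ?ltrDl//; exists x.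
Qed.

(** Translation by one mesh along the axis [i], wrapped around so as to be a
   bijection of the nodes; the wrapped nodes lie outside the supports. *)
Definition cycle_at N (i : 'I_n) (t : {ffun 'I_n -> 'I_(nodes N)}) : {ffun 'I_n -> 'I_(nodes N)} :=
  [ffun j => if j == i then ordS (t j) else t j].

Lemma cycle_at_inj N i : injective (@cycle_at N i).
Proof.
move=> t u /ffunP tu; apply/ffunP => j; have := tu j; rewrite !ffunE.
by case: eqP => // _; exact: ordS_inj.
Qed.

Lemma lsum_shift N L g i : supp_in L g -> (L <= N)%N ->
  lsum N (fun x => g (x + N.+1%:R^-1 *: 'e_i)) = lsum N g.
Proof.
move=> gL LN; rewrite /lsum; congr (_ * _).
rewrite [RHS](reindex_inj (@cycle_at_inj N i))/=; apply: eq_bigr => t _.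
have N0 : N.+1%:R != 0 :> R by rewrite pnatr_eq0.
have LN' : L%:R < N.+1%:R :> R by rewrite ltr_nat ltnS.
have out (x : 'rV[R]_n) : N.+1%:R <= `|x 0 i| -> g x = 0.
  by move=> Nx; apply: gL; apply: lt_le_trans LN' (le_trans Nx _); exact: norm_coord_le.
have [ti|ti] := ltnP (t i).+1 (nodes N).
  congr g; apply/rowP => j; rewrite !mxE eqxx /= !ffunE.
  have [->|ne] := eqVneq j i; last by rewrite mulr0 addr0.
  by rewrite /ordS/= modn_small// /node mulr1 -[(t i).+1%:R]natr1 mulrDl mul1r addrAC.
have tiE : val (t i) = (2 * (N.+1 * N.+1))%N.
  by have := ltn_ord (t i); move: ti; rewrite /nodes /=; lia.
rewrite !out//.
  rewrite !mxE !ffunE eqxx /ordS/= tiE -/(nodes N) modnn /node mul0r sub0r normrN.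
  by rewrite ger0_norm.
rewrite !mxE !eqxx mulr1 /node tiE.
have -> : (2 * (N.+1 * N.+1))%:R / N.+1%:R = 2 * N.+1%:R :> R.
  by rewrite !natrM !mulrA mulfK.
have -> : 2 * N.+1%:R - N.+1%:R + N.+1%:R^-1 = N.+1%:R + N.+1%:R^-1 :> R by ring.
by rewrite ger0_norm ?addr_ge0// lerDl invr_ge0.
Qed.

(** The difference quotient of [g] with step the mesh has lattice sum exactly zero by
    [lsum_shift], and it differs from the derivative by O(1/N), which the bound
    [lsum_bound] converts into a bound on lattice sums. *)
Lemma null_partial L g i : supp_in L g -> Cinf setT g -> null (fun x => 'D_'e_i g x).
Proof.
move=> gL gk; have g1L := supp_D i gL; have g2L := supp_D i g1L.
have g1k := Cinf_D i gk; have g2k := Cinf_D i g1k.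
have [C C0 HC] : exists2 C, 0 < C & forall x, `|'D_'e_i (fun y => 'D_'e_i g y) x| <= C.
  by apply: supp_bounded g2L _ => x; exact: Cinf_cont g2k _.
pose h N : R := N.+1%:R^-1.
have h0 N : 0 < h N by rewrite invr_gt0 ltr0n.
have h1 N : h N <= 1 by rewrite invf_le1 ?ltr0n// ler1n.
pose r N x := (h N)^-1 * (g (x + h N *: 'e_i) + (-1) * g x) + (-1) * 'D_'e_i g x.
have e1 : `|'e_i : 'rV[R]_n| <= 1.
  by apply: mx_norm_le => // j; rewrite !mxE eqxx/=; case: eqP; rewrite ?normr1 ?normr0.
have rC N x : `|r N x| <= C * h N.
  have [s sh E] : exists2 s, `|s| <= `|h N| & g (x + h N *: 'e_i) - g x = h N * 'D_'e_i g (x + s *: 'e_i).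
    by apply: MVT_line => s _; exact: Cinf_derivable gk _.
  have [u us E2] : exists2 u, `|u| <= `|s| & 'D_'e_i g (x + s *: 'e_i) - 'D_'e_i g x
      = s * 'D_'e_i (fun y => 'D_'e_i g y) (x + u *: 'e_i).
    by apply: (MVT_line (g := fun y => 'D_'e_i g y)) => u _; exact: Cinf_derivable g1k _.
  rewrite /r !mulN1r E mulKf ?gt_eqF// E2 normrM mulrC ler_pM//.
  by rewrite -[leRHS]ger0_norm// ltW.
have rL N : supp_in L.+1 (r N).
  move=> x Lx; rewrite /r gL ?gL ?g1L ?mulr0 ?addr0 ?mulr0//.
  - by apply: lt_trans Lx; rewrite ltr_nat.
  - by apply: lt_trans Lx; rewrite ltr_nat.
  rewrite -[x](addrK (h N *: 'e_i)) in Lx.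
  have := lt_le_trans Lx (ler_normB _ _); rewrite -natr1 => H.
  have : `|h N *: 'e_i| <= 1.
    rewrite normrZ ger0_norm; last exact: ltW.
    by rewrite -[leRHS]mulr1; apply: ler_pM => //; exact: ltW.
  by move: H; lra.
have key N : (L <= N)%N -> `|lsum N (fun x => 'D_'e_i g x)| <= C * (2 * L.+1 + 1)%:R ^+ n * h N.
  move=> LN; have := lsum_bound N _ (rL N) (rC N).
  rewrite {1}/r lsumD !lsumZ lsumD (lsum_shift i gL LN) lsumZ mulN1r subrr mulr0 add0r mulN1r normrN.
  by rewrite mulrAC; apply; rewrite mulr_ge0 ?ltW.
apply/cvgrPdist_le => e e0; near=> N.
rewrite sub0r normrN; apply: le_trans (key N _) _; first by near: N; exact: nbhs_infty_ge.
near: N; pose D := C * (2 * L.+1 + 1)%:R ^+ n.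
have : (fun N => D * h N) @ \oo --> (0 : R).
  by rewrite -[X in _ --> X](mulr0 D); apply: cvgM; [exact: cvg_cst|exact: cvg_harmonic].
move=> /cvgrPdist_le/(_ e e0); apply: filterS => N; rewrite sub0r normrN.
by rewrite ger0_norm// mulr_ge0 ?mulr_ge0 ?exprn_ge0// ltW.
Unshelve. all: by end_near. Qed.

(** ** Positivity *)

(** An interval of radius [r] contains consecutive nodes whose number is at least
   a quarter of its radius divided by the mesh. *)
Lemma node_interval (a r : R) : 0 < r -> \forall N \near \oo,
  r / 4 * N.+1%:R <= (Num.truncn (r / 2 * N.+1%:R))%:R /\
  exists i0, (i0 + Num.truncn (r / 2 * N.+1%:R) <= nodes N)%N /\
    forall k, (k < Num.truncn (r / 2 * N.+1%:R))%N -> `|node N (i0 + k) - a| < r.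
Proof.
move=> r0.
have big (b : R) : \forall N \near \oo, b < N.+1%:R.
  near=> N; apply: (@lt_trans _ _ N%:R); last by rewrite ltr_nat.
  by near: N; exact: nbhs_infty_gtr.
near=> N; have Na : `|a| + r < N.+1%:R by near: N; exact: big.
have Nr : 4 / r < N.+1%:R by near: N; exact: big.
have N0 : 0 < N.+1%:R :> R by rewrite ltr0n.
set n1 : R := N.+1%:R in Na Nr N0 *; set m := Num.truncn _.
have rN : 4 < r * n1 by rewrite mulrC -ltr_pdivrMr.
have /truncn_itv/andP[m1 m2] : 0 <= r / 2 * n1 by rewrite mulr_ge0// ?ltW ?divr_gt0.
rewrite -/m -[m.+1%:R]natr1 in m1 m2.
have an : - n1 < a - r /\ a + r < n1.
  by have := ler_norm a; have := ler_norm (- a); rewrite normrN; lra.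
pose y : R := (n1 + a) * n1.
have /truncn_itv/andP[t1 t2] : 0 <= y by rewrite mulr_ge0//; lra.
rewrite -[(Num.truncn y).+1%:R]natr1 in t2; set t := Num.truncn y in t1 t2.
have rn : r * n1 > 0 by rewrite mulr_gt0.
split; first by move: m2 rN; nra.
exists t.+1; split.
  have E1 : (nodes N)%:R = 2 * (n1 * n1) + 1 :> R by rewrite /nodes -natr1 !natrM.
  have E2 : (t.+1 + m)%:R = t%:R + 1 + m%:R :> R by rewrite natrD -natr1.
  rewrite -(ler_nat R) E1 E2; have : (a + r) * n1 < n1 * n1 by rewrite ltr_pM2r//; lra.
  by move: t1; rewrite /y; nra.
move=> k km; have k1 : k%:R + 1 <= m%:R :> R by rewrite natr1 ler_nat.
have -> : node N (t.+1 + k) - a = (t%:R + 1 + k%:R - y) / n1.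
  by rewrite /node -/n1 natrD -natr1 /y; field; rewrite gt_eqF.
rewrite normrM [X in _ * X]ger0_norm ?invr_ge0 ?ltW// ltr_pdivrMr//.
rewrite ger0_norm; last by have : 0 <= k%:R :> R by []; lra.
nra.
Unshelve. all: by end_near. Qed.

(** Around a point where [g] is positive there are of the order of [N^n] nodes where
    [g] is bounded below. *)
Lemma not_null g (x0 : 'rV[R]_n) : (forall x, 0 <= g x) -> 0 < g x0 ->
  {for x0, continuous g} -> ~ null g.
Proof.
move=> g0 gx0 cg ng; pose c := g x0 / 2; have c0 : 0 < c by rewrite divr_gt0.
have /nbhs_ballP[r /= r0 rP] : \forall x \near x0, c <= g x.
  have := cont_dist_lt cg c0; apply: filterS => x; rewrite ltr_distlC => /andP[+ _].
  by rewrite /c; lra.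
have r20 : 0 < r / 2 by rewrite divr_gt0.
suff low : \forall N \near \oo, (r / 8) ^+ n * c <= lsum N g.
  have low0 : 0 < (r / 8) ^+ n * c by rewrite mulr_gt0 ?exprn_gt0 ?divr_gt0.
  have /cvgrPdist_lt/(_ _ low0) ngd := ng.
  have [N [l1]] := filter_ex (filterI low ngd).
  by rewrite sub0r normrN => /(le_lt_trans (ler_norm _)); rewrite ltNge l1.
have FI : \forall N \near \oo, forall j : 'I_n, r / 2 / 4 * N.+1%:R <= (Num.truncn (r / 2 / 2 * N.+1%:R))%:R /\
  exists i0, (i0 + Num.truncn (r / 2 / 2 * N.+1%:R) <= nodes N)%N /\
    forall k, (k < Num.truncn (r / 2 / 2 * N.+1%:R))%N -> `|node N (i0 + k) - x0 0 j| < r / 2.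
  apply: (@filter_forall _ 'I_n (fun j N => r / 2 / 4 * N.+1%:R <= (Num.truncn (r / 2 / 2 * N.+1%:R))%:R /\
  exists i0, (i0 + Num.truncn (r / 2 / 2 * N.+1%:R) <= nodes N)%N /\
    forall k, (k < Num.truncn (r / 2 / 2 * N.+1%:R))%N -> `|node N (i0 + k) - x0 0 j| < r / 2)) => j.
  exact: node_interval.
apply: filterS FI => N H; set m := Num.truncn _ in H.
pose i0 j := projT1 (cid (proj2 (H j))).
have i0P j : (i0 j + m <= nodes N)%N /\ forall k, (k < m)%N -> `|node N (i0 j + k) - x0 0 j| < r / 2.
  exact: (projT2 (cid (proj2 (H j)))).
pose emb (u : {ffun 'I_n -> 'I_m}) : {ffun 'I_n -> 'I_(nodes N)} := [ffun j => inord (i0 j + u j)].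
have embE u j : emb u j = (i0 j + u j)%N :> nat.
  by rewrite ffunE inordK//; have [i0m _] := i0P j; apply: leq_trans i0m; rewrite ltn_add2l.
have emb_inj : injective emb.
  move=> u w /ffunP uw; apply/ffunP => j; apply/val_inj/eqP.
  by rewrite -(eqn_add2l (i0 j)) -!embE uw.
have gemb u : c <= g (latpt (emb u)).
  apply: rP; rewrite -ball_normE /ball_/=.
  apply: (@le_lt_trans _ _ (r / 2)); last by lra.
  apply: mx_norm_le => [|j]; first exact: ltW.
  by rewrite !mxE embE distrC ltW//; have [_] := i0P j; apply.
have N0 : 0 < N.+1%:R :> R by rewrite ltr0n.
rewrite /lsum exprVn ler_pdivlMl ?exprn_gt0//.
apply: (@le_trans _ _ (\sum_(u : {ffun 'I_n -> 'I_m}) g (latpt (emb u)))); last first.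
  rewrite -(big_imset (fun t => g (latpt t)))/=; last by move=> u w _ _; exact: emb_inj.
  rewrite [leRHS](bigID (fun t => t \in imset emb (mem xpredT)))/=.
  by rewrite lerDl sumr_ge0.
apply: le_trans (ler_sum _ (fun u _ => gemb u)).
have -> : \sum_(u : {ffun 'I_n -> 'I_m}) c = m%:R ^+ n * c.
  by rewrite sumr_const card_ffun !card_ord -[LHS]mulr_natl natrX.
rewrite mulrA ler_wpM2r//; first exact: ltW.
rewrite -exprMn.
have [nE|n0] := posnP n; first by rewrite nE !expr0.
have [H0 _] := H (Ordinal n0).
apply: lerXn2r; rewrite ?nnegrE//; first by rewrite mulr_ge0// divr_ge0// ltW.
by move: H0; lra.
Qed.

(** ** Symmetries of the lattice *)

Lemma lsum_perm N g (s : 'S_n) : lsum N (fun x => g (col_perm s x)) = lsum N g.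
Proof.
rewrite /lsum; congr (_ * _).
pose ps (t : {ffun 'I_n -> 'I_(nodes N)}) : {ffun 'I_n -> 'I_(nodes N)} := [ffun j => t (s j)].
have psi : injective ps.
  move=> t u /ffunP tu; apply/ffunP => j; have := tu (s^-1%g j).
  by rewrite !ffunE permKV.
rewrite [RHS](reindex_inj psi); apply: eq_bigr => t _; congr g.
by apply/rowP => j; rewrite !mxE ffunE.
Qed.

Lemma lsum_sign N g (e : 'I_n -> bool) :
  lsum N (fun x => g (\row_j ((-1) ^+ e j * x 0 j))) = lsum N g.
Proof.
rewrite /lsum; congr (_ * _).
pose ps (t : {ffun 'I_n -> 'I_(nodes N)}) : {ffun 'I_n -> 'I_(nodes N)} :=
  [ffun j => if e j then rev_ord (t j) else t j].
have psi : injective ps.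
  move=> t u /ffunP tu; apply/ffunP => j; have := tu j; rewrite !ffunE.
  by case: ifP => // _; exact: rev_ord_inj.
rewrite [RHS](reindex_inj psi); apply: eq_bigr => t _; congr g.
apply/rowP => j; rewrite !mxE ffunE; case: (e j); rewrite ?mul1r//.
rewrite expr1 mulN1r /node /= subSS natrB; last by rewrite -ltnS ltn_ord.
have N0 : N.+1%:R != 0 :> R by rewrite pnatr_eq0.
have -> : (2 * (N.+1 * N.+1))%:R = 2 * N.+1%:R * N.+1%:R :> R by rewrite !natrM mulrA.
by rewrite mulrBl mulfK//; ring.
Qed.

End LatticeSums.

(** * Symmetry of second derivatives *)

Section Schwarz.
Variables (R : realType) (n : nat).
Implicit Types (g : 'rV[R]_n -> R) (x y v e : 'rV[R]_n).

Lemma is_derive_translate g y v e d : is_derive (y + v) e g d ->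
  is_derive y e (fun z => g (z + v)) d.
Proof.
move=> dg; have E : y = y + (0 : R) *: e by rewrite scale0r addr0.
rewrite [X in is_derive X]E; apply/is_derive_lineE.
have -> : (fun r : R => g (y + r *: e + v)) = (fun r : R => g (y + v + r *: e)).
  by apply/funext => r; rewrite addrAC.
by apply/is_derive_lineE; rewrite scale0r addr0.
Qed.

Lemma norm_move x y (h s : R) (i : 'I_n) : `|s| <= `|h| -> `|x - y + s *: 'e_i| <= `|x - y| + `|h|.
Proof.
move=> sh; apply: le_trans (ler_normD _ _) _; rewrite lerD2l normrZ.
rewrite -[leRHS]mulr1; apply: ler_pM => //.
by apply: mx_norm_le => // j; rewrite !mxE eqxx/=; case: eqP; rewrite ?normr1 ?normr0.
Qed.

(** The mean value theorem applied twice, first in the direction [i] to the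
    difference in the direction [j]. *)
Lemma second_difference g x (i j : 'I_n) (r h : R) : Cinf (ball x r) g -> 0 < h -> 2 * h < r ->
  exists2 z, `|z - x| <= 2 * h &
    g (x + h *: 'e_i + h *: 'e_j) - g (x + h *: 'e_i) - (g (x + h *: 'e_j) - g x)
      = h * (h * 'D_'e_j (fun y => 'D_'e_i g y) z).
Proof.
move=> gk h0 hr; have g1k := Cinf_D i gk; have nh : `|h| = h by rewrite gtr0_norm.
have inb y : `|y - x| <= 2 * h -> ball x r y.
  by move=> yx; rewrite -ball_normE /ball_/= distrC (le_lt_trans yx).
have near1 (s : R) (k : 'I_n) : `|s| <= `|h| -> `|x + s *: 'e_k - x| <= h.
  by move=> sh; have := norm_move x x k sh; rewrite subrr normr0 add0r nh add0r addrC addKr.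
have near2 (s u : R) (k l : 'I_n) : `|s| <= `|h| -> `|u| <= `|h| -> `|x + s *: 'e_k + u *: 'e_l - x| <= 2 * h.
  move=> sh uh; rewrite addrAC; apply: le_trans (norm_move _ _ _ uh) _.
  by rewrite nh; have := near1 s k sh; lra.
have d1 y k : ball x r y -> derivable g y 'e_k by exact: Cinf_derivable gk.
have [s sh E] : exists2 s, `|s| <= `|h| &
    (g (x + h *: 'e_i + h *: 'e_j) - g (x + h *: 'e_i)) - (g (x + h *: 'e_j) - g x)
    = h * 'D_'e_i (fun y => g (y + h *: 'e_j) - g y) (x + s *: 'e_i).
  apply: (MVT_line (g := fun y => g (y + h *: 'e_j) - g y)) => s sh.
  have a1 : is_derive (x + s *: 'e_i + h *: 'e_j) 'e_i g ('D_'e_i g (x + s *: 'e_i + h *: 'e_j)).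
    by apply/derivableP/d1/inb/near2.
  have a2 : is_derive (x + s *: 'e_i) 'e_i g ('D_'e_i g (x + s *: 'e_i)).
    by apply/derivableP/d1/inb; apply: le_trans (near1 _ _ sh) _; lra.
  by have [] := is_deriveBx (is_derive_translate a1) a2.
have E2 : 'D_'e_i (fun y => g (y + h *: 'e_j) - g y) (x + s *: 'e_i)
    = 'D_'e_i g (x + s *: 'e_i + h *: 'e_j) - 'D_'e_i g (x + s *: 'e_i).
  have a1 : is_derive (x + s *: 'e_i + h *: 'e_j) 'e_i g ('D_'e_i g (x + s *: 'e_i + h *: 'e_j)).
    by apply/derivableP/d1/inb/near2.
  have a2 : is_derive (x + s *: 'e_i) 'e_i g ('D_'e_i g (x + s *: 'e_i)).
    by apply/derivableP/d1/inb; apply: le_trans (near1 _ _ sh) _; lra.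
  by have [_ ->] := is_deriveBx (is_derive_translate a1) a2.
have [u uh E3] : exists2 u, `|u| <= `|h| &
    'D_'e_i g (x + s *: 'e_i + h *: 'e_j) - 'D_'e_i g (x + s *: 'e_i)
    = h * 'D_'e_j (fun y => 'D_'e_i g y) (x + s *: 'e_i + u *: 'e_j).
  apply: (MVT_line (g := fun y => 'D_'e_i g y)) => u uh.
  exact: Cinf_derivable g1k (inb _ (near2 s u i j sh uh)).
by exists (x + s *: 'e_i + u *: 'e_j); [exact: near2|rewrite E E2 E3].
Qed.

(** The second difference is symmetric in [i] and [j], hence so are the second
    derivatives at suitable points close to [x]. *)
Lemma schwarz (V : set 'rV[R]_n) g x i j : open V -> Cinf V g -> V x ->
  'D_'e_j (fun y => 'D_'e_i g y) x = 'D_'e_i (fun y => 'D_'e_j g y) x.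
Proof.
move=> oV gk Vx.
set A := 'D_'e_j _ x; set B := 'D_'e_i _ x.
apply/eqP; rewrite -subr_eq0 -normr_le0; apply/ler_addgt0Pl => e e0; rewrite addr0.
have e2 : 0 < e / 2 by rewrite divr_gt0.
have cA : {for x, continuous (fun y => 'D_'e_j (fun y => 'D_'e_i g y) y)}.
  by apply: Cinf_cont (Cinf_D j (Cinf_D i gk)) Vx.
have cB : {for x, continuous (fun y => 'D_'e_i (fun y => 'D_'e_j g y) y)}.
  by apply: Cinf_cont (Cinf_D i (Cinf_D j gk)) Vx.
have nb : \forall y \near x, V y /\
    (`|A - 'D_'e_j (fun y => 'D_'e_i g y) y| < e / 2 /\
     `|B - 'D_'e_i (fun y => 'D_'e_j g y) y| < e / 2).
  exact: filterI (open_nbhs_nbhs (conj oV Vx))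
    (filterI (cont_dist_lt cA e2) (cont_dist_lt cB e2)).
have /nbhs_ballP[r /= r0 rP] := nb.
pose h := r / 3; have h0 : 0 < h by rewrite divr_gt0.
have hr : 2 * h < r by rewrite /h; lra.
have gB : Cinf (ball x r) g by apply: Cinf_sub gk => y /rP[].
have inb y : `|y - x| <= 2 * h -> ball x r y.
  by move=> yx; rewrite -ball_normE /ball_/= distrC (le_lt_trans yx).
have [z1 z1x E1] := second_difference i j gB h0 hr.
have [z2 z2x E2] := second_difference j i gB h0 hr.
have E : 'D_'e_j (fun y => 'D_'e_i g y) z1 = 'D_'e_i (fun y => 'D_'e_j g y) z2.
  have swap (p a b c : R) : p - a - (b - c) = p - b - (a - c) by ring.
  apply: (mulfI (lt0r_neq0 h0)); apply: (mulfI (lt0r_neq0 h0)).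
  apply: (etrans (esym E1)); apply: (etrans _ E2).
  by rewrite [x + h *: 'e_j + _]addrAC; exact: swap.
have [_ [d1 _]] := rP _ (inb _ z1x); have [_ [_ d2]] := rP _ (inb _ z2x).
rewrite -(subrKA ('D_'e_j (fun y => 'D_'e_i g y) z1)) {2}E.
apply: le_trans (ler_normD _ _) _; rewrite distrC in d2.
rewrite [leRHS]splitr; apply: lerD; [exact: ltW d1|exact: ltW d2].
Qed.

End Schwarz.

(** * Change of variables *)

Definition o0 : 'I_3 := inord 0.
Definition o1 : 'I_3 := inord 1.
Definition o2 : 'I_3 := inord 2.

Lemma o10 : (o1 == o0) = false. Proof. by rewrite -val_eqE /= !inordK. Qed.
Lemma o20 : (o2 == o0) = false. Proof. by rewrite -val_eqE /= !inordK. Qed.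
Lemma o21 : (o2 == o1) = false. Proof. by rewrite -val_eqE /= !inordK. Qed.

Section Det3.
Variable K : comPzRingType.

Definition det3r (u v w : 'I_3 -> K) : K :=
  u o0 * (v o1 * w o2 - v o2 * w o1)
  - u o1 * (v o0 * w o2 - v o2 * w o0)
  + u o2 * (v o0 * w o1 - v o1 * w o0).

Definition det3 (a : 'I_3 -> 'I_3 -> K) : K := det3r (a o0) (a o1) (a o2).

Lemma sum3 (V : nmodType) (F : 'I_3 -> V) : \sum_i F i = F o0 + F o1 + F o2.
Proof.
rewrite 3!big_ord_recl big_ord0 addr0 addrA; congr (F _ + F _ + F _);
  by apply/val_inj; rewrite /= ?inordK.
Qed.

Lemma ord3P (P : 'I_3 -> Prop) : P o0 -> P o1 -> P o2 -> forall i, P i.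
Proof.
move=> P0 P1 P2 i; have E k : val i = k -> i = inord k by move=> <-; rewrite inord_val.
by have := ltn_ord i; case vi : (val i) => [|[|[|k]]] // _; rewrite (E _ vi).
Qed.

(** The vectors [p] are the rows of the Jacobian matrix, [w] is the velocity, and the
   [q] are second derivatives: those of two spatial variables cancel in pairs,
   by antisymmetry of the determinant. *)
Lemma piola_algebra (f : K) (fd w p0 p1 p2 q0 q1 q2 q01 q02 q12 : 'I_3 -> K) :
  (\sum_k fd k * w k) * det3r p0 p1 p2
    + f * (det3r q0 p1 p2 + det3r p0 q1 p2 + det3r p0 p1 q2)
  = (\sum_k fd k * p0 k) * det3r w p1 p2
    + f * (det3r q0 p1 p2 + det3r w q01 p2 + det3r w p1 q02)
  + ((\sum_k fd k * p1 k) * det3r p0 w p2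
    + f * (det3r q01 w p2 + det3r p0 q1 p2 + det3r p0 w q12))
  + ((\sum_k fd k * p2 k) * det3r p0 p1 w
    + f * (det3r q02 p1 w + det3r p0 q12 w + det3r p0 p1 q2)).
Proof. rewrite !sum3 /det3r; ring. Qed.

Lemma det3E (A : 'M[K]_3) : \det A = det3 (fun i j => A i j).
Proof.
pose a (i j : nat) := A (inord i) (inord j).
have AE i j : A i j = a (val i) (val j) by rewrite /a !inord_val.
rewrite (expand_det_row _ ord0) !big_ord_recl big_ord0 /cofactor.
rewrite !(expand_det_row _ ord0) !big_ord_recl !big_ord0 /cofactor !det_mx11 !mxE.
rewrite /det3 /det3r !AE /o0 /o1 /o2 /= !inordK//=.
have b : (bump 0 0 = 1)%N * (bump 0 1 = 2)%N * (bump 1 0 = 0)%N * (bump 1 1 = 2)%N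
  * (bump 2 0 = 0)%N * (bump 2 1 = 1)%N by [].
rewrite !b !addr0 !add0n; ring.
Qed.

End Det3.

Section Homotopy.
Variables (R : realType).
Implicit Types (f : 'rV[R]_3 -> R).

Lemma is_derive_det3r (V : normedModType R) (u v w : 'I_3 -> V -> R) (du dv dw : 'I_3 -> R) (z e : V) :
  (forall j, is_derive z e (u j) (du j)) -> (forall j, is_derive z e (v j) (dv j)) ->
  (forall j, is_derive z e (w j) (dw j)) ->
  is_derive z e (fun y => det3r (u^~ y) (v^~ y) (w^~ y))
    (det3r du (v^~ z) (w^~ z) + det3r (u^~ z) dv (w^~ z) + det3r (u^~ z) (v^~ z) dw).
Proof.
move=> hu hv hw; rewrite /det3r.
have minor i j := is_deriveBx (is_deriveMx (hv i) (hw j)) (is_deriveMx (hv j) (hw i)).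
apply: (is_derive_eq (is_deriveDx (is_deriveBx (is_deriveMx (hu o0) (minor o1 o2))
    (is_deriveMx (hu o1) (minor o0 o2))) (is_deriveMx (hu o2) (minor o0 o1)))).
move: (u o0 z) (u o1 z) (u o2 z) (v o0 z) (v o1 z) (v o2 z) (w o0 z) (w o1 z) (w o2 z)
  (du o0) (du o1) (du o2) (dv o0) (dv o1) (dv o2) (dw o0) (dw o1) (dw o2) => *; ring.
Qed.

Lemma Cinf_det3r n (V : set 'rV[R]_n) (u v w : 'I_3 -> 'rV[R]_n -> R) : open V ->
  (forall j, Cinf V (u j)) -> (forall j, Cinf V (v j)) -> (forall j, Cinf V (w j)) ->
  Cinf V (fun y => det3r (u^~ y) (v^~ y) (w^~ y)).
Proof.
move=> oV hu hv hw; rewrite /det3r.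
have minor i j := CinfBr oV (CinfMr oV (hv i) (hw j)) (CinfMr oV (hv j) (hw i)).
exact: (CinfDr oV (CinfBr oV (CinfMr oV (hu o0) (minor o1 o2))
  (CinfMr oV (hu o1) (minor o0 o2))) (CinfMr oV (hu o2) (minor o0 o1))).
Qed.

Section family.
Variables (f : 'rV[R]_3 -> R) (H : set 'rV[R]_(1 + 3)) (Psi : 'rV[R]_(1 + 3) -> 'rV[R]_3).
Hypotheses (fk : Cinf setT f) (oH : open H) (Psik : forall j, Cinf H (fun z => Psi z 0 j)).

Let dPsi (a : 'I_(1 + 3)) (j : 'I_3) (z : 'rV[R]_(1 + 3)) : R := 'D_'e_a (fun z => Psi z 0 j) z.
Let d0 := dPsi (lshift 3 0).
Let dx i := dPsi (rshift 1 i).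

(** The pullback of [f dx1 dx2 dx3] by the map at a fixed parameter. *)
Definition pull z : R := f (Psi z) * det3r ((dx o0)^~ z) ((dx o1)^~ z) ((dx o2)^~ z).

(** The [i]th component of the field whose divergence is the derivative of
   [pull] in the parameter: one row of the Jacobian is replaced by the velocity. *)
Definition flux (i : 'I_3) z : R := f (Psi z) *
  (if i == o0 then det3r (d0^~ z) ((dx o1)^~ z) ((dx o2)^~ z)
   else if i == o1 then det3r ((dx o0)^~ z) (d0^~ z) ((dx o2)^~ z)
   else det3r ((dx o0)^~ z) ((dx o1)^~ z) (d0^~ z)).

Lemma flux0 : flux o0 = fun z => f (Psi z) * det3r (d0^~ z) ((dx o1)^~ z) ((dx o2)^~ z).
Proof. by apply/funext => z; rewrite /flux eqxx. Qed.

Lemma flux1 : flux o1 = fun z => f (Psi z) * det3r ((dx o0)^~ z) (d0^~ z) ((dx o2)^~ z).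
Proof. by apply/funext => z; rewrite /flux o10 eqxx. Qed.

Lemma flux2 : flux o2 = fun z => f (Psi z) * det3r ((dx o0)^~ z) ((dx o1)^~ z) (d0^~ z).
Proof. by apply/funext => z; rewrite /flux o20 o21. Qed.

Let dPsik a j : Cinf H (dPsi a j). Proof. exact: Cinf_D. Qed.

Let fPsik : Cinf H (fun z => f (Psi z)).
Proof. exact: (Cinf_compose oH openT Psik _ fk). Qed.

Lemma flux_Cinf i : Cinf H (flux i).
Proof.
rewrite /flux; elim/ord3P: i => /=; apply: CinfMr => //.
- by rewrite eqxx; apply: Cinf_det3r => // j; exact: dPsik.
- by rewrite o10 eqxx; apply: Cinf_det3r => // j; exact: dPsik.
- by rewrite o20 o21; apply: Cinf_det3r => // j; exact: dPsik.
Qed.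

Lemma pull_Cinf : Cinf H pull.
Proof. by apply: CinfMr => //; apply: Cinf_det3r => // j; exact: dPsik. Qed.

(** Piola's identity: the rows of the cofactor matrix of a Jacobian matrix are
    divergence free, because second derivatives commute. *)
Lemma piola z : H z ->
  'D_'e_(lshift 3 0) pull z = \sum_i 'D_'e_(rshift 1 i) (flux i) z.
Proof.
move=> Hz; pose q a b (j : 'I_3) : R := 'D_'e_a (dPsi b j) z.
have qs a b j : q a b j = q b a j by exact: (schwarz b a oH (Psik j) Hz).
have dd a b j : is_derive z 'e_a (dPsi b j) (q a b j).
  by apply: DeriveDef; [exact: Cinf_derivable (dPsik b j) Hz|].
pose fd k : R := 'D_'e_k f (Psi z).
have df a : is_derive z 'e_a (fun z => f (Psi z)) (\sum_k fd k * dPsi a k z).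
  exact: (chain_rule a oH openT Psik _ fk Hz).
have qS a b : q a b = q b a by apply/funext => j; exact: qs.
have e := is_deriveMx (df (lshift 3 0)) (is_derive_det3r (dd (lshift 3 0) (rshift 1 o0))
  (dd (lshift 3 0) (rshift 1 o1)) (dd (lshift 3 0) (rshift 1 o2))).
have e0 := is_deriveMx (df (rshift 1 o0)) (is_derive_det3r (dd (rshift 1 o0) (lshift 3 0))
  (dd (rshift 1 o0) (rshift 1 o1)) (dd (rshift 1 o0) (rshift 1 o2))).
have e1 := is_deriveMx (df (rshift 1 o1)) (is_derive_det3r (dd (rshift 1 o1) (rshift 1 o0))
  (dd (rshift 1 o1) (lshift 3 0)) (dd (rshift 1 o1) (rshift 1 o2))).
have e2 := is_deriveMx (df (rshift 1 o2)) (is_derive_det3r (dd (rshift 1 o2) (rshift 1 o0))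
  (dd (rshift 1 o2) (rshift 1 o1)) (dd (rshift 1 o2) (lshift 3 0))).
have val (a : 'I_(1 + 3)) (g : 'rV[R]_(1 + 3) -> R) (d : R) : is_derive z 'e_a g d -> 'D_'e_a g z = d by case.
have ve := val _ _ _ e; rewrite -/pull in ve.
have v0 := val _ _ _ e0; have v1 := val _ _ _ e1; have v2 := val _ _ _ e2.
rewrite -flux0 in v0; rewrite -flux1 in v1; rewrite -flux2 in v2.
rewrite sum3 ve v0 v1 v2.
rewrite !(qS (rshift 1 _) (lshift 3 0)) (qS (rshift 1 o1) (rshift 1 o0)).
rewrite (qS (rshift 1 o2) (rshift 1 o0)) (qS (rshift 1 o2) (rshift 1 o1)).
exact: piola_algebra.
Qed.

Section ends.
Variables (B : set 'rV[R]_3).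
Hypotheses (oB : open B) (BH : forall s x, s \in `[0, 1] -> B x -> H (scons s x)).

Lemma pull_increment x : B x ->
  pull (scons 1 x) - pull (scons 0 x) = \sum_i 'D_'e_i (pint (flux i)) x.
Proof.
move=> Bx.
have dF (s : R) : s \in `[0, 1] -> is_derive s 1 (fun s : R => pull (scons s x))
    (\sum_i 'D_'e_(rshift 1 i) (flux i) (scons s x)).
  move=> sI; rewrite -(piola (BH sI Bx)).
  have -> : (fun s : R => pull (scons s x)) = (fun s : R => pull (scons 0 x + s *: 'e_(lshift 3 0))).
    by apply/funext => r; rewrite -scons_moves add0r.
  have -> : scons s x = scons 0 x + s *: 'e_(lshift 3 0) by rewrite -scons_moves add0r.
  apply: is_derive_line; rewrite -scons_moves add0r.
  exact: Cinf_derivable pull_Cinf (BH sI Bx).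
have ci i : cont01 (fun s => 'D_'e_(rshift 1 i) (flux i) (scons s x)).
  exact: (slice_cont01 BH (Cinf_D (rshift 1 i) (flux_Cinf i)) Bx).
rewrite -(int01_FTC dF); last by apply: cont01_sum => i; exact: ci.
rewrite int01_sum//; apply: eq_bigr => i _.
by have [_ ->] := pint_derive oB BH i (flux_Cinf i) Bx.
Qed.

End ends.
End family.

(** ** Extension by zero *)

Section ExtendByZero.
Variable n : nat.
Implicit Types (B K : set 'rV[R]_n) (g : 'rV[R]_n -> R).

Definition ext0 B g : 'rV[R]_n -> R := fun x => if `[< B x >] then g x else 0.

Lemma ext0_in B g x : B x -> ext0 B g x = g x.
Proof. by move=> Bx; rewrite /ext0 asboolT. Qed.

Lemma ext0_near B K g x : open B -> closed K -> (forall y, B y -> ~ K y -> g y = 0) ->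
  ~ K x -> \forall y \near x, ext0 B g y = 0.
Proof.
move=> oB cK g0 Kx; apply: filterS (open_nbhs_nbhs (conj (closed_openC cK) Kx)) => y Ky.
by rewrite /ext0; case: ifPn => // /asboolP By; exact: g0.
Qed.

Lemma ext0_Cinf B K g : open B -> closed K -> K `<=` B -> (forall y, B y -> ~ K y -> g y = 0) ->
  Cinf B g -> Cinf setT (ext0 B g).
Proof.
move=> oB cK KB g0 gk; apply: Cinf_pointwise => x _.
have [Kx|Kx] := pselect (K x).
  apply: (@Cinf_near _ _ _ g) => [y ->|].
    apply: filterS (open_nbhs_nbhs (conj oB (KB _ Kx))) => z Bz.
    by rewrite ext0_in.
  by apply: Cinf_sub gk => y ->; exact: KB.
apply: (@Cinf_near _ _ _ (fun=> 0)) => [y ->|]; last exact: Cinf_cst.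
by apply: filterS (ext0_near oB cK g0 Kx) => z ->.
Qed.

Lemma ext0_D B K g x i : open B -> closed K -> K `<=` B -> (forall y, B y -> ~ K y -> g y = 0) ->
  'D_'e_i (ext0 B g) x = ext0 B (fun y => 'D_'e_i g y) x.
Proof.
move=> oB cK KB g0; rewrite {2}/ext0; case: ifPn => [/asboolP Bx|/asboolPn Bx].
  apply: near_eq_derive; apply: filterS (open_nbhs_nbhs (conj oB Bx)) => y By.
  by rewrite ext0_in.
rewrite -[RHS](derive_cst (0 : R) x 'e_i); apply: near_eq_derive.
by apply: ext0_near oB cK g0 _ => /KB.
Qed.

End ExtendByZero.

(** Integrating [piola] in the parameter shows that the two pullbacks differ by a
    divergence; [K] bounds the supports along the homotopy. *)
Lemma null_homotopy f (H : set 'rV[R]_(1 + 3)) (Psi : 'rV[R]_(1 + 3) -> 'rV[R]_3)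
    (B K : set 'rV[R]_3) (L : nat) : Cinf setT f -> open H ->
  (forall j, Cinf H (fun z => Psi z 0 j)) -> open B ->
  (forall s x, s \in `[0, 1] -> B x -> H (scons s x)) ->
  closed K -> K `<=` B -> (forall x, K x -> `|x| <= L%:R) ->
  (forall s x, s \in `[0, 1] -> B x -> ~ K x -> f (Psi (scons s x)) = 0) ->
  null (ext0 B (fun x => pull f Psi (scons 1 x) - pull f Psi (scons 0 x))).
Proof.
move=> fk oH Psik oB BH cK KB KL f0.
pose G i := pint (flux f Psi i).
have Gk i : Cinf B (G i) by apply: (pint_Cinf oB BH); exact: flux_Cinf.
have G0 i x : B x -> ~ K x -> G i x = 0.
  move=> Bx Kx; rewrite /G /pint -[RHS](int01_cst 0); apply: eq_int01 => s sI.
  by rewrite /flux f0// mul0r.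
apply: (@null_eq _ _ (fun x => \sum_i 'D_'e_i (ext0 B (G i)) x)).
  move=> x; under eq_bigr => i _ do rewrite (ext0_D x i oB cK KB (G0 i)).
  rewrite /ext0; case: ifPn => [/asboolP Bx|_]; last by rewrite big1.
  by rewrite (pull_increment fk oH Psik oB BH).
apply: null_sum => i; apply: (@null_partial _ _ L).
  move=> x Lx; rewrite /ext0; case: ifPn => // /asboolP Bx; apply: G0 => // Kx.
  by have := KL _ Kx; rewrite leNgt Lx.
exact: ext0_Cinf oB cK KB (G0 i) (Gk i).
Qed.

End Homotopy.

(** ** Affine families, and invariance under linear maps *)

Section AffineHomotopy.
Variable R : realType.
Implicit Types (f : 'rV[R]_3 -> R) (psi : 'rV[R]_3 -> 'rV[R]_3) (x y : 'rV[R]_3).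

Definition jac psi x : R := det3 (fun i j => 'D_'e_i (fun y => psi y 0 j) x).

Let tl (z : 'rV[R]_(1 + 3)) : 'rV[R]_3 := \row_j z 0 (rshift 1 j).

Let tl_scons s x : tl (scons s x) = x.
Proof. by apply/rowP => j; rewrite mxE scons_r. Qed.

Let tl_cont : continuous tl.
Proof.
move=> z; apply: row_of_coord_cont => j.
have -> : (fun y : 'rV[R]_(1 + 3) => tl y 0 j) = (fun y : 'rV[R]_(1 + 3) => y 0 (rshift 1 j)).
  by apply/funext => y; rewrite mxE.
exact: coord_continuous.
Qed.

Lemma derive_slice (g : 'rV[R]_(1 + 3) -> R) s x (i : 'I_3) :
  'D_'e_(rshift 1 i) g (scons s x) = 'D_'e_i (fun y => g (scons s y)) x.
Proof.
have E : (fun h : R => h^-1 *: ((g \o shift (scons s x)) (h *: 'e_(rshift 1 i)) - g (scons s x)))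
    = (fun h : R => h^-1 *: (((fun y => g (scons s y)) \o shift x) (h *: 'e_i) - g (scons s x))).
  by apply/funext => h /=; rewrite ![_ *: _ + _]addrC scons_move.
by rewrite /derive E.
Qed.

Let fam psi0 psi1 (z : 'rV[R]_(1 + 3)) : 'rV[R]_3 :=
  psi0 (tl z) + z 0 (lshift 3 0) *: (psi1 (tl z) - psi0 (tl z)).

(** The straight homotopy, whose parameter is the first coordinate. *)
Lemma null_affine_homotopy f psi0 psi1 (B K : set 'rV[R]_3) (L : nat) : Cinf setT f ->
  open B -> (forall j, Cinf B (fun y => psi0 y 0 j)) -> (forall j, Cinf B (fun y => psi1 y 0 j)) ->
  closed K -> K `<=` B -> (forall x, K x -> `|x| <= L%:R) ->
  (forall (s : R) x, s \in `[0, 1] -> B x -> ~ K x -> f (psi0 x + s *: (psi1 x - psi0 x)) = 0) ->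
  null (ext0 B (fun x => f (psi1 x) * jac psi1 x - f (psi0 x) * jac psi0 x)).
Proof.
move=> fk oB k0 k1 cK KB KL f0; pose H := tl @^-1` B.
have oH : open H by apply: open_comp => // z _; exact: tl_cont.
have tlk j : Cinf H (fun z => tl z 0 j).
  apply: (@Cinf_open_eq _ _ _ (fun z : 'rV[R]_(1 + 3) => z 0 (rshift 1 j))) => //.
    by move=> z _; rewrite mxE.
  exact: Cinf_coord.
have pk psi j : (forall j, Cinf B (fun y => psi y 0 j)) -> Cinf H (fun z => psi (tl z) 0 j).
  by move=> kj; apply: (@Cinf_compose _ _ _ H B tl (fun y => psi y 0 j)).
have famk j : Cinf H (fun z => fam psi0 psi1 z 0 j).
  apply: (@Cinf_open_eq _ _ _ (fun z => psi0 (tl z) 0 j + z 0 (lshift 3 0) * (psi1 (tl z) 0 j - psi0 (tl z) 0 j))) => //.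
    by move=> z _; rewrite !mxE.
  apply: CinfDr => //; first exact: pk.
  apply: CinfMr => //; first exact: Cinf_coord.
  by apply: CinfBr => //; exact: pk.
have BH s x : s \in `[0, 1] -> B x -> H (scons s x) by move=> _ Bx; rewrite /H/= tl_scons.
have famE s x : fam psi0 psi1 (scons s x) = psi0 x + s *: (psi1 x - psi0 x).
  by rewrite /fam tl_scons scons_l.
have := null_homotopy fk oH famk oB BH cK KB KL.
move=> /(_ (fun s x sI Bx Kx => etrans (congr1 f (famE s x)) (f0 s x sI Bx Kx))).
apply: null_eq => x; congr ext0; apply/funext => {}x.
have pE s psi : (forall y, psi0 y + s *: (psi1 y - psi0 y) = psi y) ->
    pull f (fam psi0 psi1) (scons s x) = f (psi x) * jac psi x.
  move=> E; rewrite /pull famE E; congr (_ * _); rewrite /jac /det3.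
  have dE i : (fun j => 'D_'e_(rshift 1 i) (fun z => fam psi0 psi1 z 0 j) (scons s x))
      = (fun j => 'D_'e_i (fun y => psi y 0 j) x).
    apply/funext => j; rewrite (derive_slice (fun z => fam psi0 psi1 z 0 j)).
    have -> // : (fun y => fam psi0 psi1 (scons s y) 0 j) = (fun y => psi y 0 j).
    by apply/funext => y; rewrite famE E.
  exact: (f_equal3 _ (dE o0) (dE o1) (dE o2)).
rewrite (pE 1 psi1) ?(pE 0 psi0)// => y; first by rewrite scale0r addr0.
by rewrite scale1r addrC subrK.
Qed.

Definition mxsum (A : 'M[R]_3) : R := \sum_i \sum_j `|A i j|.

Lemma norm_mulmx_le (A : 'M[R]_3) x : `|x *m A| <= mxsum A * `|x|.
Proof.
have s0 : 0 <= mxsum A by apply: sumr_ge0 => i _; exact: sumr_ge0.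
apply: mx_norm_le => [|j]; first exact: mulr_ge0.
rewrite mxE; apply: le_trans (ler_norm_sum _ _ _) _.
rewrite /mxsum mulr_suml; apply: ler_sum => i _; rewrite normrM mulrC.
apply: ler_pM => //; last exact: norm_coord_le.
by rewrite (bigD1 j)//= lerDl sumr_ge0.
Qed.

Lemma norm_mulmx_ge (A : 'M[R]_3) : \det A != 0 -> exists2 c, 0 < c & forall x, `|x| <= c * `|x *m A|.
Proof.
move=> dA; have uA : A \in unitmx by rewrite unitmxE unitfE.
exists (mxsum (invmx A) + 1).
  by apply: ltr_pwDr => //; apply: sumr_ge0 => i _; exact: sumr_ge0.
move=> x; have := norm_mulmx_le (invmx A) (x *m A); rewrite mulmxK// => /le_trans; apply.
by rewrite ler_wpM2r// lerDl.
Qed.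

(** A uniform version of the previous bound along a segment of invertible
   matrices, by compactness of the segment. *)
Lemma norm_path_ge (A0 A1 : 'M[R]_3) :
  (forall s : R, s \in `[0, 1] -> \det (A0 + s *: (A1 - A0)) != 0) ->
  exists2 c, 0 < c & forall (s : R) x, s \in `[0, 1] -> `|x| <= c * `|x *m (A0 + s *: (A1 - A0))|.
Proof.
move=> dA; pose A (s : R) := A0 + s *: (A1 - A0).
have /compact_near_coveringP nc : compact `[(0 : R), 1] by exact: segment_compact.
have := nc _ (+oo)%R (fun c s => forall x, `|x| <= c * `|x *m A s|) _.
case=> [s sI|c [_ cP]].
  have [c c0 cx] := norm_mulmx_ge (dA s sI).
  pose C := mxsum (A1 - A0) + 1.
  have C0 : 0 < C by apply: ltr_pwDr => //; apply: sumr_ge0 => i _; exact: sumr_ge0.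
  pose d := (2 * c * C)^-1; have d0 : 0 < d by rewrite invr_gt0 !mulr_gt0.
  exists ([set t : R | `|s - t| < d], [set k : R | 2 * c <= k]) => /=.
    split; first by have := nbhsx_ballx s d d0; rewrite -ball_normE.
    by exists (2 * c); split; [exact: num_real|move=> k; exact: ltW].
  move=> [t k]/= [st ck] x.
  have E : x *m A s = x *m A t + (s - t) *: (x *m (A1 - A0)).
    by rewrite /A !(mulmxDr x A0) -!scalemxAr -addrA -scalerDl [t + _]addrC subrK.
  have b1 : `|x *m A s| <= `|x *m A t| + d * (C * `|x|).
    rewrite E; apply: le_trans (ler_normD _ _) _; rewrite lerD2l normrZ.
    apply: ler_pM => //; first exact: ltW.
    apply: le_trans (norm_mulmx_le _ _) _; apply: ler_wpM2r => //.
    by rewrite lerDl.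
  have b2 := cx x.
  have b3 : c * (d * (C * `|x|)) = `|x| / 2.
    by rewrite /d; field; rewrite !gt_eqF.
  have b4 : c * `|x *m A s| <= c * `|x *m A t| + `|x| / 2.
    by rewrite -b3 -mulrDr ler_pM2l.
  have b5 : 2 * c * `|x *m A t| <= k * `|x *m A t| by apply: ler_wpM2r.
  by move: b2 b4 b5; rewrite -/(A s) => *; lra.
exists (Num.max 1 (c + 1)); first by rewrite lt_max ltr01.
move=> s x sI; apply: (@le_trans _ _ ((c + 1) * `|x *m A s|)).
  by apply: cP => //; rewrite ltrDl.
by apply: ler_wpM2r => //; rewrite le_max lexx orbT.
Qed.

Lemma Cinf_affine (A : 'M[R]_3) (b : 'rV[R]_3) j : Cinf setT (fun y : 'rV[R]_3 => (y *m A + b) 0 j).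
Proof.
apply: (@Cinf_open_eq _ _ _ (fun y : 'rV[R]_3 => \sum_k y 0 k * A k j + b 0 j)); first exact: openT.
  by move=> y _; rewrite !mxE.
apply: CinfDr; [exact: openT| |exact: Cinf_cst].
apply: Cinf_sum; first exact: openT.
by move=> k _; apply: CinfMr; [exact: openT|exact: Cinf_coord|exact: Cinf_cst].
Qed.

Lemma jac_affine (A : 'M[R]_3) (b x : 'rV[R]_3) : jac (fun y => y *m A + b) x = \det A.
Proof.
rewrite det3E /jac; congr det3; apply/funext => i; apply/funext => j.
have -> : (fun y : 'rV[R]_3 => (y *m A + b) 0 j) = (fun y => \sum_k y 0 k * A k j + b 0 j).
  by apply/funext => y; rewrite !mxE.
have d1 k : is_derive x 'e_i (fun y : 'rV[R]_3 => y 0 k * A k j) ((i == k)%:R * A k j).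
  have := is_deriveMx (is_derive_coord k i x) (is_derive_cst (A k j) x 'e_i).
  by rewrite mulr0 addr0.
have d2 : is_derive x 'e_i (fun y : 'rV[R]_3 => \sum_k y 0 k * A k j) (\sum_k (i == k)%:R * A k j).
  rewrite (_ : (fun y : 'rV[R]_3 => _) = \sum_k (fun y : 'rV[R]_3 => y 0 k * A k j)).
    exact: is_derive_sum.
  by apply/funext => y; rewrite fct_sumE.
have [_ ->] := is_deriveDx d2 (is_derive_cst (b 0 j) x 'e_i).
rewrite addr0 (bigD1 i)//= eqxx mul1r big1 ?addr0// => k ki.
by rewrite eq_sym (negPf ki) mul0r.
Qed.

Lemma null_path f (A0 A1 : 'M[R]_3) (b0 b1 : 'rV[R]_3) (L : nat) : Cinf setT f -> supp_in L f ->
  (forall s : R, s \in `[0, 1] -> \det (A0 + s *: (A1 - A0)) != 0) ->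
  null (fun x => f (x *m A1 + b1) * \det A1 - f (x *m A0 + b0) * \det A0).
Proof.
move=> fk fL dA; have [c c0 cP] := norm_path_ge dA.
pose b s := b0 + s *: (b1 - b0).
pose L1 := Num.truncn (c * (L%:R + (`|b0| + `|b1 - b0|))).
have /truncn_itv/andP[_ L1P] : 0 <= c * (L%:R + (`|b0| + `|b1 - b0|)).
  by rewrite mulr_ge0 ?addr_ge0// ltW.
pose K := [set x : 'rV[R]_3 | `|x| <= L1.+1%:R].
have cK : closed K.
  apply: (@preimage_closed _ _ (fun y : 'rV[R]_3 => `|y|) [set r | r <= L1.+1%:R]).
    by move=> y _; exact: norm_continuous.
  exact: closed_le.
have := @null_affine_homotopy f (fun y => y *m A0 + b0) (fun y => y *m A1 + b1) setT K L1.+1 fk openT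
  (Cinf_affine A0 b0) (Cinf_affine A1 b1) cK (fun _ _ => I) (fun x Kx => Kx).
have f0 (s : R) x : s \in `[0, 1] -> setT x -> ~ K x ->
    f (x *m A0 + b0 + s *: (x *m A1 + b1 - (x *m A0 + b0))) = 0.
  move=> sI _ Kx; apply: fL.
  have -> : x *m A0 + b0 + s *: (x *m A1 + b1 - (x *m A0 + b0)) = x *m (A0 + s *: (A1 - A0)) + b s.
    rewrite mulmxDr -scalemxAr mulmxBr /b addrACA; congr (_ + _ + _).
    by rewrite -scalerDr; congr (_ *: _); rewrite opprD addrACA.
  have nb : `|b s| <= `|b0| + `|b1 - b0|.
    apply: le_trans (ler_normD _ _) _; rewrite lerD2l normrZ.
    move: sI; rewrite in_itv/= => /andP[s0 s1]; rewrite ger0_norm//.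
    by rewrite ler_piMl.
  have xL : L1.+1%:R < `|x| by rewrite ltNge; apply/negP.
  have := cP s x sI; have := ler_normB (x *m (A0 + s *: (A1 - A0)) + b s) (b s).
  rewrite addrK => h1 h2.
  have h3 : c * `|x *m (A0 + s *: (A1 - A0))| <= c * (`|x *m (A0 + s *: (A1 - A0)) + b s| + (`|b0| + `|b1 - b0|)).
    by rewrite ler_pM2l//; apply: le_trans h1 _; rewrite lerD2l.
  have h4 := lt_trans L1P (lt_le_trans xL (le_trans h2 h3)).
  by move: h4; rewrite ltr_pM2l// ltrD2r.
move=> /(_ f0); apply: null_eq => x.
by rewrite ext0_in// !jac_affine.
Qed.

(** ** Linear invariance *)

Definition linv (A : 'M[R]_3) := forall f L, Cinf setT f -> supp_in L f ->
  null (fun x => f (x *m A) * `|\det A| - f x).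

Lemma Cinf_mulmx f (A : 'M[R]_3) : Cinf setT f -> Cinf setT (fun x => f (x *m A)).
Proof.
move=> fk; apply: (@Cinf_compose _ _ _ setT setT (fun x => x *m A) f) => //; try exact: openT.
move=> j; have := Cinf_affine A 0 j; congr Cinf.
by apply/funext => y; rewrite addr0.
Qed.

Lemma supp_mulmx f L (A : 'M[R]_3) : \det A != 0 -> supp_in L f ->
  exists L', supp_in L' (fun x => f (x *m A)).
Proof.
move=> dA fL; have [c c0 cP] := norm_mulmx_ge dA.
have /truncn_itv/andP[_ L1P] : 0 <= c * L%:R by rewrite mulr_ge0// ltW.
exists (Num.truncn (c * L%:R)).+1 => x xL; apply: fL.
have := lt_le_trans (lt_trans L1P xL) (cP x).
by rewrite ltr_pM2l.
Qed.

Lemma linvM (A B : 'M[R]_3) : \det B != 0 -> linv A -> linv B -> linv (A *m B).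
Proof.
move=> dB iA iB f L fk fL; have [L' fBL] := supp_mulmx dB fL.
have nA := iA _ L' (Cinf_mulmx B fk) fBL; have nB := iB _ _ fk fL.
apply: null_eq (nullD (nullZ `|\det B| nA) nB) => x.
rewrite mulmxA det_mulmx normrM; ring.
Qed.

(** A path of invertible matrices is a homotopy through linear maps, and it does not
    change the sign of the determinant. *)
Lemma linv_path (A0 A1 : 'M[R]_3) : 0 < \det A0 * \det A1 ->
  (forall s : R, s \in `[0, 1] -> \det (A0 + s *: (A1 - A0)) != 0) ->
  linv A0 -> linv A1.
Proof.
move=> d01 dA i0 f L fk fL.
have := null_path 0 0 fk fL dA => nP.
have n0 := i0 _ _ fk fL.
have [a0|a0|a0] := ltgtP (\det A0) 0; last by rewrite a0 mul0r ltxx in d01.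
  have a1 : \det A1 < 0 by move: d01; rewrite nmulr_rgt0.
  apply: null_eq (nullD (nullZ (-1) nP) n0) => x.
  rewrite !addr0 (ltr0_norm a0) (ltr0_norm a1); ring.
have a1 : 0 < \det A1 by move: d01; rewrite pmulr_rgt0.
apply: null_eq (nullD nP n0) => x.
rewrite !addr0 (gtr0_norm a0) (gtr0_norm a1); ring.
Qed.

Lemma null_lsum0 (g : 'rV[R]_3 -> R) : (forall N, lsum N g = 0) -> null g.
Proof.
move=> g0; rewrite /null (_ : (fun N => _) = fun=> 0); first exact: cvg_cst.
by apply/funext.
Qed.

(** This is meant for signed permutations, which permute the lattice points. *)
Lemma linv_lattice (A : 'M[R]_3) : `|\det A| = 1 ->
  (forall N f, lsum N (fun x => f (x *m A)) = lsum N f) -> linv A.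
Proof.
move=> dA H f L _ _; apply: null_lsum0 => N.
have := lsumD N (fun x => f (x *m A)) (fun x => (-1) * f x).
rewrite lsumZ H mulN1r subrr => <-; congr lsum; apply/funext => x.
by rewrite dA mulr1 mulN1r.
Qed.

Lemma linv_sign (e : 'I_3 -> bool) : linv (diag_mx (\row_j ((-1) ^+ e j))).
Proof.
apply: linv_lattice => [|N f].
  rewrite det_diag normr_prod big1// => i _.
  by rewrite mxE normrX normrN1 expr1n.
rewrite -(lsum_sign N f e); congr lsum; apply/funext => x; congr f.
by apply/rowP => j; rewrite mul_mx_diag !mxE mulrC.
Qed.

Lemma linv_perm (s : {perm 'I_3}) : linv (perm_mx s).
Proof.
apply: linv_lattice => [|N f]; first by rewrite det_perm normrX normrN1 expr1n.
rewrite -(lsum_perm N f s^-1%g); congr lsum; apply/funext => x; congr f.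
by rewrite col_permE invgK.
Qed.

Lemma linv_diag (d : 'rV[R]_3) : (forall j, d 0 j != 0) -> linv (diag_mx d).
Proof.
move=> d0; pose e j := d 0 j < 0.
have E j : 0 < (-1) ^+ e j * d 0 j.
  rewrite /e; have [dj|dj|dj] := ltgtP (d 0 j) 0.
  - by rewrite expr1 mulN1r oppr_gt0.
  - by rewrite expr0 mul1r.
  - by have := d0 j; rewrite dj eqxx.
apply: (linv_path _ _ (linv_sign e)).
  rewrite !det_diag -big_split/=; apply: prodr_gt0 => j _.
  by rewrite mxE.
move=> s; rewrite in_itv/= => /andP[s0 s1].
have -> : diag_mx (\row_j (-1) ^+ e j) + s *: (diag_mx d - diag_mx (\row_j (-1) ^+ e j))
    = diag_mx (\row_j ((-1) ^+ e j + s * (d 0 j - (-1) ^+ e j))).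
  by apply/matrixP => i j; rewrite !mxE; case: eqP => _; rewrite ?mulr1n ?mulr0n//; ring.
rewrite det_diag; apply/prodf_neq0 => j _; rewrite mxE.
have := E j; rewrite /e; case: (d 0 j < 0); rewrite ?expr1 ?expr0 ?mulN1r ?mul1r ?oppr_gt0 => dj.
  by rewrite lt_eqF//; nra.
by rewrite gt_eqF//; nra.
Qed.

Lemma linv_trig (A : 'M[R]_3) : (forall i j : 'I_3, (i < j)%N -> A i j = 0) -> (forall i, A i i != 0) -> linv A.
Proof.
move=> tA dA; pose d := \row_i A i i.
have dE (s : R) : \det (diag_mx d + s *: (A - diag_mx d)) = \prod_i A i i.
  rewrite det_trig.
    apply: eq_bigr => i _; rewrite !mxE eqxx mulr1n subrr mulr0 addr0//.
  apply/is_trig_mxP => i j ij; rewrite !mxE (tA _ _ ij).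
  have -> : (i == j) = false by apply/negbTE; rewrite -val_eqE /= ltn_eqF.
  by rewrite mulr0n subr0 mulr0 addr0.
apply: (linv_path _ _ (linv_diag (d := d) _)).
- have -> : \det A = \prod_i A i i.
    by have := dE 1; rewrite scale1r addrC subrK.
  rewrite det_diag (eq_bigr (fun i => A i i)); last by move=> i _; rewrite mxE.
  by rewrite -expr2 exprn_even_gt0//; apply/prodf_neq0.
- by move=> s _; rewrite dE; apply/prodf_neq0.
- by move=> j; rewrite mxE.
Qed.

Lemma linv_trig_up (A : 'M[R]_3) : (forall i j : 'I_3, (j < i)%N -> A i j = 0) -> (forall i, A i i != 0) -> linv A.
Proof.
move=> tA dA; pose d := \row_i A i i.
have dE (s : R) : \det (diag_mx d + s *: (A - diag_mx d)) = \prod_i A i i.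
  rewrite -det_tr det_trig.
    apply: eq_bigr => i _; rewrite !mxE eqxx mulr1n subrr mulr0 addr0//.
  apply/is_trig_mxP => i j ij; rewrite !mxE (tA _ _ ij).
  have -> : (j == i) = false by apply/negbTE; rewrite -val_eqE /= gtn_eqF.
  by rewrite mulr0n subr0 mulr0 addr0.
apply: (linv_path _ _ (linv_diag (d := d) _)).
- have -> : \det A = \prod_i A i i.
    by have := dE 1; rewrite scale1r addrC subrK.
  rewrite det_diag (eq_bigr (fun i => A i i)); last by move=> i _; rewrite mxE.
  by rewrite -expr2 exprn_even_gt0//; apply/prodf_neq0.
- by move=> s _; rewrite dE; apply/prodf_neq0.
- by move=> j; rewrite mxE.
Qed.

(** An invertible matrix is the product of a permutation and of two triangular
    matrices.  A segment of invertible matrices joins a triangular matrix to its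
    diagonal part, and another one joins the latter to a diagonal of signs. *)
Lemma linv_all (A : 'M[R]_3) : \det A != 0 -> linv A.
Proof.
move=> dA; set lup := cormen_lup A.
have Uu : forall i j : 'I_3, (j < i)%N -> lup.2 i j = 0 by exact: cormen_lup_upper.
have Ll : forall i j : 'I_3, (i <= j)%N -> lup.1.2 i j = (i == j)%:R by exact: cormen_lup_lower.
have Pp : is_perm_mx lup.1.1 by exact: cormen_lup_perm.
have E : (let '(P, L, U) := lup in P * A = L * U) := cormen_lup_correct A.
move: lup Uu Ll Pp E => [[P L] U] Uu Ll /is_perm_mxP[s sE] E.
have {}Uu (i j : 'I_3) : (j < i)%N -> U i j = 0 by exact: Uu.
have {}Ll (i j : 'I_3) : (i <= j)%N -> L i j = (i == j)%:R by exact: Ll.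
have {P sE} E : perm_mx s *m A = L *m U by rewrite -sE.
have Lt (i j : 'I_3) : (i < j)%N -> L i j = 0.
  by move=> ij; rewrite Ll ?(ltnW ij)//; have -> : (i == j) = false by apply/negbTE; rewrite -val_eqE /= ltn_eqF.
have L1 i : L i i = 1 by rewrite Ll// eqxx.
have dL : \det L = 1.
  rewrite det_trig; first by rewrite big1.
  by apply/is_trig_mxP => i j; exact: Lt.
have AE : A = perm_mx s^-1%g *m (L *m U).
  by rewrite -[L *m U]E mulmxA -perm_mxM mulVg perm_mx1 mul1mx.
have dU : \det U != 0.
  by move: dA; rewrite AE !det_mulmx dL mul1r mulf_eq0 negb_or => /andP[].
have U0 i : U i i != 0.
  move: dU; rewrite -det_tr det_trig; last first.
    by apply/is_trig_mxP => k j kj; rewrite mxE Uu.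
  by move=> /prodf_neq0/(_ i isT); rewrite mxE.
rewrite AE; apply: linvM; first by rewrite det_mulmx dL mul1r.
  exact: linv_perm.
apply: linvM => //.
  by apply: linv_trig => // i; rewrite L1 oner_eq0.
exact: linv_trig_up.
Qed.

(** ** Local change of variables *)

Lemma null_translate f L (b : 'rV[R]_3) : Cinf setT f -> supp_in L f ->
  null (fun x => f (x + b) - f x).
Proof.
move=> fk fL; have d1 (s : R) : s \in `[0, 1] -> \det (1%:M + s *: (1%:M - 1%:M) : 'M[R]_3) != 0.
  by rewrite subrr scaler0 addr0 det1 oner_eq0.
apply: null_eq (null_path 0 b fk fL d1) => x.
by rewrite det1 !mulmx1 addr0 !mulr1.
Qed.

Lemma null_affine f L (A : 'M[R]_3) (b : 'rV[R]_3) : Cinf setT f -> supp_in L f -> \det A != 0 ->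
  null (fun x => f (x *m A + b) * `|\det A| - f x).
Proof.
move=> fk fL dA; pose g y := f (y + b).
have gk : Cinf setT g.
  apply: (@Cinf_compose _ _ _ setT setT (fun x => x + b) f) => //; try exact: openT.
  move=> j; have := Cinf_affine 1%:M b j; congr Cinf.
  by apply/funext => y; rewrite mulmx1.
have /truncn_itv/andP[_ LP] : 0 <= L%:R + `|b| by rewrite addr_ge0.
have gL : supp_in (Num.truncn (L%:R + `|b|)).+1 g.
  move=> x xL; apply: fL; have := ler_normB (x + b) b; rewrite addrK => h.
  by have := lt_le_trans (lt_trans LP xL) h; rewrite ltrD2r.
apply: null_eq (nullD (linv_all dA gk gL) (null_translate b fk fL)) => x.
by rewrite /g; ring.
Qed.

(** Near a point [psi] is homotopic to its affine part through maps that send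
    the complement of a small ball away from the support of [f]. *)
Lemma local_change_of_variables psi (B0 : set 'rV[R]_3) (x0 : 'rV[R]_3) :
  open B0 -> B0 x0 -> (forall j, Cinf B0 (fun y => psi y 0 j)) -> jac psi x0 != 0 ->
  exists r d : R, [/\ 0 < r, 0 < d, ball x0 r `<=` B0 &
    forall f L, Cinf setT f -> supp_in L f -> (forall y, ~ ball (psi x0) d y -> f y = 0) ->
      null (fun x => ext0 (ball x0 r) (fun x => f (psi x) * `|jac psi x|) x - f x)].
Proof.
move=> oB0 Bx0 pk J0; pose A : 'M[R]_3 := \matrix_(i, j) 'D_'e_i (fun y => psi y 0 j) x0.
have JA : jac psi x0 = \det A.
  by rewrite det3E /jac; congr det3; apply/funext => i; apply/funext => j; rewrite mxE.
have dA : \det A != 0 by rewrite -JA.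
have [c c0 cP] := norm_mulmx_ge dA.
pose b := psi x0 - x0 *m A; pose psi0 y := y *m A + b.
have psi0E x : psi0 x = psi x0 + (x - x0) *m A.
  by rewrite /psi0 /b mulmxBl addrCA addrA.
(* The deviation of [psi] from its affine part is at most half the expansion of the
   affine part, so that the homotopy moves no outer point near [psi x0]. *)
pose e := (2 * c)^-1; have e0 : 0 < e by rewrite invr_gt0 mulr_gt0.
have inc : \forall h \near (0 : 'rV[R]_3), forall j, `|psi (x0 + h) 0 j - psi x0 0 j - (h *m A) 0 j| <= e * `|h|.
  apply: near_all => j.
  have := C1_increment oB0 Bx0 (pk j 1%N) e0.
  apply: filterS => h; rewrite /lincomb mxE; congr (`|_ - _| <= _).
  by apply: eq_bigr => i _; rewrite mxE.
have Jk : Cinf B0 (jac psi).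
  by apply: Cinf_det3r => // j; exact: Cinf_D.
have nJ : \forall x \near x0, B0 x /\ 0 < jac psi x * \det A.
  apply: filterI; first exact: open_nbhs_nbhs.
  have nA : 0 < `|\det A| by rewrite normr_gt0.
  have := cont_dist_lt (Cinf_cont Jk Bx0) nA; apply: filterS => x.
  rewrite JA; move: (jac psi x) (\det A) dA => u v v0.
  have [vn|vp|v00] := ltgtP v 0; last by rewrite v00 eqxx in v0.
    by rewrite (ltr0_norm vn) ltr_norml => /andP[h1 h2]; rewrite nmulr_lgt0//; lra.
  by rewrite (gtr0_norm vp) ltr_norml => /andP[h1 h2]; rewrite pmulr_lgt0//; lra.
have /nbhs_ballP[r1 /= r10 r1P] := nJ; have /nbhs_ballP[r2 /= r20 r2P] := inc.
pose r := Num.min r1 r2; have r0 : 0 < r by rewrite lt_min r10.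
have rB : ball x0 r `<=` B0.
  by move=> x xr; have [] := r1P x (le_ball _ xr); rewrite ?ge_min ?lexx.
exists r, (r / (4 * c)); split => //; first by rewrite divr_gt0// mulr_gt0.
move=> f L fk fL f0; set d := r / (4 * c) in f0.
have c20 : 0 < 2 * c by rewrite mulr_gt0.
have dE : d * (2 * c) = r / 2 by rewrite /d; field; rewrite gt_eqF.
have B0r x : ball x0 r x -> `|x - x0| < r by rewrite -ball_normE /ball_/= distrC.
have out y : d <= `|y - psi x0| -> f y = 0.
  by move=> dy; apply: f0; rewrite -ball_normE /ball_/= distrC => yd; rewrite ltNge dy in yd.
have incr x : ball x0 r x -> `|psi x - psi0 x| <= e * `|x - x0|.
  move=> xr; have : ball 0 r2 (x - x0).
    rewrite -ball_normE /ball_/= sub0r normrN; apply: lt_le_trans (B0r x xr) _.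
    by rewrite ge_min lexx orbT.
  move=> /r2P H; apply: mx_norm_le => [|j]; first by rewrite mulr_ge0// ltW.
  have := H j; rewrite [x0 + _]addrC subrK psi0E; congr (_ <= _).
  by rewrite !mxE opprD addrA; congr (`|_|); rewrite !mxE.
pose K := [set x : 'rV[R]_3 | `|x - x0| <= r / 2].
have cK : closed K.
  apply: (@preimage_closed _ _ (fun y : 'rV[R]_3 => `|y - x0|) [set t | t <= r / 2]).
    move=> y _; apply: (@continuous_comp _ _ _ (fun y : 'rV[R]_3 => y - x0) (fun y => `|y|)).
      by apply: continuousB => //; exact: cst_continuous.
    exact: norm_continuous.
  exact: closed_le.
have KB : K `<=` ball x0 r.
  by move=> x Kx; rewrite -ball_normE /ball_/= distrC (le_lt_trans Kx)//; lra.
have /truncn_itv/andP[_ LP] : 0 <= `|x0| + r / 2 by rewrite addr_ge0// divr_ge0// ltW.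
have KL x : K x -> `|x| <= (Num.truncn (`|x0| + r / 2)).+1%:R.
  move=> Kx; apply: le_trans (ltW LP); rewrite -[x](subrK x0) addrC.
  by apply: le_trans (ler_normD _ _) _; rewrite lerD2l.
have fs0 (s : R) x : s \in `[0, 1] -> ball x0 r x -> ~ K x -> f (psi0 x + s *: (psi x - psi0 x)) = 0.
  rewrite in_itv/= => /andP[s0 s1] xr Kx; apply: out.
  have xK : r / 2 < `|x - x0| by rewrite ltNge; apply/negP.
  have h1 := cP (x - x0).
  have h2 : `|s *: (psi x - psi0 x)| <= e * `|x - x0|.
    rewrite normrZ ger0_norm//; apply: le_trans (incr x xr); exact: ler_piMl.
  have h3 : `|(x - x0) *m A| <= `|psi0 x + s *: (psi x - psi0 x) - psi x0| + e * `|x - x0|.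
    have -> : (x - x0) *m A = (psi0 x + s *: (psi x - psi0 x) - psi x0) - s *: (psi x - psi0 x).
      by rewrite addrAC addrK psi0E addrAC subrr add0r.
    by apply: le_trans (ler_normB _ _) _; rewrite lerD2l.
  have h4 : c * `|(x - x0) *m A| <= c * `|psi0 x + s *: (psi x - psi0 x) - psi x0| + `|x - x0| / 2.
    have -> : `|x - x0| / 2 = c * (e * `|x - x0|) by rewrite /e; field; rewrite gt_eqF.
    by rewrite -mulrDr ler_pM2l.
  rewrite -(ler_pM2r c20) dE.
  by move: h1 h4 xK; rewrite -/(psi0 x); set u := `|_ - psi x0|; set v := `|x - x0|; nra.
have n1 := null_affine_homotopy fk (ball_open x0 r) (fun j => Cinf_sub (fun _ _ => I) (Cinf_affine A b j))
  (fun j => Cinf_sub rB (pk j)) cK KB KL fs0.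
have n2 := null_affine b fk fL dA.
have f00 x : ~ ball x0 r x -> f (psi0 x) = 0.
  move=> xr; apply: out; rewrite psi0E addrAC subrr add0r.
  rewrite -(ler_pM2r c20) dE.
  have : r <= `|x - x0| by rewrite leNgt; apply/negP => h; apply: xr; rewrite -ball_normE /ball_/= distrC.
  have := cP (x - x0).
  by set u := `|_ *m A|; set v := `|_|; lra.
apply: null_eq (nullD (nullZ (Num.sg (\det A)) n1) n2) => x.
rewrite /ext0 jac_affine; case: ifPn => [/asboolP xr|/asboolPn xr]; last first.
  by rewrite -/(psi0 x) f00// mul0r mulr0; ring.
have [_ Jx] : B0 x /\ 0 < jac psi x * \det A.
  by apply: r1P; apply: le_ball xr; rewrite ge_min lexx.
have [dn|dp|d0] := ltgtP (\det A) 0; last by rewrite d0 eqxx in dA.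
  have jn : jac psi x < 0 by move: Jx; rewrite nmulr_lgt0.
  by rewrite (ltr0_sg dn) (ltr0_norm dn) (ltr0_norm jn); ring.
have jp : 0 < jac psi x by move: Jx; rewrite pmulr_lgt0.
by rewrite (gtr0_sg dp) (gtr0_norm dp) (gtr0_norm jp); ring.
Qed.

End AffineHomotopy.

(** * Bump functions and partitions of unity *)

Section FlatFunction.
Variable R : realType.

(** The functions [t^-k exp (-1/t)] are flat at [0], and their span is closed
    under derivation. *)
Definition flat (k : nat) (t : R) : R := if 0 < t then t^-1 ^+ k * expR (- t^-1) else 0.

Lemma flat_pos k t : 0 < t -> 0 < flat k t.
Proof. by move=> t0; rewrite /flat t0 mulr_gt0 ?exprn_gt0 ?invr_gt0 ?expR_gt0. Qed.

Lemma flat_ge0 k t : 0 <= flat k t.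
Proof. by have [t0|t0] := ltP 0 t; [exact/ltW/flat_pos|rewrite /flat ltNge t0]. Qed.

Lemma flat_npos k t : t <= 0 -> flat k t = 0.
Proof. by move=> t0; rewrite /flat ltNge t0. Qed.

Lemma flat_le k t : `|flat k t| <= k.+2`!%:R * (t * t).
Proof.
have F0 : 0 < k.+2`!%:R :> R by rewrite ltr0n fact_gt0.
rewrite ger0_norm ?flat_ge0//; have [t0|t0] := ltP 0 t; last first.
  by rewrite flat_npos//; apply: mulr_ge0; [exact: ltW|rewrite -expr2 sqr_ge0].
rewrite /flat t0 expRN; set x := t^-1; have x0 : 0 < x by rewrite invr_gt0.
have tE : t = x^-1 by rewrite invrK.
have E0 := expR_gt0 x; have := expR_ge1Dxn k.+1 (ltW x0).
move: (expR x) E0 (k.+2`!%:R : R) F0 => e e0 F F0 H.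
have : x ^+ k.+2 / F <= e by apply: le_trans H; rewrite lerDr.
rewrite ler_pdivrMr// => {}H.
rewrite ler_pdivrMr// tE -invfM mulrAC [X in _ <= X]mulrC ler_pdivlMl ?mulr_gt0//.
by move: H; rewrite !exprS mulrA [F * e]mulrC.
Qed.

Lemma is_derive_flat k (t : R) :
  is_derive t (1 : R) (flat k) (\sum_(c <- [:: (- k%:R, k.+1); (1, k.+2)]) c.1 * flat c.2 t).
Proof.
rewrite !big_cons big_nil /= addr0 mul1r; have [t0|t0|->] := ltgtP t 0.
- rewrite !(flat_npos _ (ltW t0)) mulr0 addr0.
  apply: near_eq_is_derive (is_derive_cst (0 : R) t (1 : R)).
  apply: filterS (lt_nbhsl t0) => s s0.
  by rewrite /cst flat_npos// ltW.
- have t00 : t != 0 by rewrite gt_eqF.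
  have dV : is_derive t (1 : R) (fun t : R => t^-1) (- t ^- 2).
    by have := is_deriveV (f := id) t00 (is_derive_id t 1); rewrite scaler1.
  have dk : is_derive t (1 : R) (fun t : R => t^-1 ^+ k) (- (k%:R * t^-1 ^+ k.+1)).
    have -> : (fun t : R => t^-1 ^+ k) = (fun t : R => t^-1) ^+ k by rewrite exprfctE.
    apply: (is_derive_eq (is_deriveX k dV)).
    case: (k) => [|m]; first by rewrite !mul0r oppr0 scale0r.
    by rewrite -[_ *: _]/(_ * _) mulrN -mulrA -exprVn -exprD addn2.
  have de : is_derive t (1 : R) (fun t => expR (- t^-1)) (expR (- t^-1) * t^-1 ^+ 2).
    apply: is_derive1_comp => //; apply: (is_derive_eq (is_deriveN dV)).
    by rewrite opprK exprVn.
  have nt : - t < 0 by rewrite oppr_lt0.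
  apply: (is_derive_eq (near_eq_is_derive _ (is_deriveMx dk de))).
    by apply: filterS (Nlt_nbhsl nt) => s; rewrite oppr_lt0 => s0; rewrite /flat s0.
  by rewrite /flat t0 !exprS; ring.
rewrite !(flat_npos _ (lexx 0)) mulr0 addr0.
have F0 : 0 < k.+2`!%:R :> R by rewrite ltr0n fact_gt0.
have C : (fun h : R => h^-1 *: ((flat k \o shift 0) (h *: 1) - flat k 0)) @ 0^' --> (0 : R).
  apply/cvgrPdist_le => e e0.
  have d0 : 0 < e / k.+2`!%:R by rewrite divr_gt0.
  exists (e / k.+2`!%:R) => // h hd h0.
  rewrite /ball_ /= sub0r normrN in hd.
  rewrite sub0r normrN /= [h *: 1]mulr1 addr0 (flat_npos _ (lexx 0)) subr0 [_ *: _]mulrC normrM.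
  have := flat_le k h; rewrite normfV ler_pdivrMr ?normr_gt0// => /le_trans; apply.
  have -> : h * h = `|h| * `|h| by rewrite -normrM ger0_norm// -expr2 sqr_ge0.
  rewrite mulrA; apply: ler_wpM2r => //; rewrite mulrC -ler_pdivlMr//; exact: ltW.
by apply: DeriveDef; [apply/cvg_ex; exists 0|exact: cvg_lim C].
Qed.

Lemma flat_Cinf n (V : set 'rV[R]_n) k g : open V -> Cinf V g -> Cinf V (fun x => flat k (g x)).
Proof.
move=> oV gk m.
exact: (@Ck_comp1 _ _ setT nat flat (fun k => [:: (- k%:R, k.+1); (1, k.+2)]) _ _ _ oV
  (fun j t _ => is_derive_flat j t) (fun _ _ => I) (gk m)).
Qed.

(** For [0 < r] this is positive exactly on the open ball of radius [r] around [a], the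
   norm being the sup norm. *)
Definition bump n (a : 'rV[R]_n) (r : R) (x : 'rV[R]_n) : R :=
  \prod_j flat 0 (r * r - (x 0 j - a 0 j) * (x 0 j - a 0 j)).

Lemma bump_Cinf n (a : 'rV[R]_n) r : Cinf setT (bump a r).
Proof.
apply: Cinf_prod => [|j _]; first exact: openT.
apply: flat_Cinf; first exact: openT.
have k : Cinf setT (fun x : 'rV[R]_n => x 0 j - a 0 j).
  by apply: CinfBr; [exact: openT|exact: Cinf_coord|exact: Cinf_cst].
by apply: CinfBr; [exact: openT|exact: Cinf_cst|apply: CinfMr => //; exact: openT].
Qed.

Lemma bump_ge0 n (a : 'rV[R]_n) r x : 0 <= bump a r x.
Proof. by apply: prodr_ge0 => j _; exact: flat_ge0. Qed.

Lemma bump_center n (a : 'rV[R]_n) r : 0 < r -> 0 < bump a r a.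
Proof. by move=> r0; apply: prodr_gt0 => j _; rewrite subrr mulr0 subr0 flat_pos// mulr_gt0. Qed.

Lemma bump_out n (a : 'rV[R]_n) r x : 0 < r -> r < `|x - a| -> bump a r x = 0.
Proof.
move=> r0 xr; have [/existsP[j jr]|] := boolP [exists j, r < `|x 0 j - a 0 j|].
  rewrite /bump (bigD1 j)//= flat_npos ?mul0r// subr_le0.
  have -> : (x 0 j - a 0 j) * (x 0 j - a 0 j) = `|x 0 j - a 0 j| * `|x 0 j - a 0 j|.
    by rewrite -normrM ger0_norm// -expr2 sqr_ge0.
  by apply: ler_pM; rewrite ?ltW.
rewrite negb_exists => /forallP H; move: xr; rewrite ltNge => /negP; case.
apply: mx_norm_le => [|j]; first exact: ltW.
by rewrite !mxE leNgt.
Qed.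

End FlatFunction.

Section PartitionOfUnity.
Variables (R : realType) (n : nat) (M : manifold R n).
Local Notation C := R[i].
Implicit Types (U V O K : set M) (u : M -> R) (p q : M) (c d : chart R n M).

(** Extending a function by zero outside a chart domain keeps it smooth because
    compact sets are closed in a Hausdorff space. *)
Lemma bump_exists O p : open O -> O p -> exists (u : M -> R) K,
  [/\ smooth_on setT (fun q => (u q)%:C), forall q, 0 <= u q, 0 < u p, closed K /\ K `<=` O &
      forall q, ~ K q -> u q = 0].
Proof.
move=> oO Op; have [c ac cp] := atlas_cover p; pose a := cmap c p.
have /nbhs_ballP[r2 /= r20 r2P] : nbhs a (cmap c @` (O `&` cdom c)).
  by apply: open_nbhs_nbhs; split; [exact: img_open|exists p].
pose r := r2 / 2; have r0 : 0 < r by rewrite divr_gt0.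
pose D := [set x : 'rV[R]_n | `|x - a| <= r].
have DO : D `<=` cmap c @` (O `&` cdom c).
  move=> x Dx; apply: r2P; rewrite -ball_normE /ball_/= distrC.
  by apply: le_lt_trans Dx _; rewrite /r; lra.
have cD : compact D.
  apply: bounded_closed_compact.
    exists (`|a| + r); split; first exact: num_real.
    move=> k ak x Dx; apply: le_trans (ltW ak); rewrite -[x](subrK a) addrC.
    by apply: le_trans (ler_normD _ _) _; rewrite lerD2l.
  apply: (@preimage_closed _ _ (fun y : 'rV[R]_n => `|y - a|) [set t | t <= r]).
    move=> y _; apply: (@continuous_comp _ _ _ (fun y : 'rV[R]_n => y - a) (fun y => `|y|)).
      by apply: continuousB => //; exact: cst_continuous.
    exact: norm_continuous.
  exact: closed_le.
pose K := cinv c @` D.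
have cK : closed K.
  apply: (compact_closed (@manifold_hausdorff _ _ M)); apply: continuous_compact => //.
  apply: continuous_in_subspaceT => x; rewrite inE => Dx.
  by apply: cinv_cont; have [q [_ cq] <-] := DO x Dx; exists q.
have KO q : K q -> [/\ O q, cdom c q & D (cmap c q)].
  by case=> x Dx <-; have [q' [Oq cq] E] := DO x Dx; rewrite -E cmapK//; split=> //; rewrite E.
pose u q : R := if `[< cdom c q >] then bump a r (cmap c q) else 0.
have uE q : cdom c q -> u q = bump a r (cmap c q) by move=> cq; rewrite /u asboolT.
have u0 q : ~ K q -> u q = 0.
  move=> Kq; rewrite /u; case: ifPn => // /asboolP cq; apply: bump_out => //.
  by rewrite ltNge; apply/negP => H; apply: Kq; exists (cmap c q) => //; exact: cmapK.
exists u, K; split=> //.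
- apply: smooth_pointwise => q _; have [cq|cq] := pselect (cdom c q).
    exists (cdom c); split=> //.
    apply: (@smooth_eq _ _ _ _ (fun q => (bump a r (cmap c q))%:C)); first exact: cdom_open.
      by move=> q' cq'; rewrite uE.
    have := smooth_chart ac openT (bump_Cinf a r); apply: smooth_sub => q' cq'; by split.
  exists (~` K); split; first by move=> /KO[].
  apply: (@smooth_eq _ _ _ _ (fun=> 0)); first exact: closed_openC.
    by move=> q' Kq'; rewrite u0.
  by apply: smooth_cst; exact: closed_openC.
- by move=> q; rewrite /u; case: ifP => _ //; exact: bump_ge0.
- by rewrite uE//; exact: bump_center.
- by split=> // q /KO[].
Qed.

Hypothesis cM : compact [set: M].

Lemma finite_subcover (V : M -> set M) : (forall p, nbhs p (V p)) ->
  exists s : seq M, forall q, exists2 p, p \in s & V p q.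
Proof.
move=> VP; have /compact_near_coveringP nc := cM.
pose F := filter_from setT (fun s0 : seq M => [set s : seq M | {subset s0 <= s}]).
have FF : Filter F.
  apply: filter_from_filter; first by exists [::].
  move=> s t _ _; exists (s ++ t) => // w /= sw; split=> x xs; apply: sw; rewrite mem_cat xs ?orbT//.
have := nc _ F (fun s q => exists2 p, p \in s & V p q) FF.
case=> [p _|s _ /(_ s) H].
  exists (V p, [set s : seq M | {subset [:: p] <= s}]); first by split=> //; exists [:: p].
  by move=> [q s] /= [Vq ps]; exists p => //; apply: ps; rewrite mem_head.
by exists s => q; apply: H.
Qed.

Lemma partition_of_unity (O : M -> set M) : (forall p, open (O p)) -> (forall p, O p p) ->
  exists (s : seq M) (chi : M -> M -> R) (K : M -> set M),
  [/\ forall p, smooth_on setT (fun q => (chi p q)%:C),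
      forall p q, 0 <= chi p q,
      forall p, closed (K p) /\ K p `<=` O p,
      forall p q, ~ K p q -> chi p q = 0 &
      forall q, \sum_(p <- s) chi p q = 1].
Proof.
move=> oO Op.
have /choice[u uP] : forall p, exists u : M -> R, exists K,
    [/\ smooth_on setT (fun q => (u q)%:C), forall q, 0 <= u q, 0 < u p, closed K /\ K `<=` O p &
        forall q, ~ K q -> u q = 0].
  by move=> p; exact: bump_exists (oO p) (Op p).
have [K KP] := choice uP.
have [s sP] : exists s : seq M, forall q, exists2 p, p \in s & 0 < u p q.
  apply: finite_subcover => p; have [su u0 up _ _] := KP p.
  have [cu _] := smooth_cont su (I : [set: M] p).
  have := cont_dist_lt cu up; apply: filterS => q /=.
  by rewrite ltr_distlC => /andP[+ _]; rewrite subrr.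
pose S q := \sum_(p <- s) u p q.
have S0 q : 0 < S q.
  have [p ps pq] := sP q; rewrite /S (big_rem p)//=.
  by apply: ltr_pwDl => //; apply: sumr_ge0 => p' _; have [_ + _ _ _] := KP p'; exact.
have sS : smooth_on setT (fun q => (S q)%:C).
  apply: (@smooth_eq _ _ _ _ (fun q => \sum_(p <- s) (u p q)%:C)); first exact: openT.
    by move=> q _; rewrite /S rmorph_sum.
  by apply: smooth_sum; [exact: openT|move=> p _; have [] := KP p].
exists s, (fun p q => u p q / S q), K; split.
- move=> p; have [su _ _ _ _] := KP p.
  apply: (@smooth_eq _ _ _ _ (fun q => (u p q)%:C * ((S q)%:C)^-1)); first exact: openT.
    by move=> q _; rewrite rmorphM fmorphV.
  apply: smoothM => //; first exact: openT.
  apply: smoothV => //; first exact: openT.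
  move=> q _; rewrite (_ : 0 = (0 : R)%:C)//; apply/eqP => -[E].
  by have := S0 q; rewrite E ltxx.
- by move=> p q; rewrite divr_ge0//; [have [_ + _ _ _] := KP p; exact|exact: ltW].
- by move=> p; have [_ _ _ + _] := KP p.
- by move=> p q Kq; have [_ _ _ _ ->//] := KP p; rewrite mul0r.
- move=> q; rewrite -mulr_suml -/(S q) divff//; exact/lt0r_neq0/S0.
Qed.

End PartitionOfUnity.

(** * The divergence theorem on a closed manifold *)

Section Divergence.
Variables (R : realType) (M : manifold R 3).
Local Notation C := R[i].
Implicit Types (U V O K : set M) (u h : M -> R) (p q : M) (c d : chart R 3 M).

Local Notation cimg c := (cmap c @` cdom c).

Definition rsmooth U u := smooth_on U (fun q => (u q)%:C).

Lemma rsmooth_sub U V u : V `<=` U -> rsmooth U u -> rsmooth V u.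
Proof. exact: smooth_sub. Qed.

Lemma rsmoothM U u h : open U -> rsmooth U u -> rsmooth U h -> rsmooth U (fun q => u q * h q).
Proof.
move=> oU uU hU; apply: (smooth_eq oU _ (smoothM oU uU hU)) => q _.
by rewrite rmorphM.
Qed.

Lemma rsmoothD U u h : open U -> rsmooth U u -> rsmooth U h -> rsmooth U (fun q => u q + h q).
Proof.
move=> oU uU hU; apply: (smooth_eq oU _ (smoothD oU uU hU)) => q _.
by rewrite rmorphD.
Qed.

Lemma rsmooth_Cinf U u c : atlas c -> rsmooth U u -> Cinf (cmap c @` (U `&` cdom c)) (fun x => u (cinv c x)).
Proof. by move=> ac /(_ c ac)[]. Qed.

Lemma rsmooth_chart u c : atlas c -> rsmooth (cdom c) u -> Cinf (cimg c) (fun x => u (cinv c x)).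
Proof. by move=> ac /(rsmooth_Cinf ac); rewrite setIid. Qed.

Hypothesis cM : compact [set: M].
Variable rho : chart R 3 M -> M -> R.
(** A density: a positive function in each chart, such that [rho dx1 dx2 dx3] does not
    depend on the chart. *)
Hypothesis rho_smooth : forall c, atlas c -> rsmooth (cdom c) (rho c).
Hypothesis rho_gt0 : forall c q, atlas c -> cdom c q -> 0 < rho c q.
Hypothesis rho_jac : forall c d q, atlas c -> atlas d -> cdom c q -> cdom d q ->
  rho c q = rho d q * `|jac (fun x => cmap d (cinv c x)) (cmap c q)|.

(** The function whose integral over the chart is that of [h] over [cdom c]. *)
Definition lift c h : 'rV[R]_3 -> R := ext0 (cimg c) (fun x => h (cinv c x) * rho c (cinv c x)).

Lemma lift_in c h q : cdom c q -> lift c h (cmap c q) = h q * rho c q.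
Proof. by move=> cq; rewrite /lift ext0_in ?cmapK//; exists q. Qed.

Lemma lift_eq0 c h x : (forall q, cdom c q -> x = cmap c q -> h q = 0) -> lift c h x = 0.
Proof.
move=> H; rewrite /lift /ext0; case: ifPn => // /asboolP[q cq xE].
by rewrite -xE cmapK// H// mul0r.
Qed.

Lemma lift_sum c (I : Type) (s : seq I) (F : I -> M -> R) x :
  lift c (fun q => \sum_(i <- s) F i q) x = \sum_(i <- s) lift c (F i) x.
Proof.
rewrite /lift /ext0; case: ifP => _; last by rewrite big1.
by rewrite mulr_suml.
Qed.

Lemma compact_cimg c K : closed K -> K `<=` cdom c -> compact (cmap c @` K).
Proof.
move=> cK Kc; apply: continuous_compact.
  by apply: continuous_in_subspaceT => q; rewrite inE => /Kc; exact: cmap_cont.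
by apply: (@subclosed_compact _ K setT).
Qed.

Lemma lift_Cinf c h K : atlas c -> rsmooth (cdom c) h -> closed K -> K `<=` cdom c ->
  (forall q, ~ K q -> h q = 0) ->
  Cinf setT (lift c h) /\ exists L, supp_in L (lift c h).
Proof.
move=> ac hc cK Kc h0; have cKc := compact_cimg cK Kc; have oc := @cimg_open _ _ _ c.
have cKi : closed (cmap c @` K) by apply: compact_closed cKc; exact: norm_hausdorff.
have z x : cimg c x -> ~ (cmap c @` K) x -> h (cinv c x) * rho c (cinv c x) = 0.
  by move=> [q cq <-] Kx; rewrite cmapK// h0 ?mul0r// => Kq; apply: Kx; exists q.
split.
  apply: (ext0_Cinf oc cKi _ z); first exact: image_subset.
  by apply: CinfMr => //; apply: rsmooth_chart => //; exact: rho_smooth.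
have [B [_ HB]] := compact_bounded cKc.
have /truncn_itv/andP[_ LP] : 0 <= `|B| + 1 by rewrite addr_ge0.
exists (Num.truncn (`|B| + 1)).+1 => x xL.
rewrite /lift /ext0; case: ifPn => // /asboolP cx; apply: z => // Kx.
have Bl : B < `|B| + 1 by apply: le_lt_trans (ler_norm B) _; rewrite ltrDl.
by have := lt_le_trans (lt_trans LP xL) (HB _ Bl _ Kx); rewrite ltxx.
Qed.

(** ** Independence of the chart *)

(** Functions supported in a small neighbourhood of [p] have, up to null functions,
    the same lift to both charts, by the local change of variables. *)
Lemma lift_change_local c d h p : atlas c -> atlas d -> rsmooth (cdom c `&` cdom d) h ->
  cdom c p -> cdom d p -> exists O, [/\ open O, O p &
    forall psi K', rsmooth setT psi -> closed K' -> K' `<=` O -> (forall q, ~ K' q -> psi q = 0) ->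
      null (fun x => lift c (fun q => psi q * h q) x - lift d (fun q => psi q * h q) x)].
Proof.
move=> ac ad hs cp dp; pose psi0 x := cmap d (cinv c x).
have oc := cdom_open c; have od := cdom_open d.
pose B0 := cmap c @` (cdom c `&` cdom d).
have oB : open B0 by rewrite /B0 setIC; exact: img_open.
have J0 : jac psi0 (cmap c p) != 0.
  have := rho_gt0 ac cp; rewrite (rho_jac ac ad cp dp); apply: contraTneq => J0.
  by rewrite -[jac _ _]/(jac psi0 (cmap c p)) J0 normr0 mulr0 ltxx.
have Bp : B0 (cmap c p) by exists p.
have [r [e [r0 e0 rB H]]] := local_change_of_variables oB Bp (atlas_compat ac ad) J0.
have psiE q : cdom c q -> psi0 (cmap c q) = cmap d q by move=> cq; rewrite /psi0 cmapK.
rewrite /psi0 cmapK// -/psi0 in H.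
pose O := [set q | [/\ cdom c q, cdom d q, ball (cmap c p) r (cmap c q) & ball (cmap d p) e (cmap d q)]].
exists O; split.
- rewrite openE => q [cq dq b1 b2]; rewrite /interior.
  have n1 : \forall q' \near q, cdom c q' by apply: open_nbhs_nbhs.
  have n2 : \forall q' \near q, cdom d q' by apply: open_nbhs_nbhs.
  have n3 : \forall q' \near q, ball (cmap c p) r (cmap c q').
    by apply: near_cinv => //; apply: open_nbhs_nbhs; split=> //; exact: ball_open.
  have n4 : \forall q' \near q, ball (cmap d p) e (cmap d q').
    by apply: near_cinv => //; apply: open_nbhs_nbhs; split=> //; exact: ball_open.
  by apply: filterS2 (filterI n1 n2) (filterI n3 n4) => q' [? ?] [? ?].
- by split=> //; exact: ballxx.
move=> psi K' sp cK' K'O p0; set g := fun q => psi q * h q.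
have g0 q : ~ K' q -> g q = 0 by move=> /p0 g0; rewrite /g g0 mul0r.
have gd : rsmooth (cdom d) g.
  apply: smooth_pointwise => q dq; have [cq|cq] := pselect (cdom c q).
    exists (cdom c `&` cdom d); split=> //; apply: rsmoothM => //; first exact: openI.
    exact: rsmooth_sub sp.
  exists (~` K'); split; first by move=> /K'O[].
  apply: (@smooth_eq _ _ _ _ (fun=> 0)); first exact: closed_openC.
    by move=> q' Kq'; rewrite g0.
  by apply: smooth_cst; exact: closed_openC.
have K'd : K' `<=` cdom d by move=> q /K'O[].
have [fk [L fL]] := lift_Cinf ad gd cK' K'd g0.
have f0 y : ~ ball (cmap d p) e y -> lift d g y = 0.
  move=> yb; apply: lift_eq0 => q dq yE; apply: g0 => /K'O[_ _ _ +].
  by rewrite -yE.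
apply: null_eq (H _ _ fk fL f0) => x; congr (_ - _).
rewrite {1}/ext0; case: ifPn => [/asboolP xb|/asboolPn xb]; last first.
  by rewrite lift_eq0// => q cq xE; apply: g0 => /K'O[_ _ + _]; rewrite -xE.
have [q [cq dq] <-] := rB x xb; rewrite -/(psi0 _) psiE// !lift_in// (rho_jac ac ad cq dq).
by rewrite mulrA.
Qed.

(** A partition of unity reduces this to small supports; away from [K] the function
    vanishes and there is nothing to compare. *)
Lemma lift_change c d h K : atlas c -> atlas d -> rsmooth (cdom c `&` cdom d) h ->
  closed K -> K `<=` cdom c `&` cdom d -> (forall q, ~ K q -> h q = 0) ->
  null (fun x => lift c h x - lift d h x).
Proof.
move=> ac ad hs cK Kcd h0.
have /choice[G GP] : forall p, exists O, [/\ open O, O p &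
    forall psi K', rsmooth setT psi -> closed K' -> K' `<=` O -> (forall q, ~ K' q -> psi q = 0) ->
      null (fun x => lift c (fun q => psi q * h q) x - lift d (fun q => psi q * h q) x)].
  move=> p; have [[cp dp]|np] := pselect ((cdom c `&` cdom d) p); first exact: lift_change_local.
  exists (~` K); split; [exact: closed_openC|by move=> /Kcd|].
  move=> psi K' _ _ K'O p0; apply: null_eq (@null0 _ _) => x.
  have g0 q : psi q * h q = 0.
    have [/h0->|Kq] := pselect (~ K q); first by rewrite mulr0.
    by rewrite p0 ?mul0r// => /K'O.
  by rewrite !lift_eq0 ?subrr.
have [s [chi [K' [chis chi0 K'O chiK chi1]]]] :=
  partition_of_unity cM (fun p => let: And3 a _ _ := GP p in a) (fun p => let: And3 _ a _ := GP p in a).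
have E e x : lift e h x = \sum_(p <- s) lift e (fun q => chi p q * h q) x.
  rewrite -lift_sum; congr (lift e _ x); apply/funext => q.
  by rewrite -mulr_suml chi1 mul1r.
have N p : null (fun x => lift c (fun q => chi p q * h q) x - lift d (fun q => chi p q * h q) x).
  have [_ _ H] := GP p; have [cK' sK'] := K'O p.
  by apply: (H _ _ (chis p) cK' sK') => q; exact: chiK.
by apply: null_eq (null_sum s N) => x; rewrite sumrB -!E.
Qed.

(** ** The divergence theorem *)

Variables (Y : vfield M) (kappa : M -> R).
Hypothesis Y_smooth : smooth_vfield setT Y.
Hypothesis kappa_smooth : rsmooth setT kappa.
Hypothesis divergence : forall c q, atlas c -> cdom c q ->
  \sum_j 'D_'e_j (fun x => rho c (cinv c x) * 're (Y (cinv c x) (coordf c j))) (cmap c q)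
    = rho c q * kappa q.

Let dY u q : R := 're (Y q (fun q => (u q)%:C)).

Let dY_expand c u q : atlas c -> cdom c q -> rsmooth setT u ->
  dY u q = \sum_j 're (Y q (coordf c j)) * 'D_'e_j (fun x => u (cinv c x)) (cmap c q).
Proof.
move=> ac cq us; rewrite /dY; have := tangent_expand ac cq (vfield_tangent Y_smooth (I : [set: M] q)).
move=> /(congr1 (fun v : vec M => v (fun q => (u q)%:C))) ->.
rewrite raddf_sum; apply: eq_bigr => j _; rewrite /partial asboolT; last by exists setT; split=> //; exact: openT.
rewrite (_ : 'D_'e_j (fun x => 'im _) _ = 0); last exact: derive_cst.
by case: (Y q _) => a b /=; rewrite mulr0 subr0.
Qed.

Let dY_smooth u : rsmooth setT u -> rsmooth setT (dY u).
Proof.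
move=> us; apply: smooth_Re; first exact: openT.
by apply: (vfield_smooth Y_smooth) => //; exact: openT.
Qed.

(** [u kappa + Y u] is the divergence of [u Y], which has compact support in one
    chart. *)
Lemma null_lift_divergence c u K : atlas c -> rsmooth setT u -> closed K -> K `<=` cdom c ->
  (forall q, ~ K q -> u q = 0) -> null (lift c (fun q => u q * kappa q + dY u q)).
Proof.
move=> ac us cK Kc u0; have oc := cdom_open c.
pose Yj j q : R := 're (Y q (coordf c j)).
have Yjs j : rsmooth (cdom c) (Yj j).
  apply: smooth_Re => //; apply: (vfield_smooth Y_smooth) => //; exact: smooth_coord.
have uc : rsmooth (cdom c) u by exact: rsmooth_sub us.
have gs j : rsmooth (cdom c) (fun q => u q * Yj j q) by exact: rsmoothM.
have g0 j q : ~ K q -> u q * Yj j q = 0 by move=> /u0->; rewrite mul0r.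
have N j : null (fun x => 'D_'e_j (lift c (fun q => u q * Yj j q)) x).
  have [gk [L gL]] := lift_Cinf ac (gs j) cK Kc (g0 j).
  exact: null_partial gL gk.
apply: null_eq (null_sum (index_enum 'I_3) N) => x.
have cKi : closed (cmap c @` K).
  by apply: compact_closed (compact_cimg cK Kc); exact: norm_hausdorff.
have z j y : cimg c y -> ~ (cmap c @` K) y -> u (cinv c y) * Yj j (cinv c y) * rho c (cinv c y) = 0.
  by move=> [q cq <-] Kx; rewrite cmapK// g0 ?mul0r// => Kq; apply: Kx; exists q.
rewrite (eq_bigr (fun j => ext0 (cimg c)
    (fun y => 'D_'e_j (fun x => u (cinv c x) * Yj j (cinv c x) * rho c (cinv c x)) y) x)); last first.
  move=> j _; have KB : cmap c @` K `<=` cimg c by exact: image_subset.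
  exact: (ext0_D x j (@cimg_open _ _ _ c) cKi KB (z j)).
have [[q cq <-]|nx] := pselect (cimg c x); last first.
  rewrite big1 => [|j _]; first by rewrite /lift /ext0 asboolF.
  by rewrite /ext0 asboolF.
rewrite lift_in// (dY_expand ac cq us) mulrDl mulr_suml -mulrA [kappa q * _]mulrC.
rewrite -(divergence ac cq) mulr_sumr -big_split /=; apply: eq_bigr => j _.
have xc : cimg c (cmap c q) by exists q.
have uk := rsmooth_chart ac uc; have rk := rsmooth_chart ac (rho_smooth ac).
have Yk := rsmooth_chart ac (Yjs j).
rewrite ext0_in//.
have du := derivableP (Cinf_derivable (i := j) uk xc).
have dv := derivableP (Cinf_derivable (i := j) (CinfMr (@cimg_open _ _ _ c) rk Yk) xc).
have -> : (fun x => u (cinv c x) * Yj j (cinv c x) * rho c (cinv c x))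
    = (fun x => u (cinv c x) * (rho c (cinv c x) * Yj j (cinv c x))).
  by apply/funext => y; ring.
have [_ ->] := is_deriveMx du dv.
by rewrite cmapK// /Yj; ring.
Qed.

(** The functions [chi] of a partition of unity satisfy
    [kappa = \sum_k (chi_k kappa + Y chi_k)], as [\sum_k Y chi_k = Y 1 = 0], and each
    term is a divergence supported in one chart.  Hence the sum of the lifts of
    the [chi_p kappa] is null, although it is nonnegative. *)
Theorem nonneg_divergence_eq0 : (forall q, 0 <= kappa q) -> forall q, kappa q = 0.
Proof.
move=> k0 p0; apply/eqP; rewrite eq_le k0 andbT leNgt; apply/negP => kp.
have /choice[ch chP] : forall p : M, exists c, atlas c /\ cdom c p.
  by move=> p; have [c ac cp] := atlas_cover p; exists c.
have [s [chi [K [chis chi0 KO chiK chi1]]]] := partition_of_unity cM (O := fun p => cdom (ch p))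
  (fun p => cdom_open (ch p)) (fun p => (chP p).2).
have ac p : atlas (ch p) by have [] := chP p.
pose h k q := chi k q * kappa q + dY (chi k) q.
have hs k : rsmooth setT (h k).
  exact: (rsmoothD openT (rsmoothM openT (chis k) kappa_smooth) (dY_smooth (chis k))).
have hK k q : ~ K k q -> h k q = 0.
  move=> Kq; rewrite /h chiK// mul0r add0r /dY.
  have tY := vfield_tangent Y_smooth (I : [set: M] q).
  rewrite (tangent_near (g := fun=> 0) tY); first by rewrite (tangent0 tY).
  apply: filterS (open_nbhs_nbhs (conj (closed_openC (KO k).1) Kq)) => q' Kq'.
  by rewrite chiK.
have sum_h q : \sum_(k <- s) h k q = kappa q.
  rewrite /h big_split/= -mulr_suml chi1 mul1r.
  have tY := vfield_tangent Y_smooth (I : [set: M] q).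
  rewrite /dY -raddf_sum -(tangent_sum s tY) /=; last first.
    by move=> k; exact: (smooth_at_on openT I (chis k)).
  rewrite (_ : (fun q => _) = fun=> 1); first by rewrite (tangent_cst 1 tY) addr0.
  by apply/funext => r; rewrite -(rmorph_sum (real_complex R)) chi1.
pose I x := \sum_(p <- s) lift (ch p) (fun q => chi p q * kappa q) x.
have swap p k : null (fun x => lift (ch p) (fun q => chi p q * h k q) x
    - lift (ch k) (fun q => chi p q * h k q) x).
  apply: (lift_change (ac p) (ac k) (K := K p `&` K k)).
  - apply: rsmooth_sub (rsmoothM openT (chis p) (hs k)) => //.
  - by apply: closedI; [exact: (KO p).1|exact: (KO k).1].
  - by move=> q [Kp Kk]; split; [exact: (KO p).2|exact: (KO k).2].
  - move=> q nK; have [Kp|/chiK->] := pselect (K p q); last by rewrite mul0r.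
    by rewrite hK ?mulr0// => Kk; apply: nK.
have nI : null I.
  have n1 := null_sum s (fun k => null_sum s (fun p => swap p k)).
  have n2 := null_sum s (fun k => null_lift_divergence (ac k) (chis k) (KO k).1 (KO k).2 (@chiK k)).
  apply: null_eq (nullD n1 n2) => x.
  rewrite -big_split /= /I.
  under eq_bigr => k _.
    rewrite sumrB -lift_sum.
    rewrite [X in _ - X + _](_ : _ = lift (ch k) (h k) x); last first.
      by congr (lift _ _ x); apply/funext => q; rewrite -mulr_suml chi1 mul1r.
    rewrite subrK.
    over.
  rewrite exchange_big /=; apply: eq_bigr => p _.
  rewrite -lift_sum; congr (lift _ _ x); apply/funext => q.
  by rewrite -mulr_sumr sum_h.
have lift0 p x : 0 <= lift (ch p) (fun q => chi p q * kappa q) x.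
  rewrite /lift /ext0; case: ifPn => // /asboolP[q cq <-]; rewrite cmapK//.
  by rewrite !mulr_ge0// ltW// rho_gt0.
have [k ks kpos] : exists2 k, k \in s & 0 < chi k p0.
  apply: contrapT => H; suff : \sum_(p <- s) chi p p0 = 0 by rewrite chi1; apply/eqP/oner_neq0.
  rewrite big_seq big1// => k ks; apply/eqP; rewrite eq_le chi0 andbT leNgt.
  by apply/negP => ck; apply: H; exists k.
have ck : cdom (ch k) p0.
  by apply: (KO k).2; apply: contrapT => /chiK E; rewrite E ltxx in kpos.
apply: (not_null (g := I) (x0 := cmap (ch k) p0)) nI.
- by move=> x; apply: sumr_ge0 => p _; exact: lift0.
- rewrite /I (big_rem k)//=; apply: ltr_pwDl; last by apply: sumr_ge0 => p _; exact: lift0.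
  by rewrite lift_in// !mulr_gt0// rho_gt0.
have Ik : Cinf setT I.
  apply: Cinf_sum => [|p _]; first exact: openT.
  have [] // := lift_Cinf (K := K p) (h := fun q => chi p q * kappa q) (ac p) _ (KO p).1 (KO p).2 _.
    by apply: rsmooth_sub (rsmoothM openT (chis p) kappa_smooth).
  by move=> q /chiK ->; rewrite mul0r.
exact: Cinf_cont Ik _.
Qed.

End Divergence.

Local Notation "x ^*" := (conjc x) : ring_scope.
(** * Differential forms *)

Section Forms.
Variables (R : realType) (n : nat) (M : manifold R n).
Local Notation C := R[i].
Implicit Types (U V : set M) (a b f g : func M) (p q : M) (w : form1 M).
Implicit Types (v : vec M) (X Y : vfield M).

Lemma form1_sub U V w : V `<=` U -> smooth_form1 U w -> smooth_form1 V w.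
Proof.
move=> VU [lw sw]; split=> [p /VU|W X oW WV]; first exact: lw.
by apply: sw => //; exact: subset_trans VU.
Qed.

Lemma form1_vec0 U w p : smooth_form1 U w -> U p -> w p (fun=> 0) = 0.
Proof.
move=> sw Up; have t0 := tangent_vec0 (M := M) p.
have := form1_linear sw Up 1 t0 t0; rewrite mul1r (_ : (fun f => _) = fun=> 0); last first.
  by apply/funext => f; rewrite addr0.
by rewrite mul1r -{1}[w p _]addr0 => /addrI <-.
Qed.

Lemma form1_vecZ U w p (k : C) v : smooth_form1 U w -> U p -> tangent p v ->
  w p (fun f => k * v f) = k * w p v.
Proof.
move=> sw Up tv; have := form1_linear sw Up k tv (tangent_vec0 p).
by rewrite (form1_vec0 sw Up) addr0 => <-; congr (w p _); apply/funext => f; rewrite addr0.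
Qed.

Lemma form1_comb U w p (k l : C) v v' : smooth_form1 U w -> U p -> tangent p v -> tangent p v' ->
  w p (fun f => k * v f + l * v' f) = k * w p v + l * w p v'.
Proof.
move=> sw Up tv tv'; rewrite (form1_linear sw Up k tv (tangent_vecZ l tv')).
by rewrite (form1_vecZ l sw Up tv').
Qed.

Lemma form1_comb3 U w p (k l m : C) v v' v'' : smooth_form1 U w -> U p ->
  tangent p v -> tangent p v' -> tangent p v'' ->
  w p (fun f => k * v f + l * v' f + m * v'' f) = k * w p v + l * w p v' + m * w p v''.
Proof.
move=> sw Up tv tv' tv''; rewrite -(form1_comb k l sw Up tv tv').
have := form1_comb 1 m sw Up (tangent_comb k l tv tv') tv''; rewrite mul1r => <-.
by congr (w p _); apply/funext => f; rewrite mul1r.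
Qed.

Lemma form1_sum U w p (I : Type) (s : seq I) (k : I -> C) (v : I -> vec M) :
  smooth_form1 U w -> U p -> (forall i, tangent p (v i)) ->
  w p (fun f => \sum_(i <- s) k i * v i f) = \sum_(i <- s) k i * w p (v i).
Proof.
move=> sw Up tv; elim: s => [|i s IHs].
  rewrite big_nil -[RHS](form1_vec0 sw Up); congr (w p _).
  by apply/funext => f; rewrite big_nil.
rewrite big_cons -IHs -(form1_linear sw Up (k i) (tv i)); last first.
  by apply: tangent_vec_sum => j; exact: tangent_vecZ.
by congr (w p _); apply/funext => f; rewrite big_cons.
Qed.

Lemma conj_form1_smooth U w : open U -> smooth_form1 U w -> smooth_form1 U (conj_form1 w).
Proof.
move=> oU sw; split=> [p Up k v v' tv tv'|V X oV VU sX].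
  rewrite /conj_form1 -[in RHS](conjcK k) -rmorphM -rmorphD.
  rewrite -(form1_linear sw Up k^* (tangent_conjv tv) (tangent_conjv tv')).
  by congr (_^* ); congr (w p _); apply/funext => f; rewrite /conjv rmorphD rmorphM.
apply: smooth_conj => //; apply: (form1_smooth sw oV VU); exact: vfield_conj.
Qed.

Lemma conj_fieldK X : conj_field (conj_field X) = X.
Proof. by apply/funext => p; exact: conjvK. Qed.

Lemma bracket_conj X Y p :
  lie_bracket (conj_field X) (conj_field Y) p = conjv (lie_bracket X Y p).
Proof.
apply/funext => f; rewrite /conjv /lie_bracket; case: ifPn => [/asboolP fp|/asboolPn fp].
  rewrite asboolT; last exact: smooth_at_conj.
  rewrite rmorphB; congr (_ - _); rewrite /conj_field /conjv; congr (_^* ); congr (X p _) || congr (Y p _);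
    by apply/funext => q; rewrite conjcK.
by rewrite asboolF ?conjc0// => /smooth_at_conjE.
Qed.

Lemma bracket_local V X X' Y Y' p : open V -> V p -> smooth_vfield V X -> smooth_vfield V Y ->
  (forall q, V q -> X q = X' q) -> (forall q, V q -> Y q = Y' q) ->
  lie_bracket X Y p = lie_bracket X' Y' p.
Proof.
move=> oV Vp sX sY XX YY; apply/funext => f; rewrite /lie_bracket; case: ifP => // _.
have nV : \forall q \near p, V q by apply: open_nbhs_nbhs.
rewrite -!XX// -!YY//; congr (_ - _).
  by apply: (tangent_near (vfield_tangent sX Vp)); apply: filterS nV => q /YY ->.
by apply: (tangent_near (vfield_tangent sY Vp)); apply: filterS nV => q /XX ->.
Qed.

Lemma conj_dform w X Y p :
  dform (conj_form1 w) X Y p = (dform w (conj_field X) (conj_field Y) p)^*.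
Proof.
have conj_conjv v g : conjc (conjv v g) = v (fun q => conjc (g q)) by rewrite /conjv conjcK.
rewrite /dform !rmorphB bracket_conj -[in RHS]/conjc /=.
by rewrite /conj_field !conj_conjv.
Qed.

Lemma dform_local V w X X' Y Y' p : open V -> V p -> smooth_vfield V X -> smooth_vfield V Y ->
  (forall q, V q -> X q = X' q) -> (forall q, V q -> Y q = Y' q) ->
  dform w X Y p = dform w X' Y' p.
Proof.
move=> oV Vp sX sY XX YY; rewrite /dform (bracket_local oV Vp sX sY XX YY).
have nV : \forall q \near p, V q by apply: open_nbhs_nbhs.
congr (_ - _ - _); rewrite -?XX// -?YY//.
  by apply: (tangent_near (vfield_tangent sX Vp)); apply: filterS nV => q /YY ->.
by apply: (tangent_near (vfield_tangent sY Vp)); apply: filterS nV => q /XX ->.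
Qed.

Lemma dform_form_local V w w' X Y p : open V -> V p -> smooth_vfield V X -> smooth_vfield V Y ->
  (forall q v, V q -> tangent q v -> w q v = w' q v) -> dform w X Y p = dform w' X Y p.
Proof.
move=> oV Vp sX sY ww; have nV : \forall q \near p, V q by apply: open_nbhs_nbhs.
rewrite /dform (ww p)//; last exact: (bracket_tangent oV).
congr (_ - _ - _).
  apply: (tangent_near (vfield_tangent sX Vp)); apply: filterS nV => q Vq.
  by apply: ww => //; exact: (vfield_tangent sY Vq).
apply: (tangent_near (vfield_tangent sY Vp)); apply: filterS nV => q Vq.
by apply: ww => //; exact: (vfield_tangent sX Vq).
Qed.

Section open.
Variables (V : set M) (oV : open V) (w : form1 M) (sw : smooth_form1 V w).

Lemma dform_smooth X Y : smooth_vfield V X -> smooth_vfield V Y ->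
  smooth_on V (fun q => dform w X Y q).
Proof.
move=> sX sY; have VV : V `<=` V by [].
apply: smoothB => //; [apply: smoothB => //|].
- by apply: (vfield_smooth sX) => //; apply: (form1_smooth sw).
- by apply: (vfield_smooth sY) => //; apply: (form1_smooth sw).
- by apply: (form1_smooth sw) => //; exact: bracket_smooth.
Qed.

Lemma bracket_anti X Y p : V p -> smooth_vfield V X -> smooth_vfield V Y ->
  lie_bracket Y X p = fun f => (-1) * lie_bracket X Y p f.
Proof.
move=> Vp sX sY; apply/funext => f; rewrite /lie_bracket; case: ifP => _; last by rewrite mulr0.
by rewrite mulN1r opprB.
Qed.

Lemma dform_anti X Y p : V p -> smooth_vfield V X -> smooth_vfield V Y ->
  dform w Y X p = - dform w X Y p.
Proof.
move=> Vp sX sY; rewrite /dform (bracket_anti Vp sX sY).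
rewrite (form1_vecZ _ sw Vp (bracket_tangent oV sX sY Vp)); ring.
Qed.

Lemma dform_diag X p : V p -> smooth_vfield V X -> dform w X X p = 0.
Proof.
move=> Vp sX; have /eqP := dform_anti Vp sX sX.
by rewrite -addr_eq0 -mulr2n mulrn_eq0 => /eqP.
Qed.

(** The derivatives of the coefficients in [X (w Y) - Y (w X)] cancel those in the
    bracket: [dform w] is bilinear over functions. *)
Lemma dform_combl a b X X' Y p : V p -> smooth_on V a -> smooth_on V b ->
  smooth_vfield V X -> smooth_vfield V X' -> smooth_vfield V Y ->
  dform w (fun q f => a q * X q f + b q * X' q f) Y p = a p * dform w X Y p + b p * dform w X' Y p.
Proof.
move=> Vp sa sb sX sX' sY; set XX := (fun q f => _).
have VV : V `<=` V by [].
have sXX : smooth_vfield V XX by exact: vfield_comb.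
have nV : \forall q \near p, V q by apply: open_nbhs_nbhs.
have tY := vfield_tangent sY Vp; have at_ g : smooth_on V g -> smooth_at p g by exact: smooth_at_on.
have wX : smooth_at p (fun q => w q (X q)) by apply/at_/(form1_smooth sw).
have wX' : smooth_at p (fun q => w q (X' q)) by apply/at_/(form1_smooth sw).
have E2 : Y p (fun q => w q (XX q)) = Y p a * w p (X p) + a p * Y p (fun q => w q (X q))
    + (Y p b * w p (X' p) + b p * Y p (fun q => w q (X' q))).
  rewrite -(tangent_leibniz tY (at_ _ sa) wX) -(tangent_leibniz tY (at_ _ sb) wX').
  rewrite -(tangentD tY); [|exact: (smooth_atM (at_ _ sa) wX)|exact: (smooth_atM (at_ _ sb) wX')].
  apply: (tangent_near tY); apply: filterS nV => q Vq.
  by rewrite /XX (form1_comb _ _ sw Vq (vfield_tangent sX Vq) (vfield_tangent sX' Vq)).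
have E3 : lie_bracket XX Y p = fun f => 1 * (a p * lie_bracket X Y p f + b p * lie_bracket X' Y p f)
    + (-1) * (Y p a * X p f + Y p b * X' p f).
  apply/funext => f; have [fp|fp] := pselect (smooth_at p f); last first.
    rewrite /lie_bracket !asboolF// !mulr0.
    by rewrite !(tangent_junk (vfield_tangent sX Vp))// !(tangent_junk (vfield_tangent sX' Vp))//; ring.
  rewrite !(bracketE _ _ fp) {1 2}/XX.
  have sXf := vfield_smooth_at oV sX Vp fp; have sXf' := vfield_smooth_at oV sX' Vp fp.
  rewrite (tangentD tY (smooth_atM (at_ _ sa) sXf) (smooth_atM (at_ _ sb) sXf')).
  rewrite (tangent_leibniz tY (at_ _ sa) sXf) (tangent_leibniz tY (at_ _ sb) sXf'); ring.
have tB := tangent_comb (a p) (b p) (bracket_tangent oV sX sY Vp) (bracket_tangent oV sX' sY Vp).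
have tC := tangent_comb (Y p a) (Y p b) (vfield_tangent sX Vp) (vfield_tangent sX' Vp).
rewrite /dform E2 E3 (form1_comb _ _ sw Vp tB tC).
rewrite (form1_comb _ _ sw Vp (bracket_tangent oV sX sY Vp) (bracket_tangent oV sX' sY Vp)).
rewrite (form1_comb _ _ sw Vp (vfield_tangent sX Vp) (vfield_tangent sX' Vp)) /XX; ring.
Qed.

Lemma dform_combr a b X Y Y' p : V p -> smooth_on V a -> smooth_on V b ->
  smooth_vfield V X -> smooth_vfield V Y -> smooth_vfield V Y' ->
  dform w X (fun q f => a q * Y q f + b q * Y' q f) p = a p * dform w X Y p + b p * dform w X Y' p.
Proof.
move=> Vp sa sb sX sY sY'; rewrite dform_anti//; last exact: vfield_comb.
by rewrite dform_combl// ![dform w _ X p]dform_anti//; ring.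
Qed.

Lemma dform_suml (I : Type) (s : seq I) (a : I -> func M) (X : I -> vfield M) Y p : V p ->
  (forall i, smooth_on V (a i)) -> (forall i, smooth_vfield V (X i)) -> smooth_vfield V Y ->
  smooth_vfield V (fun q f => \sum_(i <- s) a i q * X i q f) /\
  dform w (fun q f => \sum_(i <- s) a i q * X i q f) Y p = \sum_(i <- s) a i p * dform w (X i) Y p.
Proof.
move=> Vp sa sX sY; elim: s => [|i s [IH1 IH2]].
  have s0 : smooth_vfield V (fun (q : M) (f : func M) => 0 : C).
    split=> [q _|V' f oV' _ _]; first exact: tangent_vec0.
    exact: smooth_cst.
  rewrite (_ : (fun _ _ => _) = (fun _ _ => 0)); last by do 2!apply/funext => ?; rewrite big_nil.
  split=> //; rewrite big_nil.
  have s1 := @smooth_cst _ _ _ V (0 : C).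
  have := dform_combl Vp s1 s1 sY sY sY; rewrite !mul0r addr0; apply: etrans.
  by congr (dform w _ Y p); do 2!apply/funext => ?; rewrite !mul0r addr0.
have s1 := @smooth_cst _ _ _ V (1 : C).
rewrite (_ : (fun _ _ => _) = (fun q f => a i q * X i q f + 1 * (\sum_(j <- s) a j q * X j q f))); last first.
  by do 2!apply/funext => ?; rewrite big_cons mul1r.
split; first exact: vfield_comb.
by rewrite dform_combl// IH2 big_cons mul1r.
Qed.

End open.
End Forms.

(** * The structure functions of an admissible frame *)

Section FrameFunctions.
Variables (R : realType) (M : manifold R 3) (T Z : vfield M) (theta1 : form1 M).
Local Notation C := R[i].
Local Notation Y := (conj_field Z).

(** The brackets of the frame are
    [[Z, Y] = - i T + alpha Z - conj(alpha) Y] and [[T, Z] = beta Z + gamma Y]. *)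
Definition fr_alpha : func M := fun q => theta1 q (lie_bracket Z Y q).
Definition fr_beta : func M := fun q => theta1 q (lie_bracket T Z q).
Definition fr_gamma : func M := fun q => conj_form1 theta1 q (lie_bracket T Z q).

(** The values on [Y] and [T] are forced by the structure equation on [(Z, Y)] and
    [(T, Z)], and the value on [Z] by [omega] being imaginary. *)
Definition fr_omega (theta : form1 M) : form1 M := fun q v =>
  (fr_alpha q)^* * theta1 q v + - fr_alpha q * conj_form1 theta1 q v + fr_beta q * theta q v.

End FrameFunctions.

Section LinearCombinations.
Variables (R : realType) (n : nat) (M : manifold R n).
Local Notation C := R[i].
Implicit Types (U V : set M) (a b c : func M) (w : form1 M).

Lemma form1_comb_smooth U a b c (w w' w'' : form1 M) : open U ->
  smooth_on U a -> smooth_on U b -> smooth_on U c ->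
  smooth_form1 U w -> smooth_form1 U w' -> smooth_form1 U w'' ->
  smooth_form1 U (fun q v => a q * w q v + b q * w' q v + c q * w'' q v).
Proof.
move=> oU sa sb sc sw sw' sw''; split=> [p Up k v v' tv tv'|V X oV VU sX].
  rewrite (form1_linear sw Up k tv tv') (form1_linear sw' Up k tv tv').
  rewrite (form1_linear sw'' Up k tv tv'); ring.
have sub g : smooth_on U g -> smooth_on V g by exact: smooth_sub.
have sV w0 : smooth_form1 U w0 -> smooth_on V (fun q => w0 q (X q)).
  by move=> s0; apply: (form1_smooth s0).
by apply: smoothD => //; [apply: smoothD => //|]; apply: smoothM => //; [exact: sub|exact: sV|exact: sub|exact: sV|exact: sub|exact: sV].
Qed.

Lemma vfield_comb3 U a b c (X X' X'' : vfield M) : open U ->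
  smooth_on U a -> smooth_on U b -> smooth_on U c ->
  smooth_vfield U X -> smooth_vfield U X' -> smooth_vfield U X'' ->
  smooth_vfield U (fun q f => a q * X q f + b q * X' q f + c q * X'' q f).
Proof.
move=> oU sa sb sc sX sX' sX''; have s1 := @smooth_cst _ _ _ U (1 : C).
have := vfield_comb oU s1 sc (vfield_comb oU sa sb sX sX') sX''.
congr smooth_vfield; do 2!apply/funext => ?; by rewrite mul1r.
Qed.

Lemma derive_near_cst (p : M) (v : vec M) U (g : func M) (k : C) : open U -> U p -> tangent p v ->
  (forall q, U q -> g q = k) -> v g = 0.
Proof.
move=> oU Up tv gk; rewrite -(tangent_cst k tv); apply: (tangent_near tv).
have nU : \forall q \near p, U q by apply: open_nbhs_nbhs.
by apply: filterS nU => q /gk.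
Qed.

(** [dform w] is bilinear over functions and alternating, hence determined by its
    values on the pairs of a frame. *)
Lemma dform_span V w (w0 w1 w2 : form1 M) (E0 E1 E2 X X' : vfield M) p : open V -> V p ->
  smooth_form1 V w -> smooth_form1 V w0 -> smooth_form1 V w1 -> smooth_form1 V w2 ->
  smooth_vfield V E0 -> smooth_vfield V E1 -> smooth_vfield V E2 ->
  (forall q v, V q -> tangent q v ->
    v = fun f => w0 q v * E0 q f + w1 q v * E1 q f + w2 q v * E2 q f) ->
  smooth_vfield V X -> smooth_vfield V X' ->
  dform w X X' p =
    (w0 p (X p) * w1 p (X' p) - w1 p (X p) * w0 p (X' p)) * dform w E0 E1 p
    + (w0 p (X p) * w2 p (X' p) - w2 p (X p) * w0 p (X' p)) * dform w E0 E2 p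
    + (w1 p (X p) * w2 p (X' p) - w2 p (X p) * w1 p (X' p)) * dform w E1 E2 p.
Proof.
move=> oV Vp sw s0 s1 s2 sE0 sE1 sE2 span sX sX'.
have co w' X0 : smooth_form1 V w' -> smooth_vfield V X0 -> smooth_on V (fun q => w' q (X0 q)).
  by move=> sw' sX0; apply: (form1_smooth sw').
have sc := @smooth_cst _ _ _ V (1 : C).
pose ex (X0 : vfield M) : vfield M := fun q f =>
  1 * (w0 q (X0 q) * E0 q f + w1 q (X0 q) * E1 q f) + w2 q (X0 q) * E2 q f.
have exE X0 q : smooth_vfield V X0 -> V q -> X0 q = ex X0 q.
  move=> sX0 Vq; rewrite {1}(span _ _ Vq (vfield_tangent sX0 Vq)).
  by apply/funext => f; rewrite /ex mul1r.
rewrite (dform_local w oV Vp sX sX' (fun q => exE X q sX) (fun q => exE X' q sX')).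
have c0 X0 := co _ X0 s0; have c1 X0 := co _ X0 s1; have c2 X0 := co _ X0 s2.
have s01 X0 : smooth_vfield V X0 -> smooth_vfield V (fun q f => w0 q (X0 q) * E0 q f + w1 q (X0 q) * E1 q f).
  by move=> sX0; apply: vfield_comb => //; [exact: c0|exact: c1].
have sex : smooth_vfield V (ex X') by apply: vfield_comb => //; [exact: c2|exact: s01].
rewrite {1}/ex (dform_combl oV sw Vp sc (c2 _ sX) (s01 _ sX) sE2 sex).
rewrite (dform_combl oV sw Vp (c0 _ sX) (c1 _ sX) sE0 sE1 sex).
have r X0 : smooth_vfield V X0 -> dform w X0 (ex X') p =
    w0 p (X' p) * dform w X0 E0 p + w1 p (X' p) * dform w X0 E1 p + w2 p (X' p) * dform w X0 E2 p.
  move=> sX0; rewrite /ex (dform_combr oV sw Vp sc (c2 _ sX') sX0 (s01 _ sX') sE2).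
  by rewrite (dform_combr oV sw Vp (c0 _ sX') (c1 _ sX') sX0 sE0 sE1) mul1r.
rewrite !r// !(dform_diag oV sw Vp)//.
rewrite (dform_anti oV sw Vp sE0 sE1) (dform_anti oV sw Vp sE0 sE2) (dform_anti oV sw Vp sE1 sE2).
ring.
Qed.

End LinearCombinations.

Section Frame.
Variables (R : realType) (M : manifold R 3) (theta : form1 M) (J : M -> vec M -> vec M).
Variables (T : vfield M) (U : set M) (Z : vfield M) (theta1 : form1 M).
Local Notation C := R[i].
Hypothesis psh : pseudohermitian theta J.
Hypothesis reeb : reeb_field theta T.
Hypothesis fr : admissible_frame theta J T U Z theta1.

Local Notation Y := (conj_field Z).
Local Notation theta1b := (conj_form1 theta1).
Local Notation al := (fr_alpha Z theta1).
Local Notation be := (fr_beta T Z theta1).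
Local Notation ga := (fr_gamma T Z theta1).
Local Notation om := (fr_omega T Z theta1 theta).

Let oU : open U := frame_open fr.
Let sZ : smooth_vfield U Z := frame_Z1 fr.

Lemma frame_T_smooth : smooth_vfield U T.
Proof. by case: reeb => -[sT _] _ _; apply: vfield_sub sT. Qed.
Let sT := frame_T_smooth.

Lemma frame_Y_smooth : smooth_vfield U Y.
Proof. exact: vfield_conj. Qed.
Let sY := frame_Y_smooth.

Lemma reeb_real p : conjv (T p) = T p.
Proof. by case: reeb => -[_ rT] _ _; exact: rT. Qed.

Lemma frame_theta_smooth : smooth_form1 U theta.
Proof. by case: psh => -[s _ _] *; apply: form1_sub s. Qed.
Let sth := frame_theta_smooth.
Let sth1 : smooth_form1 U theta1 := frame_theta1 fr.
Let sth1b : smooth_form1 U theta1b := conj_form1_smooth oU sth1.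

Let tT p : U p -> tangent p (T p). Proof. exact: (vfield_tangent sT). Qed.
Let tZ p : U p -> tangent p (Z p). Proof. exact: (vfield_tangent sZ). Qed.
Let tY p : U p -> tangent p (Y p). Proof. exact: (vfield_tangent sY). Qed.

Lemma theta_conj p v : tangent p v -> theta p (conjv v) = (theta p v)^*.
Proof.
case: psh => -[_ rth _] _ _ _ _ _ _ tv.
by rewrite -(rth p (conjv v) I (tangent_conjv tv)) /conj_form1 conjvK.
Qed.

Lemma frame_values p : U p ->
  [/\ theta p (T p) = 1, theta p (Z p) = 0 & theta p (Y p) = 0] /\
  ([/\ theta1 p (T p) = 0, theta1 p (Z p) = 1 & theta1 p (Y p) = 0] /\
   [/\ theta1b p (T p) = 0, theta1b p (Z p) = 0 & theta1b p (Y p) = 1]).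
Proof.
move=> Up; have [d1 d2 d3] := frame_dual fr Up; have [_ hT _] := reeb.
split; first split=> //; first exact: (frame_xi fr).
  by rewrite theta_conj ?(frame_xi fr Up) ?conjc0//; exact: tZ.
split=> //; rewrite /conj_form1; split.
- by rewrite reeb_real d1 conjc0.
- by rewrite d3 conjc0.
- by rewrite /conj_field conjvK d2 conjc1.
Qed.

Let thT p : U p -> theta p (T p) = 1. Proof. by move=> /frame_values[[]]. Qed.
Let thZ p : U p -> theta p (Z p) = 0. Proof. by move=> /frame_values[[]]. Qed.
Let thY p : U p -> theta p (Y p) = 0. Proof. by move=> /frame_values[[]]. Qed.
Let t1T p : U p -> theta1 p (T p) = 0. Proof. by move=> /frame_values[_ [[]]]. Qed.
Let t1Z p : U p -> theta1 p (Z p) = 1. Proof. by move=> /frame_values[_ [[]]]. Qed.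
Let t1Y p : U p -> theta1 p (Y p) = 0. Proof. by move=> /frame_values[_ [[]]]. Qed.
Let tbT p : U p -> theta1b p (T p) = 0. Proof. by move=> /frame_values[_ [_ []]]. Qed.
Let tbZ p : U p -> theta1b p (Z p) = 0. Proof. by move=> /frame_values[_ [_ []]]. Qed.
Let tbY p : U p -> theta1b p (Y p) = 1. Proof. by move=> /frame_values[_ [_ []]]. Qed.

Lemma conj_T : conj_field T = T.
Proof. by apply/funext => p; exact: reeb_real. Qed.

Let UU : U `<=` U. Proof. by []. Qed.

Lemma dtheta_ZY p : U p -> dform theta Z Y p = 'i%C.
Proof.
move=> Up; rewrite (frame_normalized fr oU UU sZ sY Up) /scale_form2 /wedge.
by rewrite t1Z// tbY// t1Y// mul0r subr0 !mulr1.
Qed.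

(** The coefficient along [T] is read off from [d theta], and the one along [Y] follows
    because conjugation exchanges [Z] and [Y]. *)
Lemma bracket_ZY p : U p -> lie_bracket Z Y p = fun g =>
  - 'i%C * T p g + al p * Z p g + - (al p)^* * Y p g.
Proof.
move=> Up; have tB := bracket_tangent oU sZ sY Up.
rewrite {1}(frame_span fr Up tB).
have -> : theta p (lie_bracket Z Y p) = - 'i%C.
  rewrite -(dtheta_ZY Up) /dform (derive_near_cst oU Up (tZ Up) thY) (derive_near_cst oU Up (tY Up) thZ).
  by rewrite subrr sub0r opprK.
have -> // : theta1b p (lie_bracket Z Y p) = - (al p)^*.
rewrite /conj_form1 -bracket_conj conj_fieldK (bracket_anti Up sZ sY) (form1_vecZ _ sth1 Up tB).
by rewrite mulN1r rmorphN.
Qed.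

Lemma bracket_TZ p : U p -> lie_bracket T Z p = fun g => 0 * T p g + be p * Z p g + ga p * Y p g.
Proof.
move=> Up; have tB := bracket_tangent oU sT sZ Up.
rewrite {1}(frame_span fr Up tB).
have [_ _ dT] := reeb; have := dT U Z oU sZ p Up.
rewrite /dform (derive_near_cst oU Up (tT Up) thZ) (derive_near_cst oU Up (tZ Up) thT).
by rewrite subrr sub0r => /eqP; rewrite oppr_eq0 => /eqP ->.
Qed.

Lemma bracket_TY p : U p -> lie_bracket T Y p = fun g =>
  0 * T p g + (ga p)^* * Z p g + (be p)^* * Y p g.
Proof.
move=> Up; rewrite -[in LHS]conj_T bracket_conj bracket_TZ//; apply/funext => g.
have -> : conjv (fun g => 0 * T p g + be p * Z p g + ga p * Y p g) g
    = 0^* * conjv (T p) g + (be p)^* * conjv (Z p) g + (ga p)^* * conjv (Y p) g.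
  by rewrite /conjv !rmorphD !rmorphM.
rewrite reeb_real [conjv (Y p)]conjvK rmorph0 addrAC; congr (_ + _ + _).
Qed.

Lemma frame_alpha_smooth : smooth_on U al.
Proof. by apply: (form1_smooth sth1) => //; exact: bracket_smooth. Qed.

Lemma frame_beta_smooth : smooth_on U be.
Proof. by apply: (form1_smooth sth1) => //; exact: bracket_smooth. Qed.

Lemma frame_gamma_smooth : smooth_on U ga.
Proof. by apply: (form1_smooth sth1b) => //; exact: bracket_smooth. Qed.

Let sal := frame_alpha_smooth.
Let sbe := frame_beta_smooth.
Let sga := frame_gamma_smooth.

Lemma dform_frame V w X X' p : open V -> V `<=` U -> smooth_form1 U w ->
  smooth_vfield V X -> smooth_vfield V X' -> V p ->
  dform w X X' p =
    (theta p (X p) * theta1 p (X' p) - theta1 p (X p) * theta p (X' p)) * dform w T Z p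
    + (theta p (X p) * theta1b p (X' p) - theta1b p (X p) * theta p (X' p)) * dform w T Y p
    + (theta1 p (X p) * theta1b p (X' p) - theta1b p (X p) * theta1 p (X' p)) * dform w Z Y p.
Proof.
move=> oV VU sw sX sX' Vp.
apply: (dform_span oV Vp (form1_sub VU sw) (form1_sub VU sth) (form1_sub VU sth1)
  (form1_sub VU sth1b) (vfield_sub VU sT) (vfield_sub VU sZ) (vfield_sub VU sY) _ sX sX').
by move=> q v /VU Uq tv; exact: (frame_span fr Uq tv).
Qed.

Lemma frame_omega_smooth : smooth_form1 U om.
Proof.
apply: form1_comb_smooth => //; first exact: smooth_conj.
exact: smoothN.
Qed.

Lemma frame_structure_equation : eq_form2 U (dform theta1)
  (add_form2 (wedge theta1 om) (wedge theta (scale_form1 (fun q => - (ga q)^*) theta1b))).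
Proof.
move=> V X X' oV VU sX sX' p Vp; have Up := VU _ Vp.
rewrite (dform_frame oV VU sth1 sX sX' Vp).
have -> : dform theta1 T Z p = - be p.
  rewrite /dform (derive_near_cst oU Up (tT Up) t1Z) (derive_near_cst oU Up (tZ Up) t1T).
  by rewrite subrr sub0r.
have -> : dform theta1 T Y p = - (ga p)^*.
  rewrite /dform (derive_near_cst oU Up (tT Up) t1Y) (derive_near_cst oU Up (tY Up) t1T).
  rewrite subrr sub0r bracket_TY// (form1_comb3 _ _ _ sth1 Up (tT Up) (tZ Up) (tY Up)).
  by rewrite t1T// t1Z// t1Y// !mulr0 mulr1 addr0 add0r.
have -> : dform theta1 Z Y p = - al p.
  rewrite /dform (derive_near_cst oU Up (tZ Up) t1Y) (derive_near_cst oU Up (tY Up) t1Z).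
  by rewrite subrr sub0r.
rewrite /add_form2 /wedge /scale_form1 /fr_omega; ring.
Qed.

End Frame.

(** * Curvature, the Bianchi identity and the divergence *)

Section Conjugation.
Variable R : realType.
Implicit Types x y : R[i].

Lemma conjD x y : (x + y)^* = x^* + y^*. Proof. exact: rmorphD. Qed.
Lemma conjB x y : (x - y)^* = x^* - y^*. Proof. exact: rmorphB. Qed.
Lemma conjN x : (- x)^* = - x^*. Proof. exact: rmorphN. Qed.
Lemma conjM x y : (x * y)^* = x^* * y^*. Proof. exact: rmorphM. Qed.
Lemma conji : ('i%C : R[i])^* = - 'i%C.
Proof. by apply/eqP; rewrite eq_complex /= oppr0 !eqxx. Qed.

End Conjugation.

Section Der.
Variables (R : realType) (n : nat) (M : manifold R n) (p : M) (v : vec M).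
Hypothesis tv : tangent p v.
Implicit Types (g h : func M).

(** Pairing a value with smoothness lets derivatives of products be composed. *)
Definition der (w : vec M) g d := smooth_at p g /\ w g = d.

Lemma der_base g : smooth_at p g -> der v g (v g). Proof. by []. Qed.

Lemma der_cst k : der v (fun=> k) 0.
Proof. by split; [exact: smooth_at_cst|exact: (tangent_cst k tv)]. Qed.

Lemma derD g h d e : der v g d -> der v h e -> der v (fun q => g q + h q) (d + e).
Proof. by move=> [sg <-] [sh <-]; split; [exact: smooth_atD|rewrite (tangentD tv)]. Qed.

Lemma derN g d : der v g d -> der v (fun q => - g q) (- d).
Proof. by move=> [sg <-]; split; [exact: smooth_atN|rewrite (tangentN tv)]. Qed.

Lemma derM g h d e : der v g d -> der v h e -> der v (fun q => g q * h q) (d * h p + g p * e).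
Proof. by move=> [sg <-] [sh <-]; split; [exact: smooth_atM|rewrite (tangent_leibniz tv)]. Qed.

Lemma derZ k h e : der v h e -> der v (fun q => k * h q) (k * e).
Proof.
by move=> he; have [s E] := derM (der_cst k) he; split=> //; rewrite E mul0r add0r.
Qed.

Lemma der_on U g h d : open U -> U p -> (forall q, U q -> h q = g q) -> der v g d -> v h = d.
Proof.
move=> oU Up hg [_ <-]; apply: (tangent_near tv).
have nU : \forall q \near p, U q by apply: open_nbhs_nbhs.
by apply: filterS nU => q /hg.
Qed.

End Der.

Section Identities.
Variables (R : realType) (M : manifold R 3) (theta : form1 M) (J : M -> vec M -> vec M).
Variables (T : vfield M) (U : set M) (Z : vfield M) (theta1 : form1 M).
Local Notation C := R[i].
Hypothesis psh : pseudohermitian theta J.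
Hypothesis reeb : reeb_field theta T.
Hypothesis fr : admissible_frame theta J T U Z theta1.

Local Notation Y := (conj_field Z).
Local Notation theta1b := (conj_form1 theta1).
Local Notation al := (fr_alpha Z theta1).
Local Notation be := (fr_beta T Z theta1).
Local Notation ga := (fr_gamma T Z theta1).
Local Notation om := (fr_omega T Z theta1 theta).
Local Notation alb := (fun q => (al q)^*).
Local Notation beb := (fun q => (be q)^*).
Local Notation gab := (fun q => (ga q)^*).

Let oU : open U := frame_open fr.
Let sT : smooth_vfield U T := frame_T_smooth U reeb.
Let sZ : smooth_vfield U Z := frame_Z1 fr.
Let sY : smooth_vfield U Y := frame_Y_smooth fr.
Let sal : smooth_on U al := frame_alpha_smooth fr.
Let sbe : smooth_on U be := frame_beta_smooth reeb fr.
Let sga : smooth_on U ga := frame_gamma_smooth reeb fr.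
Let salb : smooth_on U alb := smooth_conj oU sal.
Let sbeb : smooth_on U beb := smooth_conj oU sbe.
Let sgab : smooth_on U gab := smooth_conj oU sga.
Let tT p (Up : U p) : tangent p (T p) := vfield_tangent sT Up.
Let tZ p (Up : U p) : tangent p (Z p) := vfield_tangent sZ Up.
Let tY p (Up : U p) : tangent p (Y p) := vfield_tangent sY Up.
Let UU : U `<=` U. Proof. by []. Qed.

Let on X g : smooth_vfield U X -> smooth_on U g -> smooth_on U (fun q => X q g).
Proof. by move=> sX; apply: (vfield_smooth sX). Qed.

Let at_ p g : U p -> smooth_on U g -> smooth_at p g.
Proof. exact: smooth_at_on. Qed.

Lemma comm_ZY p g : U p -> smooth_at p g ->
  Z p (fun q => Y q g) - Y p (fun q => Z q g) = - 'i%C * T p g + al p * Z p g + - (al p)^* * Y p g.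
Proof. by move=> Up gp; rewrite -(bracketE Z Y gp) (bracket_ZY psh reeb fr Up). Qed.

Lemma comm_TZ p g : U p -> smooth_at p g ->
  T p (fun q => Z q g) - Z p (fun q => T q g) = be p * Z p g + ga p * Y p g.
Proof. by move=> Up gp; rewrite -(bracketE T Z gp) (bracket_TZ psh reeb fr Up) mul0r add0r. Qed.

Lemma comm_TY p g : U p -> smooth_at p g ->
  T p (fun q => Y q g) - Y p (fun q => T q g) = (ga p)^* * Z p g + (be p)^* * Y p g.
Proof. by move=> Up gp; rewrite -(bracketE T Y gp) (bracket_TY psh reeb fr Up) mul0r add0r. Qed.

Lemma conj_Y p g : (Y p g)^* = Z p (fun q => (g q)^*).
Proof. by rewrite /conj_field /conjv conjcK. Qed.

Lemma conj_Tg p g : U p -> (T p g)^* = T p (fun q => (g q)^*).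
Proof. by move=> Up; rewrite (tangent_conj_eq _ (tT Up) (reeb_real reeb p)). Qed.

(** The components along [T] and [Z] of the Jacobi identity for the frame.  The
    component along [Y] is conjugate to the second one. *)
Lemma jacobi_frame p : U p -> be p + (be p)^* = 0 /\
  T p al = - (al p * be p) + (al p)^* * (ga p)^* - Y p be + Z p gab.
Proof.
move=> Up.
(* The components of the Jacobi identity along [T], [Z] and [Y]. *)
pose c0 := - 'i%C * (be p + (be p)^*).
pose c1 := Z p gab - Y p be - T p al - al p * be p + (al p)^* * (ga p)^* + (be p + (be p)^*) * al p.
pose c2 := Z p beb - Y p ga + T p alb - al p * ga p + (al p)^* * (be p)^* - (be p + (be p)^*) * (al p)^*.
have vec0 : (fun g => c0 * T p g + c1 * Z p g + c2 * Y p g) = (fun=> 0).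
  apply/funext => g; have [gp|gp] := pselect (smooth_at p g); last first.
    by rewrite (tangent_junk (tT Up) gp) (tangent_junk (tZ Up) gp) (tangent_junk (tY Up) gp) !mulr0 !addr0.
  have [V0 [oV0 V0p gV0]] := gp; pose V := U `&` V0.
  have oV : open V by exact: openI.
  have Vp : V p by [].
  have gV : smooth_on V g by apply: smooth_sub gV0 => q [].
  have VU : V `<=` U by move=> q [].
  have ons X h : smooth_vfield U X -> smooth_on V h -> smooth_on V (fun q => X q h).
    by move=> sX; apply: (vfield_smooth sX).
  have atV h q : V q -> smooth_on V h -> smooth_at q h by exact: smooth_at_on.
  have b X h : smooth_vfield U X -> smooth_on V h -> der p (X p) h (X p h).
    by move=> sX sh; apply: der_base; exact: (atV _ _ Vp).
  have bU X h : smooth_vfield U X -> smooth_on U h -> der p (X p) h (X p h).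
    by move=> sX sh; apply: der_base; exact: at_.
  have A1 := der_on (tT Up) oV Vp (fun q (Vq : V q) => comm_ZY (VU _ Vq) (atV _ _ Vq gV))
    (derD (tT Up) (derD (tT Up) (derZ (tT Up) (- 'i%C) (b T _ sT (ons _ _ sT gV)))
      (derM (tT Up) (bU T _ sT sal) (b T _ sT (ons _ _ sZ gV))))
      (derM (tT Up) (derN (tT Up) (bU T _ sT salb)) (b T _ sT (ons _ _ sY gV)))).
  have A2 := der_on (tZ Up) oV Vp (fun q (Vq : V q) => comm_TY (VU _ Vq) (atV _ _ Vq gV))
    (derD (tZ Up) (derM (tZ Up) (bU Z _ sZ sgab) (b Z _ sZ (ons _ _ sZ gV)))
      (derM (tZ Up) (bU Z _ sZ sbeb) (b Z _ sZ (ons _ _ sY gV)))).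
  have A3 := der_on (tY Up) oV Vp (fun q (Vq : V q) => comm_TZ (VU _ Vq) (atV _ _ Vq gV))
    (derD (tY Up) (derM (tY Up) (bU Y _ sY sbe) (b Y _ sY (ons _ _ sZ gV)))
      (derM (tY Up) (bU Y _ sY sga) (b Y _ sY (ons _ _ sY gV)))).
  have dB X Y1 Z1 Y2 Z2 : smooth_vfield U X -> smooth_vfield U Y1 -> smooth_vfield U Z1 ->
      smooth_vfield U Y2 -> smooth_vfield U Z2 ->
      X p (fun q => Y1 q (fun r => Z1 r g) - Y2 q (fun r => Z2 r g))
      = X p (fun q => Y1 q (fun r => Z1 r g)) - X p (fun q => Y2 q (fun r => Z2 r g)).
    move=> sX sY1 sZ1 sY2 sZ2.
    have tX := vfield_tangent sX Up.
    by rewrite (tangentB tX)//; apply: (atV _ _ Vp); apply: (ons) => //; exact: ons.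
  rewrite (dB T Z Y Y Z)// in A1; rewrite (dB Z T Y Y T)// in A2; rewrite (dB Y T Z Z T)// in A3.
  have B1 := comm_ZY Up (atV _ _ Vp (ons _ _ sT gV)).
  have B2 := comm_TZ Up (atV _ _ Vp (ons _ _ sY gV)).
  have B3 := comm_TY Up (atV _ _ Vp (ons _ _ sZ gV)).
  have C1 := comm_ZY Up gp; have C2 := comm_TZ Up gp; have C3 := comm_TY Up gp.
  rewrite /c0 /c1 /c2.
  move: A1 A2 A3 B1 B2 B3 C1 C2 C3.
  move: (T p (fun q => Z q (fun r => Y r g))) (T p (fun q => Y q (fun r => Z r g))) => TZY TYZ.
  move: (Z p (fun q => T q (fun r => Y r g))) (Z p (fun q => Y q (fun r => T r g))) => ZTY ZYT.
  move: (Y p (fun q => T q (fun r => Z r g))) (Y p (fun q => Z q (fun r => T r g))) => YTZ YZT.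
  move: (T p (fun q => T q g)) (T p (fun q => Z q g)) (T p (fun q => Y q g)) => TT TZ TY.
  move: (Z p (fun q => T q g)) (Z p (fun q => Z q g)) (Z p (fun q => Y q g)) => ZT ZZ ZY.
  move: (Y p (fun q => T q g)) (Y p (fun q => Z q g)) (Y p (fun q => Y q g)) => YT YZ YY.
  move: (T p g) (Z p g) (Y p g) (T p al) (T p alb) (Z p beb) (Z p gab) (Y p be) (Y p ga) => Tg Zg Yg Ta Tab Zbb Zgb Yb Yga.
  move: (al p) (be p) (ga p) ((al p)^*) ((be p)^*) ((ga p)^*) ('i%C : C) => a b0 c a' b' c' ii.
  move=> A1 A2 A3 B1 B2 B3 C1 C2 C3.
  have s0 (x y : C) : x = y -> x - y = 0 by move=> ->; rewrite subrr.
  (* The iterated derivatives of [g] cancel. *)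
  transitivity (((TZY - TYZ) - (- ii * TT + (Ta * Zg + a * TZ) + (- Tab * Yg + - a' * TY)))
    - ((ZTY - ZYT) - (Zgb * Zg + c' * ZZ + (Zbb * Yg + b' * ZY)))
    + ((YTZ - YZT) - (Yb * Zg + b0 * YZ + (Yga * Yg + c * YY)))
    - ((ZYT - YZT) - (- ii * TT + a * ZT + - a' * YT))
    - ((TZY - ZTY) - (b0 * ZY + c * YY)) + ((TYZ - YTZ) - (c' * ZZ + b' * YZ))
    - (b0 + b') * ((ZY - YZ) - (- ii * Tg + a * Zg + - a' * Yg))
    + a * ((TZ - ZT) - (b0 * Zg + c * Yg)) - a' * ((TY - YT) - (c' * Zg + b' * Yg))); first by ring.
  by rewrite (s0 _ _ A1) (s0 _ _ A2) (s0 _ _ A3) (s0 _ _ B1) (s0 _ _ B2) (s0 _ _ B3) (s0 _ _ C1) (s0 _ _ C2) (s0 _ _ C3); ring.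
have [[thT thZ thY] [[t1T t1Z t1Y] _]] := frame_values psh reeb fr Up.
have sth := frame_theta_smooth U psh.
have sth1 := frame_theta1 fr.
have := form1_comb3 c0 c1 c2 sth Up (tT Up) (tZ Up) (tY Up).
rewrite vec0 (form1_vec0 sth Up) thT thZ thY !mulr0 mulr1 !addr0 => /esym/eqP.
rewrite /c0 mulf_eq0 oppr_eq0 => /orP[|/eqP bb]; first by rewrite eq_complex /= oner_eq0 andbF.
split=> //; have := form1_comb3 c0 c1 c2 sth1 Up (tT Up) (tZ Up) (tY Up).
rewrite vec0 (form1_vec0 sth1 Up) t1T t1Z t1Y !mulr0 mulr1 addr0 add0r /c1 bb mul0r addr0.
move=> /esym/eqP; rewrite addrAC -addrA => E.
by apply/eqP; rewrite -subr_eq0 -oppr_eq0; move: E; congr (_ == _); ring.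
Qed.

Lemma frame_beta_conj p : U p -> (be p)^* = - be p.
Proof. by move=> /jacobi_frame[/eqP]; rewrite addrC addr_eq0 => /eqP. Qed.

Lemma T_alpha p : U p -> T p al = - (al p * be p) + (al p)^* * (ga p)^* - Y p be + Z p gab.
Proof. by move=> /jacobi_frame[]. Qed.

Lemma T_alphab p : U p -> T p alb = (al p)^* * be p + al p * ga p + Z p be + Y p ga.
Proof.
move=> Up; rewrite -(conj_Tg al Up) (T_alpha Up) !conjD !conjN !conjM conj_Y.
have -> : (Z p gab)^* = Y p ga by [].
rewrite (der_on (tZ Up) oU Up frame_beta_conj (derN (tZ Up) (der_base (Z p) (at_ Up sbe)))).
rewrite !conjcK [(be p)^*]frame_beta_conj//; ring.
Qed.

Definition fr_torsion : func M := fun q => - (ga q)^*.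

Lemma frame_connection : connection_torsion theta U theta1 om fr_torsion.
Proof.
split.
- exact: (frame_omega_smooth psh reeb fr).
- move=> p v Up tv; rewrite /conj_form1 /fr_omega (theta_conj psh tv) /conj_form1 conjvK.
  by rewrite !conjD !conjM conjN !conjcK frame_beta_conj//; ring.
- exact: smoothN.
- exact: (frame_structure_equation psh reeb fr).
Qed.

(** On [Z] and [Y] the torsion terms of [d omega] drop out, as they contain [theta]. *)
Lemma webster_frame (W : M -> R) p : webster_curvature theta J T W -> U p ->
  (W p)%:C = - Z p al - Y p alb + 'i%C * be p - 2%:R * (al p * (al p)^*).
Proof.
move=> web Up; have := web _ _ _ _ _ fr frame_connection _ _ _ oU UU sZ sY p Up.
have omv q : U q -> [/\ om q (T q) = be q, om q (Z q) = (al q)^* & om q (Y q) = - al q].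
  move=> Uq; have [[thT thZ thY] [[t1T t1Z t1Y] [tbT tbZ tbY]]] := frame_values psh reeb fr Uq.
  by rewrite /fr_omega thT thZ thY t1T t1Z t1Y tbT tbZ tbY !mulr0 !mulr1 !addr0 !add0r.
have omY q : U q -> om q (Y q) = - al q by move=> /omv[].
have omZ q : U q -> om q (Z q) = (al q)^* by move=> /omv[].
have [oT oZ oY] := omv p Up.
have som := frame_omega_smooth psh reeb fr.
rewrite {1}/dform (bracket_ZY psh reeb fr Up) (form1_comb3 _ _ _ som Up (tT Up) (tZ Up) (tY Up)).
rewrite (der_on (tZ Up) oU Up omY (derN (tZ Up) (der_base (Z p) (at_ Up sal)))).
rewrite (der_on (tY Up) oU Up omZ (der_base (Y p) (at_ Up salb))) oT oZ oY.
have [[thT thZ thY] [[t1T t1Z t1Y] [tbT tbZ tbY]]] := frame_values psh reeb fr Up.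
rewrite /add_form2 /scale_form2 /im_form2 /wedge conj_fieldK thZ thY t1Z t1Y tbZ tbY.
rewrite !(mulr0, mul0r, mulr1, subr0, sub0r, oppr0, conjc0, addr0).
move=> <-; ring.
Qed.

(** This is [A_{11,1bar}], as [A_11 = - gamma] and [omega(Y) = - alpha]. *)
Definition fr_E : func M := fun q => - (Y q ga + 2%:R * (al q * ga q)).
Local Notation E := fr_E.

Lemma fr_E_smooth : smooth_on U E.
Proof.
apply: smoothN => //; apply: smoothD => //; first exact: on.
by apply: smoothM => //; [exact: smooth_cst|exact: smoothM].
Qed.

(** The contracted Bianchi identity; it is the compatibility of the Jacobi
    identity with the expression of [W] by the structure functions. *)
Lemma bianchi (W : M -> R) p : webster_curvature theta J T W -> U p ->
  T p (cfun W) = (Y p E + al p * E p) + (Y p E + al p * E p)^*.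
Proof.
move=> web Up; have b X h : smooth_vfield U X -> smooth_on U h -> der p (X p) h (X p h).
  by move=> sX sh; apply: der_base; exact: at_.
have Yal := on sY sal.
have Zal := on sZ sal.
have ZTa := der_on (tZ Up) oU Up (fun q Uq => T_alpha Uq)
  (derD (tZ Up) (derD (tZ Up) (derD (tZ Up) (derN (tZ Up) (derM (tZ Up) (b Z _ sZ sal) (b Z _ sZ sbe)))
     (derM (tZ Up) (b Z _ sZ salb) (b Z _ sZ sgab)))
     (derN (tZ Up) (b Z _ sZ (on sY sbe)))) (b Z _ sZ (on sZ sgab))).
have YTa := der_on (tY Up) oU Up (fun q Uq => T_alphab Uq)
  (derD (tY Up) (derD (tY Up) (derD (tY Up) (derM (tY Up) (b Y _ sY salb) (b Y _ sY sbe))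
     (derM (tY Up) (b Y _ sY sal) (b Y _ sY sga)))
     (b Y _ sY (on sZ sbe))) (b Y _ sY (on sY sga))).
have TW := der_on (tT Up) oU Up (fun q Uq => webster_frame web Uq)
  (derD (tT Up) (derD (tT Up) (derD (tT Up) (derN (tT Up) (b T _ sT Zal)) (derN (tT Up) (b T _ sT (on sY salb))))
    (derZ (tT Up) 'i%C (b T _ sT sbe)))
    (derN (tT Up) (derZ (tT Up) 2%:R (derM (tT Up) (b T _ sT sal) (b T _ sT salb))))).
have [_ YE] := derN (tY Up) (derD (tY Up) (b Y _ sY (on sY sga))
    (derZ (tY Up) 2%:R (derM (tY Up) (b Y _ sY sal) (b Y _ sY sga)))).
have Ebar q : (E q)^* = - (Z q gab + 2%:R * ((al q)^* * (ga q)^*)).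
  by rewrite /fr_E conjN conjD !conjM conj_Y conjc_nat.
have [_ ZE] := derN (tZ Up) (derD (tZ Up) (b Z _ sZ (on sZ sgab))
    (derZ (tZ Up) 2%:R (derM (tZ Up) (b Z _ sZ salb) (b Z _ sZ sgab)))).
have C1 := comm_TZ Up (at_ Up sal); have C2 := comm_TY Up (at_ Up salb).
have C3 := comm_ZY Up (at_ Up sbe).
rewrite conjD conjM Ebar (conj_Y p E) (_ : (fun q => (E q)^*) = fun q => - (Z q gab + 2%:R * ((al q)^* * (ga q)^*))); last exact/funext.
rewrite ZE YE /fr_E /cfun TW (T_alpha Up) (T_alphab Up).
move: C1 C2 C3; rewrite ZTa YTa (frame_beta_conj Up).
move: (T p (fun q => Z q al)) (T p (fun q => Y q alb)) => TZa TYa.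
move: (Z p (fun q => Y q be)) (Y p (fun q => Z q be)) => ZYb YZb.
move: (Z p (fun q => Z q gab)) (Y p (fun q => Y q ga)) => ZZg YYg.
move: (T p be) (Z p al) (Y p al) (Z p alb) (Y p alb) (Z p be) (Y p be) (Z p ga) (Y p ga) (Z p gab) => Tb Za Ya Zab Yab Zb Yb Zg Yg Zgb.
move: (al p) (be p) (ga p) ((al p)^*) ((ga p)^*) ('i%C : C) => a b0 c a' c' ii C1 C2 C3.
have s0 (x y : C) : x = y -> x - y = 0 by move=> ->; rewrite subrr.
apply/eqP; rewrite -subr_eq0; apply/eqP.
transitivity (- (TZa - (- (Za * b0 + a * Zb) + (Zab * c' + a' * Zgb) - ZYb + ZZg) - (b0 * Za + c * Ya))
  - (TYa - (Yab * b0 + a' * Yb + (Ya * c + a * Yg) + YZb + YYg) - (c' * Zab + - b0 * Yab))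
  + (ZYb - YZb - (- ii * Tb + a * Zb + - a' * Yb))); first by ring.
by rewrite (s0 _ _ C1) (s0 _ _ C2) (s0 _ _ C3); ring.
Qed.

(** ** The divergence identity *)

Variables (W f : M -> R) (mu : R).
Hypothesis web : webster_curvature theta J T W.
Hypothesis sF : smooth_on U (cfun f).
Hypothesis curv : forall p, (W p)%:C + 2%:R^-1 * d0 T f p = mu%:C.
Hypothesis hess : forall p, U p -> d11 Z om f p + 'i%C * A11 fr_torsion p * (f p)%:C = 0.
Local Notation F := (cfun f).

(** This is [f A_{11,1bar} - A_11 f_1bar]. *)
Definition fr_B : func M := fun q => F q * E q + ga q * Y q F.

Lemma fr_B_smooth : smooth_on U fr_B.
Proof.
by apply: smoothD => //; apply: smoothM => //; [exact: fr_E_smooth|exact: on].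
Qed.

Lemma W_smooth : smooth_on U (cfun W).
Proof.
apply: (@smooth_eq _ _ _ _ (fun p => mu%:C - 2%:R^-1 * T p F)) => //.
  by move=> p _; rewrite -(curv p) addrK.
by apply: smoothB => //; [exact: smooth_cst|exact: (smoothM oU (@smooth_cst _ _ _ U (2%:R^-1 : C)) (on sT sF))].
Qed.

Lemma hessian_YY p : U p -> Y p (fun q => Y q F) = al p * Y p F - 'i%C * (ga p)^* * F p.
Proof.
move=> Up; have := hess Up; rewrite /d11 /A11 /fr_torsion conjN (conjcK (ga p)).
have [[thT thZ thY] [[t1T t1Z t1Y] [tbT tbZ tbY]]] := frame_values psh reeb fr Up.
rewrite /fr_omega thZ t1Z tbZ !mulr0 mulr1 !addr0 => /eqP.
rewrite mulrN mulNr subr_eq0 subr_eq => /eqP H.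
have Fr : (fun q => (F q)^*) = F by apply/funext => q; exact: conjc_real.
have ZF q : (Z q F)^* = Y q F by rewrite /conj_field /conjv Fr.
have -> : Y p (fun q => Y q F) = (Z p (fun q => Z q F))^*.
  rewrite {1}/conj_field /conjv; congr (_^* ); congr (Z p _); apply/funext => q.
  by rewrite -ZF conjcK.
rewrite H conjD !conjM ZF (conjcK (al p)) [(F p)^*]conjc_real.
rewrite conji; ring.
Qed.

(** The left-hand side is the divergence of [(mu f - f W) T + B Y + conj(B) Z], since [T]
    has divergence zero and that of [Y] is [alpha].  By the Hessian equation
    [Y B + alpha B] is [f (Y E + alpha E)] plus an imaginary multiple of [f], and the
    Bianchi identity cancels [f W_0]. *)
Lemma divergence_identity p : U p ->
  T p (fun q => mu%:C * F q - F q * (W q)%:C)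
    + (Y p fr_B + al p * fr_B p) + (Y p fr_B + al p * fr_B p)^*
  = 2%:R^-1 * (T p F * T p F).
Proof.
move=> Up; have b X h : smooth_vfield U X -> smooth_on U h -> der p (X p) h (X p h).
  by move=> sX sh; apply: der_base; exact: at_.
have sE := fr_E_smooth.
have YB : Y p fr_B + al p * fr_B p = F p * (Y p E + al p * E p) - 'i%C * (ga p * (ga p)^*) * F p.
  have [_ ->] := derD (tY Up) (derM (tY Up) (b Y _ sY sF) (b Y _ sY sE))
     (derM (tY Up) (b Y _ sY sga) (b Y _ sY (on sY sF))).
  rewrite hessian_YY// /fr_B /fr_E; ring.
have Fr : ((f p)%:C)^* = (f p)%:C by exact: conjc_real.
have [_ ->] := derD (tT Up) (derZ (tT Up) mu%:C (b T _ sT sF))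
   (derN (tT Up) (derM (tT Up) (b T _ sT sF) (b T _ sT W_smooth))).
rewrite (bianchi web Up) YB -(curv p) /d0 /cfun.
set S := Y p E + al p * E p.
rewrite conjB !conjM conji (conjcK (ga p)) Fr.
by move: (S^* ) (T p _) => S' t; field.
Qed.

End Identities.

(** * The volume density *)

Section DetAlgebra.
Variable K : comPzRingType.
Implicit Types (u v w a b : 'I_3 -> K).

(** The determinants of dual bases are inverse to each other. *)
Lemma det3r_dual a0 a1 a2 u v w :
  \sum_j a0 j * u j = 1 -> \sum_j a0 j * v j = 0 -> \sum_j a0 j * w j = 0 ->
  \sum_j a1 j * u j = 0 -> \sum_j a1 j * v j = 1 -> \sum_j a1 j * w j = 0 ->
  \sum_j a2 j * u j = 0 -> \sum_j a2 j * v j = 0 -> \sum_j a2 j * w j = 1 ->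
  det3r a0 a1 a2 * det3r u v w = 1.
Proof.
move=> s0u s0v s0w s1u s1v s1w s2u s2v s2w.
transitivity (
  (\sum_j a0 j * u j) * ((\sum_j a1 j * v j) * (\sum_j a2 j * w j) - (\sum_j a1 j * w j) * (\sum_j a2 j * v j))
  - (\sum_j a0 j * v j) * ((\sum_j a1 j * u j) * (\sum_j a2 j * w j) - (\sum_j a1 j * w j) * (\sum_j a2 j * u j))
  + (\sum_j a0 j * w j) * ((\sum_j a1 j * u j) * (\sum_j a2 j * v j) - (\sum_j a1 j * v j) * (\sum_j a2 j * u j))).
  rewrite !sum3 /det3r; ring.
rewrite s0u s0v s0w s1u s1v s1w s2u s2v s2w; ring.
Qed.

(** The derivative of a determinant under the linear action of [D] on its rows. *)
Lemma det3r_trace a0 a1 a2 (D : 'I_3 -> 'I_3 -> K) :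
  det3r (fun j => \sum_i a0 i * D i j) a1 a2 + det3r a0 (fun j => \sum_i a1 i * D i j) a2
    + det3r a0 a1 (fun j => \sum_i a2 i * D i j) = (\sum_j D j j) * det3r a0 a1 a2.
Proof. rewrite /det3r !sum3; ring. Qed.

Lemma det3r_add a0 a1 a2 r0 r1 r2 s0 s1 s2 :
  det3r (fun j => r0 j + s0 j) a1 a2 + det3r a0 (fun j => r1 j + s1 j) a2
    + det3r a0 a1 (fun j => r2 j + s2 j)
  = (det3r r0 a1 a2 + det3r a0 r1 a2 + det3r a0 a1 r2)
    + (det3r s0 a1 a2 + det3r a0 s1 a2 + det3r a0 a1 s2).
Proof. rewrite /det3r; ring. Qed.

Lemma det3r_comb a0 a1 a2 (k0 k1 k2 l0 l1 l2 m0 m1 m2 : K) :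
  det3r (fun j => k0 * a0 j + k1 * a1 j + k2 * a2 j) a1 a2
    + det3r a0 (fun j => l0 * a0 j + l1 * a1 j + l2 * a2 j) a2
    + det3r a0 a1 (fun j => m0 * a0 j + m1 * a1 j + m2 * a2 j)
  = (k0 + l1 + m2) * det3r a0 a1 a2.
Proof. rewrite /det3r; ring. Qed.

Lemma eq_det3r a0 a1 a2 b0 b1 b2 : (forall j, a0 j = b0 j) -> (forall j, a1 j = b1 j) ->
  (forall j, a2 j = b2 j) -> det3r a0 a1 a2 = det3r b0 b1 b2.
Proof. by move=> e0 e1 e2; rewrite /det3r !e0 !e1 !e2. Qed.

Lemma wedge_change (b : 'I_3 -> 'I_3 -> K) t (d : 'I_3 -> 'I_3 -> K) :
  (forall k, d k k = 0) -> (forall k l, d l k = - d k l) ->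
  (\sum_j b o0 j * t j) * (\sum_k b o1 k * \sum_l b o2 l * d k l)
    - (\sum_j b o1 j * t j) * (\sum_k b o0 k * \sum_l b o2 l * d k l)
    + (\sum_j b o2 j * t j) * (\sum_k b o0 k * \sum_l b o1 l * d k l)
  = (t o0 * d o1 o2 - t o1 * d o0 o2 + t o2 * d o0 o1) * det3 b.
Proof.
move=> d0 dN; rewrite !sum3 !d0 (dN o0 o1) (dN o0 o2) (dN o1 o2) /det3 /det3r; ring.
Qed.

End DetAlgebra.

Lemma det3_realC (R : realType) (a : 'I_3 -> 'I_3 -> R) :
  (det3 a)%:C = det3 (fun i j => (a i j)%:C).
Proof.
rewrite /det3 /det3r.
move: (a o0 o0) (a o0 o1) (a o0 o2) (a o1 o0) (a o1 o1) (a o1 o2) (a o2 o0) (a o2 o1) (a o2 o2) => *.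
by apply/eqP; rewrite eq_complex /=; apply/andP; split; apply/eqP; ring.
Qed.

Lemma partialE (R : realType) (n : nat) (M : manifold R n) (c : chart R n M) j p f : smooth_at p f ->
  partial c j p f = Complex ('D_'e_j (fun x => 're (f (cinv c x))) (cmap c p))
    ('D_'e_j (fun x => 'im (f (cinv c x))) (cmap c p)).
Proof. by move=> fp; rewrite /partial asboolT. Qed.

Opaque o0 o1 o2 partial.

Section DerDet.
Variables (R : realType) (n : nat) (M : manifold R n) (p : M) (X : vec M).
Hypothesis tX : tangent p X.

Lemma der_det3r (u v w : 'I_3 -> func M) (du dv dw : 'I_3 -> R[i]) :
  (forall j, der p X (u j) (du j)) -> (forall j, der p X (v j) (dv j)) ->
  (forall j, der p X (w j) (dw j)) ->
  der p X (fun q => det3r (u^~ q) (v^~ q) (w^~ q))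
    (det3r du (v^~ p) (w^~ p) + det3r (u^~ p) dv (w^~ p) + det3r (u^~ p) (v^~ p) dw).
Proof.
move=> hu hv hw; rewrite /det3r.
have minor i j := derD tX (derM tX (hv i) (hw j)) (derN tX (derM tX (hv j) (hw i))).
have [s E] := derD tX (derD tX (derM tX (hu o0) (minor o1 o2))
    (derN tX (derM tX (hu o1) (minor o0 o2)))) (derM tX (hu o2) (minor o0 o1)).
split=> //; rewrite E; ring.
Qed.

End DerDet.

Lemma imag_neq0 (R : realType) : ('i%C : R[i]) != 0.
Proof. by rewrite eq_complex /= oner_eq0 andbF. Qed.

Section Volume.
Variables (R : realType) (M : manifold R 3) (theta : form1 M) (J : M -> vec M -> vec M).
Variable T : vfield M.
Local Notation C := R[i].
Hypothesis psh : pseudohermitian theta J.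
Hypothesis reeb : reeb_field theta T.
Implicit Types (c d : chart R 3 M) (q : M).

(** The coefficient of [theta /\ d theta] in the coordinates of [c]. *)
Definition vol c : func M :=
  wedge12 theta (dform theta) (partial c o0) (partial c o1) (partial c o2).

Let sth : smooth_form1 setT theta. Proof. by case: psh => -[]. Qed.
Let rth : real_form1 setT theta. Proof. by case: psh => -[]. Qed.

Let sthc c : smooth_form1 (cdom c) theta. Proof. exact: form1_sub sth. Qed.
Let oc c : open (cdom c). Proof. exact: cdom_open. Qed.

Lemma vol_smooth c : atlas c -> smooth_on (cdom c) (vol c).
Proof.
move=> ac; have sp j := partial_smooth ac j.
have sf j : smooth_on (cdom c) (fun q => theta q (partial c j q)).
  by apply: (form1_smooth (sthc c)).
have sd i j := dform_smooth (oc c) (sthc c) (sp i) (sp j).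
exact: (smoothD (oc c) (smoothB (oc c) (smoothM (oc c) (sf o0) (sd o1 o2))
  (smoothM (oc c) (sf o1) (sd o0 o2))) (smoothM (oc c) (sf o2) (sd o0 o1))).
Qed.

Lemma dform_real V X Y p : open V -> V p -> smooth_vfield V X -> smooth_vfield V Y ->
  (forall q, V q -> conjv (X q) = X q) -> (forall q, V q -> conjv (Y q) = Y q) ->
  (dform theta X Y p)^* = dform theta X Y p.
Proof.
move=> oV Vp sX sY rX rY.
rewrite {1}(dform_local theta oV Vp sX sY (fun q Vq => esym (rX q Vq)) (fun q Vq => esym (rY q Vq))).
rewrite -(conj_dform theta X Y p); apply: (dform_form_local oV Vp sX sY) => q v _.
exact: rth.
Qed.

Lemma vol_conj c q : atlas c -> cdom c q -> (vol c q)^* = vol c q.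
Proof.
move=> ac cq; have sp j := partial_smooth ac j.
have rp j p : cdom c p -> conjv (partial c j p) = partial c j p by exact: partial_conj.
have rf j : (theta q (partial c j q))^* = theta q (partial c j q).
  by rewrite -(theta_conj psh (vfield_tangent (sp j) cq)) rp.
have dd i j : (dform theta (partial c i) (partial c j) q)^* = dform theta (partial c i) (partial c j) q.
  exact: (dform_real (oc c) cq (sp i) (sp j) (rp i) (rp j)).
have comb (x y z x' y' z' : C) : x^* = x -> y^* = y -> z^* = z -> x'^* = x' -> y'^* = y' -> z'^* = z' ->
    (x * x' - y * y' + z * z')^* = x * x' - y * y' + z * z'.
  by move=> ex ey ez ex' ey' ez'; rewrite conjD conjB !conjM ex ey ez ex' ey' ez'.
exact: (comb _ _ _ _ _ _ (rf o0) (rf o1) (rf o2) (dd o1 o2) (dd o0 o2) (dd o0 o1)).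
Qed.

Lemma vol_change c d q : atlas c -> atlas d -> cdom c q -> cdom d q ->
  vol c q = vol d q * (jac (fun x => cmap d (cinv c x)) (cmap c q))%:C.
Proof.
move=> ac ad cq dq; pose V := cdom c `&` cdom d.
have oV : open V by exact: openI.
have Vq : V q by [].
have Vc : V `<=` cdom c by move=> ? [].
have Vd : V `<=` cdom d by move=> ? [].
have sc j := vfield_sub Vc (partial_smooth ac j).
have sd j := vfield_sub Vd (partial_smooth ad j).
have sthV := form1_sub Vc (sthc c).
pose b i j : func M := fun r => partial c i r (coordf d j).
have sb i j : smooth_on V (b i j).
  by apply: (vfield_smooth (sc i)) => //; apply: smooth_sub (smooth_coord j ad).
pose pd i : vfield M := fun r g => \sum_j b i j r * partial d j r g.
have E i r : V r -> partial c i r = pd i r.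
  by move=> [cr dr]; rewrite /pd /b {1}(tangent_expand ad dr (partial_tangent ac i cr)).
have F1 i : theta q (partial c i q) = \sum_j b i j q * theta q (partial d j q).
  rewrite E// /pd (form1_sum _ _ sthV Vq) // => j; exact: (vfield_tangent (sd j) Vq).
have dE i j : dform theta (partial c i) (partial c j) q
    = \sum_k b i k q * \sum_l b j l q * dform theta (partial d k) (partial d l) q.
  have [si _] := dform_suml oV sthV (index_enum 'I_3) Vq (sb i) sd (sc j).
  have [sj _] := dform_suml oV sthV (index_enum 'I_3) Vq (sb j) sd (sc j).
  rewrite (dform_local theta oV Vq (sc i) (sc j) (E i) (E j)).
  have [_ ->] := dform_suml oV sthV (index_enum 'I_3) Vq (sb i) sd sj.
  apply: eq_bigr => k _; congr (_ * _).
  rewrite (dform_anti oV sthV Vq sj (sd k)).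
  have [_ ->] := dform_suml oV sthV (index_enum 'I_3) Vq (sb j) sd (sd k).
  by rewrite -sumrN; apply: eq_bigr => l _; rewrite (dform_anti oV sthV Vq (sd k) (sd l)) mulrN opprK.
have bE i j : b i j q = ('D_'e_i (fun x => cmap d (cinv c x) 0 j) (cmap c q))%:C.
  rewrite /b partialE; last exact: smooth_at_coord.
  by congr Complex; exact: derive_cst.
have -> : (jac (fun x => cmap d (cinv c x)) (cmap c q))%:C = det3 (fun i j => b i j q).
  rewrite /jac det3_realC; apply: eq_det3r => j; exact/esym/bE.
have G i j : dform theta (partial c i) (partial c j) q
    = \sum_k b i k q * \sum_l b j l q * dform theta (partial d k) (partial d l) q by exact: dE.
pose dd k l := dform theta (partial d k) (partial d l) q.
have d0 k : dd k k = 0 by exact: (dform_diag oV sthV Vq (sd k)).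
have dN k l : dd l k = - dd k l by exact: (dform_anti oV sthV Vq (sd k) (sd l)).
have comb (x y z x' y' z' x1 y1 z1 x2 y2 z2 : C) : x = x1 -> y = y1 -> z = z1 -> x' = x2 -> y' = y2 -> z' = z2 ->
    x * x' - y * y' + z * z' = x1 * x2 - y1 * y2 + z1 * z2 by move=> -> -> -> -> -> ->.
have := wedge_change (fun i j => b i j q) (fun j => theta q (partial d j q)) d0 dN.
exact: etrans (comb _ _ _ _ _ _ _ _ _ _ _ _ (F1 o0) (F1 o1) (F1 o2) (G o1 o2) (G o0 o2) (G o0 o1)).
Qed.

Section frame.
Variables (U : set M) (Z : vfield M) (theta1 : form1 M).
Hypothesis fr : admissible_frame theta J T U Z theta1.
Local Notation Y := (conj_field Z).
Local Notation theta1b := (conj_form1 theta1).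

Let oU : open U := frame_open fr.
Let sT : smooth_vfield U T := frame_T_smooth U reeb.
Let sZ : smooth_vfield U Z := frame_Z1 fr.
Let sY : smooth_vfield U Y := frame_Y_smooth fr.
Let sth1 : smooth_form1 U theta1 := frame_theta1 fr.
Let sth1b : smooth_form1 U theta1b := conj_form1_smooth oU sth1.
Let sthU : smooth_form1 U theta := frame_theta_smooth U psh.

Definition frame_det c : func M := fun q =>
  det3r (fun j => T q (coordf c j)) (fun j => Z q (coordf c j)) (fun j => Y q (coordf c j)).

(** In the dual coframe [theta /\ d theta] is [i theta /\ theta1 /\ theta1bar]. *)
Lemma vol_frame_det c q : atlas c -> U q -> cdom c q -> vol c q * frame_det c q = 'i%C.
Proof.
move=> ac Uq cq; pose V := U `&` cdom c; have oV : open V by exact: openI.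
have VU : V `<=` U by move=> ? [].
have Vc : V `<=` cdom c by move=> ? [].
have sp j := vfield_sub Vc (partial_smooth ac j).
have dE i j : dform theta (partial c i) (partial c j) q = 'i%C *
    (theta1 q (partial c i q) * theta1b q (partial c j q) - theta1 q (partial c j q) * theta1b q (partial c i q)).
  exact: (frame_normalized fr oV VU (sp i) (sp j)).
have -> : vol c q = 'i%C * det3r (fun j => theta q (partial c j q)) (fun j => theta1 q (partial c j q))
    (fun j => theta1b q (partial c j q)).
  have comb (i t0 t1 t2 a0 a1 a2 b0 b1 b2 d12 d02 d01 : C) : d12 = i * (a1 * b2 - a2 * b1) ->
      d02 = i * (a0 * b2 - a2 * b0) -> d01 = i * (a0 * b1 - a1 * b0) ->
      t0 * d12 - t1 * d02 + t2 * d01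
      = i * (t0 * (a1 * b2 - a2 * b1) - t1 * (a0 * b2 - a2 * b0) + t2 * (a0 * b1 - a1 * b0)).
    by move=> -> -> ->; ring.
  exact: (comb _ _ _ _ _ _ _ _ _ _ _ _ _ (dE o1 o2) (dE o0 o2) (dE o0 o1)).
have ex w X k : smooth_form1 U w -> smooth_vfield U X -> w q (X q) = k ->
    \sum_j X q (coordf c j) * w q (partial c j q) = k.
  move=> sw sX <-; rewrite [in RHS](tangent_expand ac cq (vfield_tangent sX Uq)).
  by rewrite (form1_sum _ _ sw Uq)// => j; exact: partial_tangent.
have [[thT thZ thY] [[t1T t1Z t1Y] [tbT tbZ tbY]]] := frame_values psh reeb fr Uq.
have := det3r_dual (ex _ _ _ sthU sT thT) (ex _ _ _ sth1 sT t1T) (ex _ _ _ sth1b sT tbT)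
  (ex _ _ _ sthU sZ thZ) (ex _ _ _ sth1 sZ t1Z) (ex _ _ _ sth1b sZ tbZ)
  (ex _ _ _ sthU sY thY) (ex _ _ _ sth1 sY t1Y) (ex _ _ _ sth1b sY tbY).
move=> E; rewrite -mulrA [X in _ * X]mulrC -[RHS]mulr1; congr (_ * _); exact: E.
Qed.

Lemma vol_neq0 c q : atlas c -> U q -> cdom c q -> vol c q != 0.
Proof.
move=> ac Uq cq; have := vol_frame_det ac Uq cq; apply: contra_eq_neq => ->.
by rewrite mul0r eq_sym imag_neq0.
Qed.

(** The divergence is minus the trace of the action of [X] on the frame by brackets:
    [vol] is inverse to the determinant of the frame up to the constant [i], and
    [X (E x_j) = [X, E] x_j + E (X x_j)] for a frame field [E]. *)
Lemma chart_divergence c q X : atlas c -> U q -> cdom c q -> smooth_vfield U X ->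
  \sum_j partial c j q (fun r => vol c r * X r (coordf c j)) =
  - (vol c q * (theta q (lie_bracket X T q) + theta1 q (lie_bracket X Z q)
      + theta1b q (lie_bracket X Y q))).
Proof.
move=> ac Uq cq sX; pose V := U `&` cdom c; have oV : open V by exact: openI.
have Vq : V q by [].
have VU : V `<=` U by move=> ? [].
have Vc : V `<=` cdom c by move=> ? [].
have sx j : smooth_on V (coordf c j) by apply: smooth_sub (smooth_coord j ac).
have on E j : smooth_vfield U E -> smooth_on V (fun r => E r (coordf c j)).
  by move=> sE; apply: (vfield_smooth sE).
have at_ g : smooth_on V g -> smooth_at q g by exact: smooth_at_on.
have tX := vfield_tangent sX Uq.
pose Xj j : func M := fun r => X r (coordf c j).
pose D i j := partial c i q (Xj j).
have xat j : smooth_at q (coordf c j) by exact: smooth_at_coord.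
have XE E j : smooth_vfield U E -> X q (fun r => E r (coordf c j)) =
    (theta q (lie_bracket X E q) * T q (coordf c j) + theta1 q (lie_bracket X E q) * Z q (coordf c j)
      + theta1b q (lie_bracket X E q) * Y q (coordf c j)) + \sum_i E q (coordf c i) * D i j.
  move=> sE; have tB := bracket_tangent oU sX sE Uq.
  have := congr1 (fun v : vec M => v (coordf c j)) (frame_span fr Uq tB) => /= <-.
  rewrite (bracketE X E (xat j)).
  have := congr1 (fun v : vec M => v (Xj j)) (tangent_expand ac cq (vfield_tangent sE Uq)) => /= <-.
  by rewrite subrK.
have dA : X q (frame_det c) = (theta q (lie_bracket X T q) + theta1 q (lie_bracket X Z q)
      + theta1b q (lie_bracket X Y q) + \sum_j D j j) * frame_det c q.
  have bE E j (sE : smooth_vfield U E) : der q (X q) (fun r => E r (coordf c j)) (X q (fun r => E r (coordf c j))).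
    by apply: der_base; apply: at_; exact: on.
  have [_ ->] := der_det3r tX (fun j => bE T j sT) (fun j => bE Z j sZ) (fun j => bE Y j sY).
  rewrite (eq_det3r (fun j => XE T j sT) (fun j => erefl) (fun j => erefl)).
  rewrite (eq_det3r (fun j => erefl) (fun j => XE Z j sZ) (fun j => erefl)).
  rewrite (eq_det3r (fun j => erefl) (fun j => erefl) (fun j => XE Y j sY)).
  by rewrite det3r_add det3r_trace det3r_comb -mulrDl.
have sv : smooth_on V (vol c) by apply: smooth_sub (vol_smooth ac).
have sdet : smooth_at q (frame_det c).
  have bE E j (sE : smooth_vfield U E) : der q (X q) (fun r => E r (coordf c j)) (X q (fun r => E r (coordf c j))).
    by apply: der_base; apply: at_; exact: on.
  by have [] := der_det3r tX (fun j => bE T j sT) (fun j => bE Z j sZ) (fun j => bE Y j sY).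
have := derive_near_cst oV Vq tX (fun r Vr => vol_frame_det ac (VU _ Vr) (Vc _ Vr)).
rewrite (tangent_leibniz tX (at_ _ sv) sdet) dA => H.
have d0 : frame_det c q != 0.
  have := vol_frame_det ac Uq cq; apply: contra_eq_neq => ->.
  by rewrite mulr0 eq_sym imag_neq0.
have {H} Xv : X q (vol c) = - (vol c q * (theta q (lie_bracket X T q) + theta1 q (lie_bracket X Z q)
      + theta1b q (lie_bracket X Y q) + \sum_j D j j)).
  apply: (mulIf d0); apply/eqP; rewrite -subr_eq0 -[X in _ == X]H; apply/eqP; ring.
have := congr1 (fun v : vec M => v (vol c)) (tangent_expand ac cq tX) => /= Xv2.
have -> : \sum_j partial c j q (fun r => vol c r * X r (coordf c j))
    = \sum_j (Xj j q * partial c j q (vol c) + vol c q * D j j).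
  apply: eq_bigr => j _; rewrite (tangent_leibniz (partial_tangent ac j cq) (at_ _ sv) (at_ _ (on X j sX))).
  by rewrite /Xj /D mulrC.
rewrite big_split/= -Xv2 Xv -mulr_sumr; ring.
Qed.

End frame.
End Volume.

(** * The global vector field *)

Section Scaling.
Variables (R : realType) (n : nat) (M : manifold R n) (V : set M) (w : form1 M) (p : M).
Hypotheses (oV : open V) (sw : smooth_form1 V w) (Vp : V p).

Lemma dform_scalel (a : func M) X Y : smooth_on V a -> smooth_vfield V X -> smooth_vfield V Y ->
  dform w (fun q f => a q * X q f) Y p = a p * dform w X Y p.
Proof.
move=> sa sX sY; have := dform_combl oV sw Vp sa (@smooth_cst _ _ _ V (0 : R[i])) sX sX sY.
rewrite mul0r addr0 => <-; congr (dform w _ Y p).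
by do 2!apply/funext => ?; rewrite mul0r addr0.
Qed.

Lemma dform_scaler (a : func M) X Y : smooth_on V a -> smooth_vfield V X -> smooth_vfield V Y ->
  dform w X (fun q f => a q * Y q f) p = a p * dform w X Y p.
Proof.
move=> sa sX sY; have := dform_combr oV sw Vp sa (@smooth_cst _ _ _ V (0 : R[i])) sX sY sY.
rewrite mul0r addr0 => <-; congr (dform w X _ p).
by do 2!apply/funext => ?; rewrite mul0r addr0.
Qed.

End Scaling.

Lemma conjv_comb3 (R : realType) n (M : manifold R n) (a b c : R[i]) (u v w : vec M) :
  conjv (fun g => a * u g + b * v g + c * w g)
  = fun g => a^* * conjv u g + b^* * conjv v g + c^* * conjv w g.
Proof. by apply/funext => g; rewrite /conjv !conjD !conjM. Qed.

Section FrameChange.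
Variables (R : realType) (M : manifold R 3) (theta : form1 M) (J : M -> vec M -> vec M).
Variable T : vfield M.
Local Notation C := R[i].
Hypothesis psh : pseudohermitian theta J.
Hypothesis reeb : reeb_field theta T.
Variables (U U' : set M) (Z Z' : vfield M) (theta1 theta1' : form1 M).
Hypothesis fr : admissible_frame theta J T U Z theta1.
Hypothesis fr' : admissible_frame theta J T U' Z' theta1'.
Local Notation Y := (conj_field Z).
Local Notation Y' := (conj_field Z').
Local Notation theta1b := (conj_form1 theta1).

Lemma J_comb p (x y : C) v w : in_xi theta p v -> in_xi theta p w ->
  J p (fun g => x * v g + y * w g) = fun g => x * J p v g + y * J p w g.
Proof.
move=> xv xw; have [tv v0] := xv; have [tw w0] := xw.
have sth : smooth_form1 setT theta by case: psh => -[].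
have x0 : in_xi theta p (fun=> 0) by split; [exact: tangent_vec0|exact: (form1_vec0 sth)].
have J0 : J p (fun=> 0) = fun=> 0.
  have := J_linear psh 1 x0 x0; rewrite (_ : (fun f => 1 * 0 + 0) = fun=> 0); last first.
    by apply/funext => g; rewrite mulr0 addr0.
  move=> E; apply/funext => g; have := congr1 (fun v : vec M => v g) E => /=.
  by rewrite mul1r -{1}[J p _ g]addr0 => /addrI <-.
have yw : in_xi theta p (fun g => y * w g).
  by split; [exact: tangent_vecZ|rewrite (form1_vecZ y sth I tw) w0 mulr0].
rewrite (J_linear psh x xv yw); apply/funext => g; congr (_ + _).
have := J_linear psh y xw x0; rewrite J0 (_ : (fun f => y * w f + 0) = fun f => y * w f); last first.
  by apply/funext => h; rewrite addr0.
by move=> ->; rewrite addr0.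
Qed.

Let lam : func M := fun r => theta1 r (Z' r).
Let V := U `&` U'.
Let oV : open V := openI (frame_open fr) (frame_open fr').
Let VU : V `<=` U. Proof. by move=> ? []. Qed.
Let VU' : V `<=` U'. Proof. by move=> ? []. Qed.
Let sT : smooth_vfield V T. Proof. exact: frame_T_smooth reeb. Qed.
Let sZ : smooth_vfield V Z := vfield_sub VU (frame_Z1 fr).
Let sZ' : smooth_vfield V Z' := vfield_sub VU' (frame_Z1 fr').
Let sY : smooth_vfield V Y := vfield_conj oV sZ.
Let sY' : smooth_vfield V Y' := vfield_conj oV sZ'.
Let sth1 : smooth_form1 V theta1 := form1_sub VU (frame_theta1 fr).
Let sth1' : smooth_form1 V theta1' := form1_sub VU' (frame_theta1 fr').
Let sth1b : smooth_form1 V theta1b := conj_form1_smooth oV sth1.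
Let slam : smooth_on V lam. Proof. exact: (form1_smooth sth1 oV). Qed.
Let slamb : smooth_on V (fun r => (lam r)^*) := smooth_conj oV slam.
Let tZ r (Vr : V r) := vfield_tangent sZ Vr.
Let tY r (Vr : V r) := vfield_tangent sY Vr.
Let tT r (Vr : V r) := vfield_tangent sT Vr.

(** Both fields span the [i]-eigenspace of [J]: the component of [Z'] along [Y] would
    lie in the other eigenspace. *)
Lemma frame_Z_change r : V r -> Z' r = fun g => lam r * Z r g.
Proof.
move=> Vr; have [Ur U'r] := Vr; have tZ' := vfield_tangent sZ' Vr.
have [[thT thZ thY] [[t1T t1Z t1Y] [tbT tbZ tbY]]] := frame_values psh reeb fr Ur.
pose x := lam r; pose y := theta1b r (Z' r).
have E : Z' r = fun g => x * Z r g + y * Y r g.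
  rewrite {1}(frame_span fr Ur tZ') (frame_xi fr' U'r).
  by apply/funext => g; rewrite mul0r add0r.
have xiZ : in_xi theta r (Z r) by split=> //; exact: tZ.
have xiY : in_xi theta r (Y r) by split=> //; exact: tY.
have JZ := frame_type fr Ur.
have JY : J r (Y r) = fun g => - 'i%C * Y r g.
  rewrite /conj_field (J_real psh xiZ) JZ; apply/funext => g.
  by rewrite /conjv conjM conji.
have JZ' := frame_type fr' U'r.
have Y0 : (fun g => (2%:R * 'i%C * y) * Y r g) = fun=> 0.
  apply/funext => g; have := congr1 (fun v : vec M => v g) JZ' => /=.
  rewrite E (J_comb _ _ xiZ xiY) JZ JY => /eqP; rewrite -subr_eq0 => /eqP H.
  by apply/eqP; rewrite -oppr_eq0; apply/eqP; rewrite -[RHS]H; ring.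
have y0 : y = 0.
  have := form1_vecZ (2%:R * 'i%C * y) sth1b Vr (tY Vr).
  rewrite Y0 (form1_vec0 sth1b Vr) tbY mulr1 => /esym/eqP.
  by rewrite !mulf_eq0 pnatr_eq0 (negbTE (imag_neq0 R)) => /eqP.
by rewrite E y0; apply/funext => g; rewrite mul0r addr0.
Qed.

Lemma frame_Y_change r : V r -> Y' r = fun g => (lam r)^* * Y r g.
Proof.
move=> Vr; rewrite /conj_field (frame_Z_change Vr); apply/funext => g.
by rewrite /conjv conjM.
Qed.

Lemma lam_unit r : V r -> lam r * (lam r)^* = 1.
Proof.
move=> Vr; have [Ur U'r] := Vr.
have [_ [[t1T t1Z t1Y] [tbT tbZ tbY]]] := frame_values psh reeb fr Ur.
have := frame_normalized fr oV VU sZ' sY' Vr.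
rewrite (dtheta_ZY psh reeb fr' U'r) /scale_form2 /wedge.
rewrite (frame_Y_change Vr) (form1_vecZ _ sth1b Vr (tY Vr)) (form1_vecZ _ sth1 Vr (tY Vr)) t1Y tbY.
rewrite mulr0 mul0r subr0 mulr1 -/(lam r) -{1}['i%C]mulr1 => /(mulfI (imag_neq0 R)).
by move=> <-.
Qed.

Lemma frame_theta1_change r v : V r -> tangent r v -> theta1' r v = (lam r)^* * theta1 r v.
Proof.
move=> Vr tv; have [Ur U'r] := Vr.
have [_ [[t1T' t1Z' t1Y'] _]] := frame_values psh reeb fr' U'r.
have lu := lam_unit Vr.
have ZE : Z r = fun g => (lam r)^* * Z' r g.
  by rewrite (frame_Z_change Vr); apply/funext => g; rewrite mulrA [_^* * _]mulrC lu mul1r.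
have YE : Y r = fun g => lam r * Y' r g.
  by rewrite (frame_Y_change Vr); apply/funext => g; rewrite mulrA lu mul1r.
have tZ' := vfield_tangent sZ' Vr; have tY' := vfield_tangent sY' Vr.
rewrite {1}(frame_span fr Ur tv) (form1_comb3 _ _ _ sth1' Vr (tT Vr) (tZ Vr) (tY Vr)).
rewrite t1T' {1}ZE (form1_vecZ _ sth1' Vr tZ') t1Z' {1}YE (form1_vecZ _ sth1' Vr tY') t1Y'.
ring.
Qed.

Local Notation al := (fr_alpha Z theta1).
Local Notation al' := (fr_alpha Z' theta1').
Local Notation ga := (fr_gamma T Z theta1).
Local Notation ga' := (fr_gamma T Z' theta1').

Lemma frame_gamma_change r : V r -> ga' r = lam r * lam r * ga r.
Proof.
move=> Vr; have [Ur U'r] := Vr.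
have tbT q : V q -> theta1b q (T q) = 0 by case=> /(frame_values psh reeb fr)[_ [_ []]].
have tbZ q : V q -> theta1b q (Z q) = 0 by case=> /(frame_values psh reeb fr)[_ [_ []]].
have tbZ' q : V q -> theta1b q (Z' q) = 0.
  by move=> Vq; rewrite (frame_Z_change Vq) (form1_vecZ _ sth1b Vq (tZ Vq)) tbZ// mulr0.
have tB := bracket_tangent oV sT sZ' Vr.
have d1 : dform theta1b T Z r = - ga r.
  rewrite /dform (derive_near_cst oV Vr (tT Vr) tbZ) (derive_near_cst oV Vr (tZ Vr) tbT).
  by rewrite subrr sub0r.
have tZ' := vfield_tangent sZ' Vr.
have d2 : dform theta1b T Z' r = - theta1b r (lie_bracket T Z' r).
  rewrite /dform (derive_near_cst oV Vr (tT Vr) tbZ') (derive_near_cst oV Vr tZ' tbT).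
  by rewrite subrr sub0r.
have d3 : dform theta1b T Z' r = lam r * dform theta1b T Z r.
  rewrite -(dform_scaler oV sth1b Vr slam sT sZ).
  by apply: (dform_local _ oV Vr sT sZ') => // q Vq; exact: frame_Z_change.
rewrite /fr_gamma /conj_form1 (frame_theta1_change Vr (tangent_conjv tB)) conjM conjcK.
rewrite -/(conj_form1 theta1 r (lie_bracket T Z' r)).
have -> : theta1b r (lie_bracket T Z' r) = lam r * ga r.
  by apply: oppr_inj; rewrite -d2 d3 d1 mulrN.
by rewrite mulrA.
Qed.

(** The derivative of [lam] appears because [alpha] is a connection coefficient; it
    cancels in [frame_E_change]. *)
Lemma frame_alpha_change r : V r ->
  al' r = (lam r)^* * al r - (lam r)^* * (lam r)^* * Y r lam.
Proof.
move=> Vr; have [Ur U'r] := Vr.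
have t1Y q : V q -> theta1 q (Y q) = 0 by case=> /(frame_values psh reeb fr)[_ [[]]].
have t1Z q : V q -> theta1 q (Z q) = 1 by case=> /(frame_values psh reeb fr)[_ [[]]].
have t1Y' q : V q -> theta1 q (Y' q) = 0.
  by move=> Vq; rewrite (frame_Y_change Vq) (form1_vecZ _ sth1 Vq (tY Vq)) t1Y// mulr0.
have tB := bracket_tangent oV sZ' sY' Vr.
have d1 : dform theta1 Z Y r = - al r.
  rewrite /dform (derive_near_cst oV Vr (tZ Vr) t1Y) (derive_near_cst oV Vr (tY Vr) t1Z).
  by rewrite subrr sub0r.
have tZ' := vfield_tangent sZ' Vr.
have d2 : dform theta1 Z' Y' r = - (Y' r lam) - theta1 r (lie_bracket Z' Y' r).
  by rewrite /dform (derive_near_cst oV Vr tZ' t1Y') sub0r.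
have d3 : dform theta1 Z' Y' r = lam r * ((lam r)^* * dform theta1 Z Y r).
  have sbY : smooth_vfield V (fun q f => (lam q)^* * Y q f) by exact: vfieldZ.
  rewrite -(dform_scaler oV sth1 Vr slamb sZ sY) -(dform_scalel oV sth1 Vr slam sZ sbY).
  by apply: (dform_local _ oV Vr sZ' sY') => q Vq; [exact: frame_Z_change|exact: frame_Y_change].
rewrite {1}/fr_alpha (frame_theta1_change Vr tB).
have -> : theta1 r (lie_bracket Z' Y' r) = al r - Y' r lam.
  move: d3; rewrite d2 d1 !mulrN mulrA (lam_unit Vr) mul1r => /eqP.
  by rewrite -subr_eq0 => /eqP H; apply/eqP; rewrite -subr_eq0 -oppr_eq0 -[X in _ == X]H; apply/eqP; ring.
have -> : Y' r lam = (lam r)^* * Y r lam by rewrite (frame_Y_change Vr).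
ring.
Qed.

Lemma frame_E_change r : V r -> fr_E T Z' theta1' r = lam r * fr_E T Z theta1 r.
Proof.
move=> Vr; have [Ur U'r] := Vr; rewrite /fr_E.
have sga := smooth_sub VU (frame_gamma_smooth reeb fr).
have at_ g : smooth_on V g -> smooth_at r g by exact: smooth_at_on.
have b g : smooth_on V g -> der r (Y r) g (Y r g) by move=> sg; apply: der_base; exact: at_.
have -> : Y' r ga' = (lam r)^* * Y r ga' by rewrite (frame_Y_change Vr).
rewrite (der_on (tY Vr) oV Vr frame_gamma_change
  (derM (tY Vr) (derM (tY Vr) (b _ slam) (b _ slam)) (b _ sga))).
rewrite (frame_alpha_change Vr) (frame_gamma_change Vr).
have := lam_unit Vr.
move: (lam r) ((lam r)^* ) (Y r lam) (Y r ga) (al r) (ga r) => l lb yl yg a g lu.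
transitivity (l * - (yg + 2%:R * (a * g)) + (1 - l * lb) * (l * yg + 2%:R * l * a * g - 2%:R * lb * l * yl * g)).
  by ring.
by rewrite lu subrr mul0r addr0.
Qed.

Variables (f : M -> R).

Lemma frame_B_change r : V r -> fr_B T Z' theta1' f r = lam r * fr_B T Z theta1 f r.
Proof.
move=> Vr; rewrite /fr_B (frame_E_change Vr) (frame_gamma_change Vr) (frame_Y_change Vr).
have := lam_unit Vr.
move: (lam r) ((lam r)^* ) (Y r _) (ga r) (fr_E _ _ _ _) => l lb yf g e lu.
transitivity (l * (cfun f r * e + g * yf) + (l * lb - 1) * (l * g * yf)); first by ring.
by rewrite lu subrr mul0r addr0.
Qed.

End FrameChange.

Section SolitonField.
Variables (R : realType) (M : manifold R 3) (theta : form1 M) (J : M -> vec M -> vec M).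
Variables (T : vfield M) (W f : M -> R) (mu : R).
Local Notation C := R[i].
Hypothesis soliton : cr_yamabe_soliton theta J T W f mu.

Let psh := soliton_pseudohermitian soliton.
Let reeb := soliton_reeb soliton.
Let web := soliton_webster soliton.
Let curv := soliton_curvature soliton.
Local Notation F := (cfun f).

Definition sol_a : func M := fun q => mu%:C * F q - F q * (W q)%:C.

(** The field of [divergence_identity]. *)
Definition fr_field (Z : vfield M) (theta1 : form1 M) : vfield M := fun q g =>
  sol_a q * T q g + fr_B T Z theta1 f q * conj_field Z q g + (fr_B T Z theta1 f q)^* * Z q g.

Lemma sol_a_real q : (sol_a q)^* = sol_a q.
Proof.
have r (x : R) : (x%:C)^* = x%:C by exact: conjc_real.
by rewrite /sol_a conjB !conjM !r.
Qed.

Lemma fr_field_conj Z theta1 q : conjv (fr_field Z theta1 q) = fr_field Z theta1 q.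
Proof.
apply/funext => g; rewrite /fr_field.
transitivity ((sol_a q)^* * conjv (T q) g + (fr_B T Z theta1 f q)^* * conjv (conj_field Z q) g
    + (fr_B T Z theta1 f q)^*^* * conjv (Z q) g).
  by rewrite conjv_comb3.
by rewrite sol_a_real (reeb_real reeb) [conjv (conj_field Z q)]conjvK conjcK addrAC.
Qed.

Section frame.
Variables (U : set M) (Z : vfield M) (theta1 : form1 M).
Hypothesis fr : admissible_frame theta J T U Z theta1.
Local Notation Y := (conj_field Z).
Local Notation theta1b := (conj_form1 theta1).
Local Notation B := (fr_B T Z theta1 f).
Local Notation X := (fr_field Z theta1).
Local Notation om := (fr_omega T Z theta1 theta).

Let oU : open U := frame_open fr.
Let sT : smooth_vfield U T := frame_T_smooth U reeb.
Let sZ : smooth_vfield U Z := frame_Z1 fr.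
Let sY : smooth_vfield U Y := frame_Y_smooth fr.
Let sth1 : smooth_form1 U theta1 := frame_theta1 fr.
Let sthU : smooth_form1 U theta := frame_theta_smooth U psh.
Let sF : smooth_on U F. Proof. exact: smooth_sub (soliton_smooth soliton). Qed.
Let sB : smooth_on U B := fr_B_smooth reeb fr sF.
Let sW : smooth_on U (cfun W) := W_smooth reeb fr sF curv.

Lemma sol_a_smooth : smooth_on U sol_a.
Proof.
apply: smoothB => //; last exact: smoothM.
exact: (smoothM oU (@smooth_cst _ _ _ U (mu%:C : C)) sF).
Qed.

Lemma fr_field_smooth : smooth_vfield U X.
Proof.
by apply: vfield_comb3 => //; [exact: sol_a_smooth|exact: smooth_conj].
Qed.

Lemma fr_field_values q : U q -> [/\ theta q (X q) = sol_a q, theta1 q (X q) = (B q)^* & theta1b q (X q) = B q].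
Proof.
move=> Uq; have [[thT thZ thY] [[t1T t1Z t1Y] [tbT tbZ tbY]]] := frame_values psh reeb fr Uq.
have tT := vfield_tangent sT Uq; have tZ := vfield_tangent sZ Uq; have tY := vfield_tangent sY Uq.
have sb := conj_form1_smooth oU sth1.
rewrite /fr_field (form1_comb3 _ _ _ sthU Uq tT tY tZ) (form1_comb3 _ _ _ sth1 Uq tT tY tZ).
rewrite (form1_comb3 _ _ _ sb Uq tT tY tZ) thT thZ thY t1T t1Z t1Y tbT tbZ tbY.
by rewrite !mulr0 !mulr1 !addr0 !add0r.
Qed.

(** The components of the brackets are read off from [d theta (X, T) = 0] and from the
    structure equation for [theta1 (X, Z)]; the third is conjugate to the second
    because [X] is real, and [omega X], being imaginary, cancels. *)
Lemma fr_field_trace q : U q ->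
  theta q (lie_bracket X T q) + theta1 q (lie_bracket X Z q) + theta1b q (lie_bracket X Y q)
  = - (2%:R^-1 * (T q F * T q F)).
Proof.
move=> Uq; have UU : U `<=` U by [].
have sX := fr_field_smooth; have tX := vfield_tangent sX Uq.
have tT := vfield_tangent sT Uq; have tZ := vfield_tangent sZ Uq; have tY := vfield_tangent sY Uq.
have thT r : U r -> theta r (T r) = 1 by move=> /(frame_values psh reeb fr)[[]].
have t1Z r : U r -> theta1 r (Z r) = 1 by move=> /(frame_values psh reeb fr)[_ [[]]].
have thX r : U r -> theta r (X r) = sol_a r by move=> /fr_field_values[].
have t1X r : U r -> theta1 r (X r) = (B r)^* by move=> /fr_field_values[].
have b v g (tv : tangent q v) : smooth_on U g -> der q v g (v g).
  by move=> sg; apply: der_base; exact: (smooth_at_on oU Uq).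
have e1 : theta q (lie_bracket X T q) = - T q sol_a.
  have [_ _ dT] := reeb; have := dT U X oU sX q Uq.
  move=> /eqP; rewrite -oppr_eq0 -(dform_anti oU sthU Uq sT sX) => /eqP.
  rewrite /dform (derive_near_cst oU Uq tX thT) (der_on tT oU Uq thX (b _ _ tT sol_a_smooth)).
  by rewrite sub0r => /eqP; rewrite subr_eq0 => /eqP <-.
have e2 : theta1 q (lie_bracket X Z q) = om q (X q) - (Z q (fun r => (B r)^*) + (fr_alpha Z theta1 q)^* * (B q)^*).
  have := frame_structure_equation psh reeb fr oU UU sX sZ Uq.
  rewrite /dform (derive_near_cst oU Uq tX t1Z) (der_on tZ oU Uq t1X (b _ _ tZ (smooth_conj oU sB))).
  rewrite /add_form2 /wedge /scale_form1.
  have [[_ thZ _] [_ [_ tbZ _]]] := frame_values psh reeb fr Uq.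
  have omZ : om q (Z q) = (fr_alpha Z theta1 q)^*.
    by rewrite /fr_omega thZ tbZ t1Z// !mulr0 mulr1 !addr0.
  rewrite omZ thZ tbZ t1Z// t1X// => /eqP; rewrite -subr_eq0 => /eqP H.
  by apply/eqP; rewrite -subr_eq0 -oppr_eq0 -[X in _ == X]H; apply/eqP; ring.
have e3 : theta1b q (lie_bracket X Y q) = (theta1 q (lie_bracket X Z q))^*.
  rewrite /conj_form1 -bracket_conj conj_fieldK.
  by rewrite (_ : conj_field X = X)//; apply/funext => r; exact: fr_field_conj.
have omX : (om q (X q))^* = - om q (X q).
  have := connection_imaginary (frame_connection psh reeb fr) Uq tX.
  by rewrite /conj_form1 fr_field_conj.
have D := divergence_identity psh reeb fr web sF curv (fun p Up =>
  soliton_hessian soliton fr (frame_connection psh reeb fr) Up) Uq.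
rewrite e1 e3 e2 -D conjB conjD conjM !conjcK omX conjD conjM.
rewrite [(Z q _)^*](_ : _ = Y q B)// -[T q (fun r => _ - _)]/(T q sol_a).
rewrite [(Y q B)^*]conj_Y.
move: (T q sol_a) (om q (X q)) (Y q B) (Z q _) (B q) ((B q)^* ) => *; ring.
Qed.

Lemma fr_field_divergence c q : atlas c -> U q -> cdom c q ->
  \sum_j partial c j q (fun r => vol theta c r * X r (coordf c j))
  = vol theta c q * (2%:R^-1 * (T q F * T q F)).
Proof.
move=> ac Uq cq; rewrite (chart_divergence psh reeb fr ac Uq cq fr_field_smooth).
by rewrite (fr_field_trace Uq) mulrN opprK.
Qed.

End frame.

(** [Z' = lam Z] and [B' = lam B] with [lam] of modulus one. *)
Lemma fr_field_change U U' Z Z' theta1 theta1' q :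
  admissible_frame theta J T U Z theta1 -> admissible_frame theta J T U' Z' theta1' ->
  U q -> U' q -> fr_field Z' theta1' q = fr_field Z theta1 q.
Proof.
move=> fr fr' Uq U'q; have Vq : (U `&` U') q by [].
have BE := frame_B_change psh reeb fr fr' f Vq.
have YE := frame_Y_change psh reeb fr fr' Vq; have ZE := frame_Z_change psh reeb fr fr' Vq.
have := lam_unit psh reeb fr fr' Vq; move: BE YE ZE.
set l := theta1 q (Z' q); clearbody l => BE YE ZE lu.
apply/funext => g; rewrite /fr_field BE YE ZE conjM; congr (_ + _ + _).
  by rewrite mulrACA [l * _]lu mul1r.
by rewrite mulrACA [_^* * l]mulrC lu mul1r.
Qed.

End SolitonField.

(** * Existence of admissible frames *)

Lemma dual_span (K : fieldType) (a m : 'I_3 -> 'I_3 -> K) :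
  (forall b b', \sum_j a b j * m b' j = (b == b')%:R) ->
  forall j k, \sum_b m b j * a b k = (j == k)%:R.
Proof.
move=> am; pose A : 'M[K]_3 := \matrix_(b, j) a b j; pose B : 'M[K]_3 := \matrix_(j, b) m b j.
have AB : A *m B = 1%:M.
  apply/matrixP => b b'; rewrite !mxE -am; apply: eq_bigr => j _.
  by rewrite !mxE.
move=> j k; have := mulmx1C AB => /matrixP/(_ j k); rewrite !mxE => <-.
by apply: eq_bigr => b _; rewrite !mxE.
Qed.

Lemma dual_expand (K : fieldType) (a m : 'I_3 -> 'I_3 -> K) :
  (forall b b', \sum_j a b j * m b' j = (b == b')%:R) ->
  forall (x : 'I_3 -> K) k, \sum_b (\sum_j x j * m b j) * a b k = x k.
Proof.
move=> am x k; have inv := dual_span am.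
under eq_bigr do rewrite mulr_suml.
rewrite exchange_big /=; under eq_bigr => j _.
  under eq_bigr do rewrite -mulrA.
  rewrite -mulr_sumr inv.
  over.
by rewrite (bigD1 k)//= eqxx mulr1 big1 ?addr0// => j /negbTE ->; rewrite mulr0.
Qed.

(** A frame or a coframe as a family. *)
Definition triple (A : Type) (x y z : A) (b : 'I_3) : A :=
  if b == o0 then x else if b == o1 then y else z.

Lemma tripleE (A : Type) (x y z : A) :
  [/\ triple x y z o0 = x, triple x y z o1 = y & triple x y z o2 = z].
Proof. by rewrite /triple !eqxx o10 o20 o21. Qed.

Section PowSmooth.
Variables (R : realType) (M : manifold R 3).

(** The derivatives of a real power are again real powers. *)
Lemma rsmooth_powR (U : set M) (g : M -> R) (a : R) : open U -> (forall q, U q -> 0 < g q) ->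
  rsmooth U g -> rsmooth U (fun q => g q `^ a).
Proof.
move=> oU g0 sg c ac; split; last exact: Cinf_cst.
have gk := rsmooth_Cinf ac sg => k; have oUc := @img_open _ _ _ c U oU.
pose dphi (a : R) : seq (R * R) := [:: (a, a - 1)].
apply: (@Ck_comp1 _ _ [set t | 0 < t] R (fun a t => t `^ a) dphi _ _ _ oUc _ _ (gk k) a).
  by move=> b t t0; rewrite big_cons big_nil addr0 /=; exact: is_derive1_powR.
by move=> x [q [Uq cq] <-]; rewrite /= cmapK//; exact: g0.
Qed.

End PowSmooth.

Lemma conjv_comb2 (R : realType) n (M : manifold R n) (a b : R[i]) (u v : vec M) :
  conjv (fun g => a * u g + b * v g) = fun g => a^* * conjv u g + b^* * conjv v g.
Proof. by apply/funext => g; rewrite /conjv conjD !conjM. Qed.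

Section FrameExistence.
Variables (R : realType) (M : manifold R 3) (theta : form1 M) (J : M -> vec M -> vec M).
Variable T : vfield M.
Local Notation C := R[i].
Hypothesis psh : pseudohermitian theta J.
Hypothesis reeb : reeb_field theta T.

Let sth : smooth_form1 setT theta. Proof. by case: psh => -[]. Qed.
Let thT p : theta p (T p) = 1. Proof. by case: reeb. Qed.

(** ** A unit field of type (1,0) *)

Section field.
Variables (c : chart R 3 M) (p : M).
Hypotheses (ac : atlas c) (cp : cdom c p).

Let oc : open (cdom c) := cdom_open c.
Let sT : smooth_vfield (cdom c) T := frame_T_smooth (cdom c) reeb.
Let sthc : smooth_form1 (cdom c) theta := form1_sub (fun _ _ => I) sth.

Definition horizontal (j : 'I_3) : vfield M := fun q g =>
  1 * partial c j q g + (- theta q (partial c j q)) * T q g.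

Lemma horizontal_smooth j : smooth_vfield (cdom c) (horizontal j).
Proof.
have sp := partial_smooth ac j.
apply: vfield_comb => //; first exact: smooth_cst.
by apply: smoothN => //; apply: (form1_smooth sthc).
Qed.

Lemma horizontal_xi j q : cdom c q -> theta q (horizontal j q) = 0.
Proof.
move=> cq; have tp := partial_tangent ac j cq; have tT := vfield_tangent sT cq.
by rewrite /horizontal (form1_comb _ _ sthc cq tp tT) thT mul1r mulr1 subrr.
Qed.

Lemma horizontal_real j q : cdom c q -> conjv (horizontal j q) = horizontal j q.
Proof.
move=> cq; rewrite /horizontal conjv_comb2 (partial_conj ac j cq) (reeb_real reeb) conjN conjc1.
by rewrite -(theta_conj psh (partial_tangent ac j cq)) (partial_conj ac j cq).
Qed.

(** Otherwise all the coordinate fields would be multiples of [T]. *)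
Lemma horizontal_neq0 : exists j k, horizontal j p (coordf c k) != 0.
Proof.
apply: contrapT => H; have H0 j k : horizontal j p (coordf c k) = 0.
  by apply/eqP; apply: contrapT => /negP ne; apply: H; exists j, k.
have E j k : (j == k)%:R = theta p (partial c j p) * T p (coordf c k).
  have := H0 j k; rewrite /horizontal (partial_coord ac _ _ cp) mul1r mulNr => /eqP.
  by rewrite subr_eq0 => /eqP.
have := E o0 o1; rewrite (eq_sym o0 o1) o10 => /esym/eqP; rewrite mulf_eq0 => /orP[/eqP t0|/eqP t1].
  by have /eqP := E o0 o0; rewrite eqxx t0 mul0r oner_eq0.
by have /eqP := E o1 o1; rewrite eqxx t1 mulr0 oner_eq0.
Qed.

(** [Z = (H - i J H) / sqrt (2 d theta(H, J H))] for a horizontal coordinate field [H]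
    that does not vanish at [p]; positivity of [J] gives the square root. *)
Lemma unit_field_exists : exists (U : set M) (Z : vfield M),
  [/\ open U, U p, U `<=` cdom c, smooth_vfield U Z &
    [/\ forall q, U q -> theta q (Z q) = 0,
        forall q, U q -> J q (Z q) = (fun g => 'i%C * Z q g) &
        forall q, U q -> dform theta Z (conj_field Z) q = 'i%C]].
Proof.
have [j [k jk]] := horizontal_neq0; pose H := horizontal j.
have sH : smooth_vfield (cdom c) H := horizontal_smooth j.
pose U := [set q | cdom c q /\ H q (coordf c k) != 0].
have sHk : smooth_on (cdom c) (fun q => H q (coordf c k)).
  by apply: (vfield_smooth sH) => //; exact: smooth_coord.
have oU : open U.
  rewrite openE => q [cq Hq]; apply: filterI; first by apply: open_nbhs_nbhs.
  exact: (smooth_neq0 sHk cq Hq).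
have Uc : U `<=` cdom c by move=> q [].
have sHU := vfield_sub Uc sH; have sthU := form1_sub Uc sthc.
have H0 q : U q -> theta q (H q) = 0 by move=> /Uc; exact: horizontal_xi.
have rH q : U q -> conjv (H q) = H q by move=> /Uc; exact: horizontal_real.
pose G : vfield M := fun q => J q (H q).
have sG : smooth_vfield U G by exact: (J_smooth psh).
have xiH q : U q -> in_xi theta q (H q).
  by move=> Uq; split; [exact: (vfield_tangent sHU Uq)|exact: H0].
have xiG q : U q -> in_xi theta q (G q) by move=> Uq; exact: (J_xi psh (xiH q Uq)).
have G0 q : U q -> theta q (G q) = 0 by move=> /xiG[].
have rG q : U q -> conjv (G q) = G q by move=> Uq; rewrite /G -(J_real psh (xiH q Uq)) rH.
pose N q := dform theta H G q.
have N0 q : U q -> 0 < N q.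
  move=> Uq; apply: (J_positive psh oU (conj sHU rH) H0 Uq) => E.
  by have [_] := Uq; rewrite E eqxx.
have Nr q : U q -> N q = ('re (N q))%:C /\ 0 < 're (N q).
  by move=> /N0; rewrite ltcE /= => /andP[/eqP i0 r0]; split=> //; case: (N q) i0 => a b /= ->.
pose s q : R := (2 * 're (N q)) `^ (- 2^-1).
have sN : smooth_on U N by exact: (dform_smooth oU sthU sHU sG).
have s2 q : U q -> (s q)%:C * (s q)%:C * (2%:R * N q) = 1.
  move=> Uq; have [NE Np] := Nr q Uq; have N2 : 0 < 2 * 're (N q) by rewrite mulr_gt0.
  have ss : s q * s q = (2 * 're (N q))^-1.
    rewrite /s -powRD; last by rewrite (gt_eqF N2) implybT.
    have -> : - 2^-1 + - 2^-1 = -1 :> R by field.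
    by rewrite powRN powRr1// ltW.
  rewrite NE -rmorphM ss.
  have -> : 2%:R = (2 : R)%:C by rewrite rmorph_nat.
  by rewrite -!rmorphM mulVf ?rmorph1// gt_eqF.
have ss : smooth_on U (fun q => (s q)%:C).
  apply: (@rsmooth_powR R M U (fun q => 2 * 're (N q)) (- 2^-1) oU).
    by move=> q /Nr[_ ?]; rewrite mulr_gt0.
  apply: (smooth_eq oU _ (smoothM oU (@smooth_cst _ _ _ U (2%:R : C)) (smooth_Re oU sN))) => q _.
  by rewrite rmorphM rmorph_nat.
pose Z : vfield M := fun q g => (s q)%:C * H q g + (- 'i%C * (s q)%:C) * G q g.
have sis (l : C) : smooth_on U (fun q => l * (s q)%:C).
  exact: (smoothM oU (@smooth_cst _ _ _ U l) ss).
have sZ : smooth_vfield U Z by exact: (vfield_comb oU ss (sis _) sHU sG).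
have Up : U p by [].
exists U, Z; split=> //.
have YE q : U q -> conj_field Z q = fun g => (s q)%:C * H q g + ('i%C * (s q)%:C) * G q g.
  move=> Uq; rewrite /conj_field /Z conjv_comb2 (rH q Uq) (rG q Uq) conjM conjN conji opprK.
  by rewrite [((s q)%:C)^*]conjc_real.
split=> q Uq.
- rewrite /Z (form1_comb _ _ sthU Uq (vfield_tangent sHU Uq) (vfield_tangent sG Uq)).
  by rewrite H0// G0// !mulr0 addr0.
- rewrite /Z (J_comb psh _ _ (xiH q Uq) (xiG q Uq)) (J_square psh (xiH q Uq)).
  apply/funext => g; rewrite -/(G q).
  have ii : ('i%C : C) * 'i%C = -1 by apply/eqP; rewrite eq_complex /=; apply/andP; split; apply/eqP; ring.
  transitivity ('i%C * (s q)%:C * H q g + (- ('i%C * 'i%C)) * (s q)%:C * G q g); last by ring.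
  by rewrite ii; ring.
have sYs := @vfield_comb _ _ M U _ _ _ _ oU ss (sis 'i%C) sHU sG.
rewrite (dform_local theta oU Uq sZ (vfield_conj oU sZ) (fun _ _ => erefl) YE).
rewrite (dform_combl oU sthU Uq ss (sis _) sHU sG sYs).
rewrite (dform_combr oU sthU Uq ss (sis _) sHU sHU sG) (dform_combr oU sthU Uq ss (sis _) sG sHU sG).
rewrite (dform_diag oU sthU Uq sHU) (dform_diag oU sthU Uq sG) (dform_anti oU sthU Uq sHU sG) -/(N q).
have := s2 q Uq; move: (N q) ((s q)%:C) => n s0 s1.
transitivity ('i%C * (s0 * s0 * (2%:R * n))); first by ring.
by rewrite s1 mulr1.
Qed.

End field.

(** ** The dual coframe *)

(** Contraction of [d theta] with [Y] gives [theta1], up to the factor [- i]; it is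
    written in coordinates since a form is evaluated on single vectors. *)
Lemma admissible_frame_exists p : exists (U : set M) (Z : vfield M) (theta1 : form1 M),
  U p /\ admissible_frame theta J T U Z theta1.
Proof.
have [c ac cp] := atlas_cover p.
have [U [Z [oU Up Uc sZ [thZ JZ dZY]]]] := unit_field_exists ac cp.
pose Y := conj_field Z; have sY : smooth_vfield U Y by exact: vfield_conj.
have sT := frame_T_smooth U reeb; have sthU : smooth_form1 U theta by apply: form1_sub sth.
have sp j := vfield_sub Uc (partial_smooth ac j).
have sx j : smooth_on U (coordf c j) by apply: smooth_sub (smooth_coord j ac).
pose theta1 : form1 M := fun q v => - 'i%C * \sum_j v (coordf c j) * dform theta (partial c j) Y q.
have th1E V X q : open V -> V `<=` U -> smooth_vfield V X -> V q ->
    theta1 q (X q) = - 'i%C * dform theta X Y q.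
  move=> oV VU sX Vq; congr (_ * _).
  have sXj j : smooth_on V (fun r => X r (coordf c j)).
    by apply: (vfield_smooth sX) => //; apply: smooth_sub (sx j).
  have [sXX <-] := dform_suml oV (form1_sub VU sthU) (index_enum 'I_3) Vq sXj
    (fun j => vfield_sub VU (sp j)) (vfield_sub VU sY).
  apply: (dform_local _ oV Vq sXX (vfield_sub VU sY)) => // r Vr.
  by rewrite -(tangent_expand ac (Uc _ (VU _ Vr)) (vfield_tangent sX Vr)).
have UU : U `<=` U by [].
have sth1 : smooth_form1 U theta1.
  split=> [q Uq k v v' _ _|V X oV VU sX].
    rewrite /theta1 mulrCA -mulrDr; congr (_ * _).
    rewrite mulr_sumr -big_split/=; apply: eq_bigr => j _; ring.
  apply: (smooth_eq oV (fun q Vq => esym (th1E V X q oV VU sX Vq))).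
  apply: (smoothM oV (@smooth_cst _ _ _ V (- 'i%C : C))).
  exact: (dform_smooth oV (form1_sub VU sthU) sX (vfield_sub VU sY)).
have ii : - ('i%C : C) * 'i%C = 1.
  by apply/eqP; rewrite eq_complex /=; apply/andP; split; apply/eqP; ring.
have t1T q : U q -> theta1 q (T q) = 0.
  move=> Uq; rewrite (th1E _ _ _ oU UU sT Uq); case: reeb => _ _ dT.
  by rewrite (dT U Y oU sY q Uq) mulr0.
have t1Z q : U q -> theta1 q (Z q) = 1.
  by move=> Uq; rewrite (th1E _ _ _ oU UU sZ Uq) dZY.
have t1Y q : U q -> theta1 q (Y q) = 0.
  by move=> Uq; rewrite (th1E _ _ _ oU UU sY Uq) (dform_diag oU sthU Uq sY) mulr0.
pose theta1b := conj_form1 theta1.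
have sth1b : smooth_form1 U theta1b by exact: conj_form1_smooth.
have tbT q : U q -> theta1b q (T q) = 0.
  by move=> Uq; rewrite /theta1b /conj_form1 (reeb_real reeb) t1T// conjc0.
have tbZ q : U q -> theta1b q (Z q) = 0.
  by move=> Uq; rewrite /theta1b /conj_form1 [theta1 q _]t1Y// conjc0.
have tbY q : U q -> theta1b q (Y q) = 1.
  by move=> Uq; rewrite /theta1b /conj_form1 /Y /conj_field conjvK t1Z// conjc1.
have thY q : U q -> theta q (Y q) = 0.
  move=> Uq; rewrite /Y /conj_field (theta_conj psh (vfield_tangent sZ Uq)) thZ//.
  exact: conjc0.
have span q v : U q -> tangent q v ->
    v = fun g => theta q v * T q g + theta1 q v * Z q g + theta1b q v * Y q g.
  move=> Uq tv; have cq := Uc _ Uq.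
  pose E := triple T Z Y; pose w := triple theta theta1 theta1b.
  have [E0 E1 E2] := tripleE T Z Y; have [w0 w1 w2] := tripleE theta theta1 theta1b.
  have sE : forall b, smooth_vfield U (E b) by apply: ord3P; rewrite /E ?E0 ?E1 ?E2.
  have sw : forall b, smooth_form1 U (w b) by apply: ord3P; rewrite /w ?w0 ?w1 ?w2.
  have ex b u : tangent q u -> w b q u = \sum_j u (coordf c j) * w b q (partial c j q).
    move=> tu; rewrite {1}(tangent_expand ac cq tu) (form1_sum _ _ (sw b) Uq)//.
    by move=> j; exact: (vfield_tangent (sp j) Uq).
  have dual : forall b b', \sum_j E b q (coordf c j) * w b' q (partial c j q) = (b == b')%:R.
    have wE b b' : \sum_j E b q (coordf c j) * w b' q (partial c j q) = w b' q (E b q).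
      by rewrite -(ex b' _ (vfield_tangent (sE b) Uq)).
    have o01 : (o0 == o1) = false by rewrite eq_sym o10.
    have o02 : (o0 == o2) = false by rewrite eq_sym o20.
    have o12 : (o1 == o2) = false by rewrite eq_sym o21.
    move=> b b'; rewrite wE; move: b b'; apply: ord3P; apply: ord3P;
      rewrite /w /E ?E0 ?E1 ?E2 ?w0 ?w1 ?w2 ?eqxx ?o10 ?o20 ?o21 ?o01 ?o02 ?o12.
    - exact: thT.
    - exact: t1T.
    - exact: tbT.
    - exact: thZ.
    - exact: t1Z.
    - exact: tbZ.
    - exact: thY.
    - exact: t1Y.
    - exact: tbY.
  have tE b := vfield_tangent (sE b) Uq.
  have tc : tangent q (fun g => theta q v * T q g + theta1 q v * Z q g + theta1b q v * Y q g).
    have := tangent_comb 1 (theta1b q v) (tangent_comb (theta q v) (theta1 q v)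
      (vfield_tangent sT Uq) (vfield_tangent sZ Uq)) (vfield_tangent sY Uq).
    by congr (tangent q _); apply/funext => g; rewrite mul1r.
  apply: (tangent_eq ac cq tv tc) => k.
  transitivity (\sum_b w b q v * E b q (coordf c k)); last first.
    by rewrite sum3 /w /E E0 E1 E2 w0 w1 w2.
  rewrite -[LHS](dual_expand dual (fun j => v (coordf c j)) k).
  by apply: eq_bigr => b _; rewrite (ex b v tv).
exists U, Z, theta1; split=> //; split=> //.
  by move=> q Uq; split; [exact: t1T|exact: t1Z|exact: t1Y].
move=> V X X' oV VU sX sX' q Vq; have Uq := VU _ Vq.
rewrite (dform_span oV Vq (form1_sub VU sthU) (form1_sub VU sthU) (form1_sub VU sth1) (form1_sub VU sth1b)
  (vfield_sub VU sT) (vfield_sub VU sZ) (vfield_sub VU sY) (fun q v Vq => span q v (VU _ Vq)) sX sX').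
have [_ _ dT] := reeb.
rewrite (dT U Z oU sZ q Uq) (dT U Y oU sY q Uq) (dZY q Uq) /scale_form2 /wedge -/theta1b; ring.
Qed.

End FrameExistence.

Opaque vol.

(** * Constancy of the curvature *)

Lemma norm_near_sg (R : realType) (x y : R) : `|y - x| < `|y| -> `|x| = Num.sg y * x.
Proof.
have [yn|yp|->] := ltgtP y 0; last by rewrite normr0 ltNge normr_ge0.
  rewrite (ltr0_norm yn) (ltr0_sg yn) ltr_norml => /andP[h1 h2].
  by rewrite ltr0_norm ?mulN1r//; lra.
rewrite (gtr0_norm yp) (gtr0_sg yp) ltr_norml => /andP[h1 h2].
by rewrite gtr0_norm ?mul1r//; lra.
Qed.

Section Soliton.
Variables (R : realType) (M : manifold R 3) (theta : form1 M) (J : M -> vec M -> vec M).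
Variables (T : vfield M) (W f : M -> R) (mu : R).
Local Notation C := R[i].
Hypothesis closedM : compact [set: M].
Hypothesis soliton : cr_yamabe_soliton theta J T W f mu.

Let psh := soliton_pseudohermitian soliton.
Let reeb := soliton_reeb soliton.
Local Notation F := (cfun f).
Local Notation vol := (vol theta).

(** A frame is chosen at every point; near a point all choices give the field of one
    frame. *)
Lemma sol_field_exists : exists Y0 : vfield M, smooth_vfield setT Y0 /\
  forall p, exists (U : set M) (Z : vfield M) (theta1 : form1 M),
    [/\ U p, admissible_frame theta J T U Z theta1 &
        forall q, U q -> Y0 q = fr_field T W f mu Z theta1 q].
Proof.
have /choice[D DP] : forall p : M, exists D : set M * vfield M * form1 M,
    D.1.1 p /\ admissible_frame theta J T D.1.1 D.1.2 D.2.
  move=> p; have [U [Z [theta1 H]]] := admissible_frame_exists psh reeb p.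
  by exists (U, Z, theta1).
pose Y0 : vfield M := fun p => fr_field T W f mu (D p).1.2 (D p).2 p.
have Y0E p q : (D p).1.1 q -> Y0 q = fr_field T W f mu (D p).1.2 (D p).2 q.
  move=> pq; have [_ frp] := DP p; have [qq frq] := DP q.
  exact: (fr_field_change soliton frp frq pq qq).
exists Y0; split; last first.
  by move=> p; have [pp frp] := DP p; exists (D p).1.1, (D p).1.2, (D p).2; split=> // q; exact: Y0E.
have sX p := fr_field_smooth soliton (DP p).2.
split=> [p _|V g oV _ sg]; first exact: (vfield_tangent (sX p) (DP p).1).
apply: smooth_pointwise => p Vp; have [pp frp] := DP p.
exists (V `&` (D p).1.1); split=> //.
have oVD : open (V `&` (D p).1.1) by exact: openI (frame_open frp).
apply: (@smooth_eq _ _ _ _ (fun q => fr_field T W f mu (D p).1.2 (D p).2 q g)) => //.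
  by move=> q [_ Dq]; rewrite (Y0E p).
apply: (vfield_smooth (sX p)) => //.
by apply: smooth_sub sg => q [].
Qed.

Lemma T_real q : T q F = ('re (T q F))%:C.
Proof.
have [[sT rT] _ _] := reeb.
have := tangent_conj_eq F (vfield_tangent sT (I : [set: M] q)) (rT q I).
rewrite (_ : (fun q => (F q)^*) = F); last by apply/funext => r; exact: conjc_real.
by case: (T q F) => a b [/eqP]; rewrite -addr_eq0 -mulr2n mulrn_eq0 => /eqP->.
Qed.

Lemma vol_re c q : atlas c -> cdom c q -> vol c q = ('re (vol c q))%:C.
Proof.
move=> ac cq; have := vol_conj psh ac cq; case: (vol c q) => a b [/esym/eqP].
by rewrite -addr_eq0 -mulr2n mulrn_eq0 => /eqP->.
Qed.

Lemma vol_re_neq0 c q : atlas c -> cdom c q -> 're (vol c q) != 0.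
Proof.
move=> ac cq; have [U [Z [theta1 [Uq fr]]]] := admissible_frame_exists psh reeb q.
have := vol_neq0 psh reeb fr ac Uq cq; apply: contra_neq => E.
by rewrite (vol_re ac cq) E.
Qed.

(** Locally the density is a constant multiple of the volume form. *)
Lemma norm_vol_near c q : atlas c -> cdom c q ->
  \forall r \near q, `|'re (vol c r)| = Num.sg ('re (vol c q)) * 're (vol c r).
Proof.
move=> ac cq; have v0 : 0 < `|'re (vol c q)| by rewrite normr_gt0 vol_re_neq0.
have [cr _] := smooth_cont (vol_smooth psh ac) cq.
apply: filterS (cont_dist_lt cr v0) => r; exact: norm_near_sg.
Qed.

Lemma reeb_derivative_eq0 q : T q F = 0.
Proof.
have [Y0 [sY0 Y0P]] := sol_field_exists.
pose rho c q := `|'re (vol c q)|; pose kappa q := 2^-1 * ('re (T q F) * 're (T q F)).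
have rho_s c : atlas c -> rsmooth (cdom c) (rho c).
  move=> ac; apply: smooth_all_at (cdom_open c) _ => r cr.
  pose k : C := (Num.sg ('re (vol c r)))%:C.
  apply: (smooth_at_near (f := fun r => k * ('re (vol c r))%:C)).
    by apply: filterS (norm_vol_near ac cr) => r' E; rewrite /rho E rmorphM.
  apply: (smooth_at_on (cdom_open c) cr).
  apply: (smoothM (cdom_open c) (@smooth_cst _ _ _ (cdom c) k)).
  exact: (smooth_Re (cdom_open c) (vol_smooth psh ac)).
have rho0 c r : atlas c -> cdom c r -> 0 < rho c r.
  by move=> ac cr; rewrite /rho normr_gt0 vol_re_neq0.
have rho_jac c d r : atlas c -> atlas d -> cdom c r -> cdom d r ->
    rho c r = rho d r * `|jac (fun x => cmap d (cinv c x)) (cmap c r)|.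
  move=> ac ad cr dr; rewrite /rho (vol_change psh ac ad cr dr) (vol_re ad dr) -normrM.
  by rewrite -rmorphM.
have sTF : smooth_on setT (fun r => T r F).
  have [[sT _] _ _] := reeb.
  by apply: (vfield_smooth sT) => //; [exact: openT|exact: (soliton_smooth soliton)].
have kappa_s : rsmooth setT kappa.
  apply: (@smooth_eq _ _ _ _ (fun r => 2%:R^-1 * (T r F * T r F))); first exact: openT.
    by move=> r _; rewrite /kappa (T_real r) !rmorphM fmorphV rmorph_nat.
  exact: (smoothM openT (@smooth_cst _ _ _ setT (2%:R^-1 : C)) (smoothM openT sTF sTF)).
have div c r : atlas c -> cdom c r ->
    \sum_j 'D_'e_j (fun x => rho c (cinv c x) * 're (Y0 (cinv c x) (coordf c j))) (cmap c r)
    = rho c r * kappa r.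
  move=> ac cr; have [U [Z [theta1 [Ur fr Y0E]]]] := Y0P r.
  pose k := Num.sg ('re (vol c r)).
  pose g j : func M := fun q => vol c q * fr_field T W f mu Z theta1 q (coordf c j).
  have oV : open (U `&` cdom c) by exact: openI (frame_open fr) (cdom_open c).
  have Vr : (U `&` cdom c) r by [].
  have gs j : smooth_at r (g j).
    apply: (smooth_at_on oV Vr); apply: smoothM => //.
      by apply: smooth_sub (vol_smooth psh ac) => ? [].
    apply: (vfield_smooth (fr_field_smooth soliton fr)) => //.
    by apply: smooth_sub (smooth_coord j ac) => ? [].
  have tp j := partial_tangent ac j cr.
  have E j : 'D_'e_j (fun x => rho c (cinv c x) * 're (Y0 (cinv c x) (coordf c j))) (cmap c r)
      = 're (partial c j r (fun q => k%:C * g j q)).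
    rewrite partialE; last by apply: smooth_atM => //; exact: smooth_at_cst.
    have nV : \forall q \near r, (U `&` cdom c) q by apply: open_nbhs_nbhs.
    have nE : \forall q \near r, rho c q * 're (Y0 q (coordf c j)) = 're (k%:C * g j q).
      apply: filterS2 nV (norm_vol_near ac cr) => x [Ux cx] E.
      rewrite /rho E /g (vol_re ac cx) (Y0E x Ux).
      by case: (fr_field _ _ _ _ _ _ _ _) => a b /=; rewrite !mul0r !subr0 mulrA.
    exact: (near_eq_derive _ (near_cmap cr nE)).
  rewrite (eq_bigr _ (fun j _ => E j)).
  under eq_bigr => j _ do rewrite (tangentZ k%:C (tp j) (gs j)).
  have := fr_field_divergence soliton fr ac Ur cr.
  rewrite -/(g _) => H; rewrite -raddf_sum -mulr_sumr /= H (T_real r) (vol_re ac cr).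
  have -> : (2%:R : C) = (2 : R)%:C by rewrite rmorph_nat.
  rewrite -fmorphV -!rmorphM /= /rho /kappa.
  have -> : `|'re (vol c r)| = k * 're (vol c r) by have := norm_vol_near ac cr => /nbhs_singleton.
  by rewrite mulrA.
have k0 r : 0 <= kappa r by rewrite /kappa mulr_ge0// -expr2 sqr_ge0.
have := nonneg_divergence_eq0 closedM rho_s rho0 rho_jac sY0 kappa_s div k0 q.
rewrite /kappa => /eqP; rewrite mulf_eq0 invr_eq0 pnatr_eq0 /= mulf_eq0 orbb => /eqP E.
by rewrite T_real E.
Qed.

End Soliton.

Theorem theorem1p1 (R : realType) (M : manifold R 3)
  (theta : form1 M) (J : M -> vec M -> vec M) (T : vfield M)
  (W f : M -> R) (mu : R)
  (closedM : compact [set: M])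
  (soliton : cr_yamabe_soliton theta J T W f mu) :
  (forall p : M, W p = mu) /\ (forall p : M, d0 T f p = 0).
Proof.
have f0 p : d0 T f p = 0 := reeb_derivative_eq0 closedM soliton p.
split=> // p; have := soliton_curvature soliton p.
by rewrite f0 mulr0 addr0 => -[].
Qed.
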